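(* Up to homothety and interchange of the two $2$-blocks, the metric $g_{\mathrm{bal}}$ is the unique positive asymmetric Einstein metric in the full $2+2$ ($\Gamma_{4,2}$-)fixed family on $\mathrm{SU}(18)^4/\Delta\mathrm{Sp}(9)$. The same fixed family contains exactly two symmetric Einstein metrics (up to homothety).
   Context: $H=\mathrm{SU}(18)$, $K=\mathrm{Sp}(9)$, $\mathfrak h=\mathfrak k\oplus\mathfrak q$ the Cartan decomposition, $Q=-B_{\mathfrak h}$ on each factor of $\mathfrak h^4$. The tangent space of $H^4/\Delta K$ at the origin is the $Q$-orthogonal complement of $\Delta\mathfrak k$: $\bigoplus_{i=1}^4\mathfrak q_i\oplus(V_4\otimes\mathfrak k)$, $V_4=\{t\in\mathbb R^4:\sum t_i=0\}$, $t\otimes X=(t_1X,\dots,t_4X)$. $\Gamma_{4,2}=T_4\rtimes(S_2\times S_2)$, where $T_4\cong(\mathbb Z_2)^4$ is generated by the symmetric-pair involution applied in single factors and $S_2\times S_2$ permutes factors $\{1,2\}$ and $\{3,4\}$. After homothety, the $H^4$-invariant metrics fixed by $\Gamma_{4,2}$ are exactly $(p,p,q,q;A,B,1)$, $p,q,A,B>0$: mutually orthogonal summands with scales $p,p,q,q$ (times $Q$) on $\mathfrak q_1,\dots,\mathfrak q_4$ and $A,B,1$ on $u_1\otimes\mathfrak k,u_2\otimes\mathfrak k,u_3\otimes\mathfrak k$, where $u_1=\frac1{\sqrt2}(1,-1,0,0)$, $u_2=\frac1{\sqrt2}(0,0,1,-1)$, $u_3=\frac12(1,1,-1,-1)$.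 Symmetric means $p=q$ and $A=B=1$; asymmetric means not symmetric. Interchange of the blocks is $(p,q,A,B)\mapsto(q,p,B,A)$. $g_{\mathrm{bal}}=(p,p,q,q;A,B,1)$ is the Einstein metric whose parameters $(p,q,A,B)$ form the unique solution of the Einstein equations within sup-norm distance $10^{-8}$ of $(1.237252794822,\ 1.284547470845,\ 1.039683936070,\ 0.963234095534)$. With $\rho=9/8$ the Einstein equations in this family are $r_p=r_q=r_A=r_B=r_C$, where $$r_p=\frac{8p-2A-1}{16p^2},\quad r_q=\frac{8q-2B-1}{16q^2},\quad r_A=\frac{2A^3+(8\rho-4)Ap^2+(1-2\rho)p^2}{16A^2p^2\rho},\quad r_B=\frac{2B^3+(8\rho-4)Bq^2+(1-2\rho)q^2}{16B^2q^2\rho},$$ $$r_C=\frac{2\rho-1}{8\rho}+\frac1{16\rho}\Bigl(\frac1{p^2}+\frac1{q^2}\Bigr)+\frac{2\rho-1}{32\rho}\Bigl(\frac1{A^2}+\frac1{B^2}\Bigr).$$ *)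

(* Defs.v *)
From HB Require Import structures.
From mathcomp Require Import all_boot all_order all_fingroup all_algebra.
From mathcomp Require Import complex.
From mathcomp Require Import reals.

Set Implicit Arguments.
Unset Strict Implicit.
Unset Printing Implicit Defensive.

Import Order.TTheory GRing.Theory Num.Theory.
Local Open Scope ring_scope.

(* Invariant metrics on a compact homogeneous space G/K, in Lie algebra terms: *)
(* L and k are the Lie algebras of G and K, and m is a reductive complement    *)
(* of k in L, i.e. the tangent space of G/K at the origin.  A form g on m is   *)
(* a function on the ambient space V of which only the values on m matter.     *)
Section HomogeneousSpace.
Variables (R : realType) (V : vectType R) (br : V -> V -> V).
Implicit Types (L k m U W : {vspace V}) (g : V -> V -> R) (x y z : V).

Lemma linfunE (W : vectType R) (f : V -> W) : linear f -> linfun f =1 f.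
Proof.
move=> lf x.
pose F : {linear V -> W} :=
  HB.pack f (GRing.isLinear.Build R V W *:%R f lf).
by rewrite (lfunE F).
Qed.

Lemma mem_lker_linfun (W : vectType R) (f : V -> W) :
  linear f -> forall x, (x \in lker (linfun f)) = (f x == 0).
Proof. by move=> lf x; rewrite memv_ker linfunE. Qed.

(* The trace of ad x \o ad y on L. *)
Definition killing L x y : R :=
  \sum_(i < \dim L) coord (vbasis L) i (br x (br y (vbasis L)`_i)).

Definition orthov (Q : V -> V -> R) L k : {vspace V} :=
  (L :&: \bigcap_(i < \dim k) lker (linfun (fun x => Q x (vbasis k)`_i : R^o)))%VS.

Lemma orthovP (Q : V -> V -> R) L k :
  (forall y, linear (Q^~ y : V -> R^o)) -> (forall x, linear (Q x : V -> R^o)) ->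
  forall x, reflect (x \in L /\ forall y, y \in k -> Q x y = 0)
                    (x \in orthov Q L k).
Proof.
move=> lQl lQr x; rewrite memv_cap; apply: (iffP andP) => -[xL xk]; split=> //.
  move=> y /coord_vbasis ->.
  rewrite -(linfunE (lQr x)) linear_sum big1 // => i _.
  rewrite linearZ /= (linfunE (lQr x)).
  have /subv_bigcapP/(_ i isT) : (<[x]> <= \bigcap_(i < \dim k)
      lker (linfun (fun x => Q x (vbasis k)`_i : R^o)))%VS by rewrite -memvE.
  by rewrite -memvE mem_lker_linfun // => /eqP ->; rewrite scaler0.
rewrite memvE; apply/subv_bigcapP => i _; rewrite -memvE mem_lker_linfun //.
by rewrite xk // vbasis_mem // mem_nth // size_tuple.
Qed.

Definition inner_product m g : Prop :=
  [/\ forall a x y z, x \in m -> y \in m -> z \in m ->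
        g (a *: x + y) z = a * g x z + g y z,
      forall x y, x \in m -> y \in m -> g x y = g y x
    & forall x, x \in m -> x != 0 -> 0 < g x x].

Definition invariant_under m (f : V -> V) g : Prop :=
  forall x y, x \in m -> y \in m -> g (f x) (f y) = g x y.

Definition homothetic m g g' : Prop :=
  exists2 c : R, 0 < c & forall x y, x \in m -> y \in m -> g x y = c * g' x y.

Definition orthonormal_basis m g (e : (\dim m).-tuple V) : Prop :=
  basis_of m e /\ forall i j : 'I_(\dim m), g (tnth e i) (tnth e j) = (i == j)%:R.

(* Ric(x, x) of the G-invariant metric g on G/K, for G unimodular and e a      *)
(* g-orthonormal basis of m (Besse, Einstein Manifolds, Corollary 7.38);       *)
(* daddv_pi m k is the projection of L onto m along k.  The value does not     *)
(* depend on e.                                                                *)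
Definition ricci L k m g (e : (\dim m).-tuple V) x : R :=
  let brm y z := daddv_pi m k (br y z) in
  - (2^-1 * \sum_(i < \dim m) g (brm x (tnth e i)) (brm x (tnth e i)))
  + 4^-1 * (\sum_(i < \dim m) \sum_(j < \dim m)
              g (brm (tnth e i) (tnth e j)) x ^+ 2)
  - 2^-1 * killing L x x.

(* Ric is symmetric, so Ric = lam g may be tested on the diagonal. *)
Definition einstein L k m g : Prop :=
  exists2 e : (\dim m).-tuple V, orthonormal_basis g e
    & exists lam : R, forall x, x \in m -> ricci L k g e x = lam * g x x.

End HomogeneousSpace.

(* Complex 2n x 2n matrices, as a real vector space. *)
Section ComplexMatrices.
Variables (R : realType) (n : nat).

Definition cmat : Type := 'M[R[i]]_(n + n).
HB.instance Definition _ := GRing.Zmodule.on cmat.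

Definition cmat_scale (a : R) (X : cmat) : cmat := (a%:C)%C *: (X : 'M_(n + n)).

Fact cmat_scaleA a b X : cmat_scale a (cmat_scale b X) = cmat_scale (a * b) X.
Proof. by rewrite /cmat_scale scalerA rmorphM. Qed.
Fact cmat_scale1 : left_id 1 cmat_scale.
Proof. by move=> X; rewrite /cmat_scale rmorph1 scale1r. Qed.
Fact cmat_scaleDr : right_distributive cmat_scale +%R.
Proof. by move=> a X Y; rewrite /cmat_scale scalerDr. Qed.
Fact cmat_scaleDl X : {morph cmat_scale^~ X : a b / a + b}.
Proof. by move=> a b; rewrite /cmat_scale rmorphD scalerDl. Qed.

HB.instance Definition _ := GRing.Zmodule_isLmodule.Build R cmat
  cmat_scaleA cmat_scale1 cmat_scaleDr cmat_scaleDl.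

Definition cmat_re_im (X : cmat) : 'M[R]_(n + n, (n + n) + (n + n)) :=
  row_mx (map_mx (@complex.Re R) X) (map_mx (@complex.Im R) X).

Definition cmat_of_re_im (M : 'M[R]_(n + n, (n + n) + (n + n))) : cmat :=
  \matrix_(i, j) (lsubmx M i j +i* rsubmx M i j)%C.

Fact cmat_re_im_linear : linear cmat_re_im.
Proof.
move=> a X Y; rewrite /cmat_re_im scale_row_mx add_row_mx.
congr row_mx; apply/matrixP=> i j; rewrite !mxE /=;
  case: (X i j) => x1 x2; case: (Y i j) => y1 y2 /=;
  by rewrite mul0r ?subr0 ?addr0.
Qed.

Fact cmat_re_imK : cancel cmat_re_im cmat_of_re_im.
Proof.
move=> X; apply/matrixP=> i j; rewrite mxE /cmat_re_im row_mxKl row_mxKr !mxE.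
by case: (X i j).
Qed.

Fact cmat_of_re_imK : cancel cmat_of_re_im cmat_re_im.
Proof.
move=> M; rewrite -[RHS]hsubmxK /cmat_re_im.
by congr row_mx; apply/matrixP=> i j; rewrite !mxE.
Qed.

Fact cmat_vect_axiom :
  Vector.axiom ((n + n) * ((n + n) + (n + n))) cmat.
Proof.
exists (fun X => mxvec (cmat_re_im X)).
  by move=> a X Y; rewrite cmat_re_im_linear linearP.
exists (fun v => cmat_of_re_im (vec_mx v)).
  by move=> X; rewrite mxvecK cmat_re_imK.
by move=> v; rewrite cmat_of_re_imK vec_mxK.
Qed.

HB.instance Definition _ := Lmodule_hasFinDim.Build R cmat cmat_vect_axiom.

End ComplexMatrices.

Section SU_Sp.
Variables (R : realType) (n : nat).
Implicit Types (X Y U : cmat R n).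

Definition conjmat X : cmat R n := map_mx (@conjc R) X.
Definition adjmat X : cmat R n := (conjmat X)^T.

Definition cbr X Y : cmat R n := X *m Y - Y *m X.

Definition J : cmat R n := block_mx 0 1%:M (- 1%:M) 0.

(* The involutive automorphism X |-> J \bar X J^-1 of SU(2n), and also of its  *)
(* Lie algebra, with fixed point group Sp(n).                                  *)
Definition theta X : cmat R n := J *m conjmat X *m J^T.

Definition su : {vspace cmat R n} :=
  (lker (linfun (fun X => X + adjmat X)%R)
   :&: lker (linfun (fun X => (\tr X)%:M : cmat R n)%R))%VS.

Lemma conjmat_linear : linear conjmat.
Proof.
move=> a X Y; apply/matrixP=> i j; rewrite !mxE.
by apply/eqP; case: (X i j) (Y i j) => x1 x2 [y1 y2];
  rewrite eq_complex /= !mul0r !subr0 !addr0 opprD mulrN !eqxx.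
Qed.

Lemma adjmat_linear : linear adjmat.
Proof.
move=> a X Y; rewrite /adjmat conjmat_linear.
by apply/matrixP=> i j; rewrite !mxE.
Qed.

Lemma suP X : reflect (adjmat X = - X /\ \tr X = 0) (X \in su).
Proof.
rewrite memv_cap !mem_lker_linfun; last 2 first.
- move=> a Y Z; rewrite linearP; apply/matrixP=> i j; rewrite !mxE.
  by rewrite mulrnDl mulrnAr.
- by move=> a Y Z; rewrite adjmat_linear scalerDr addrACA.
rewrite addrC addr_eq0; apply: (iffP andP) => -[/eqP aX /eqP tX].
  split=> //; case: (pickP (fun _ : 'I_(n + n) => true)) => [i _|no].
    by move: tX => /eqP/eqP/matrixP/(_ i i); rewrite !mxE eqxx.
  by rewrite /mxtrace big1 // => i; have := no i.
split=> //; rewrite (eqP tX); apply/eqP/matrixP=> i j; rewrite !mxE mul0rn //.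
Qed.

Definition Sp_group U : Prop := U *m adjmat U = 1%:M /\ U^T *m J *m U = J.

Definition sp : {vspace cmat R n} :=
  (su :&: lker (linfun (fun X => X^T *m J + J *m X : cmat R n)%R))%VS.

Lemma spP X : reflect (X \in su /\ X^T *m J + J *m X = 0) (X \in sp).
Proof.
rewrite [_ \in sp]memv_cap mem_lker_linfun; last first.
  move=> a Y Z; pose aC : R[i] := (a%:C)%C.
  have -> : (a *: Y + Z : cmat R n)^T = aC *: Y^T + Z^T :> 'M_(n + n).
    by apply/matrixP=> i j; rewrite !mxE.
  have -> : J *m (a *: Y + Z : cmat R n) = aC *: (J *m Y) + J *m Z :> 'M_(n + n).
    by rewrite scalemxAr -mulmxDr.
  rewrite mulmxDl -scalemxAl addrACA -scalerDr //.
by apply: (iffP andP) => -[-> /eqP].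
Qed.

(* The other summand of the Cartan decomposition su = sp + q. *)
Definition q_part : {vspace cmat R n} :=
  (su :&: lker (linfun (fun X => X + theta X)%R))%VS.

Lemma theta_linear : linear theta.
Proof.
move=> a X Y; rewrite /theta conjmat_linear.
by rewrite (mulmxDr J) mulmxDl -scalemxAr -scalemxAl.
Qed.

Lemma q_partP X : reflect (X \in su /\ theta X = - X) (X \in q_part).
Proof.
rewrite [_ \in q_part]memv_cap mem_lker_linfun; last first.
  by move=> a Y Z; rewrite theta_linear scalerDr addrACA.
by rewrite addrC addr_eq0; apply: (iffP andP) => -[-> /eqP].
Qed.

(* The projections of su onto sp and q_part. *)
Definition pr_k X : cmat R n := 2^-1 *: (X + theta X).
Definition pr_q X : cmat R n := 2^-1 *: (X - theta X).

Definition QH X Y : R := - killing cbr su X Y.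

(* G = SU(2n)^4, K = Sp(n) diagonally embedded. *)

Definition fourfold := {ffun 'I_4 -> cmat R n}.
Implicit Types (x y : fourfold).

Definition br4 x y : fourfold := [ffun i => cbr (x i) (y i)].

Definition su4 : {vspace fourfold} :=
  (\bigcap_(i < 4) (linfun (fun x : fourfold => x i) @^-1: su))%VS.

Lemma su4P x : reflect (forall i, x i \in su) (x \in su4).
Proof.
have xE i : (x \in (linfun (fun x : fourfold => x i) @^-1: su)%VS) = (x i \in su).
  by rewrite -memv_preim linfunE // => a y z; rewrite !ffunE.
rewrite memvE; apply: (iffP subv_bigcapP) => xsu i.
  by have := xsu i isT; rewrite -memvE xE.
by move=> _; rewrite -memvE xE.
Qed.

Definition diag X : fourfold := [ffun=> X].

Definition dsp : {vspace fourfold} := (linfun diag @: sp)%VS.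

Lemma dspP x : reflect (exists2 X, X \in sp & x = diag X) (x \in dsp).
Proof.
have diagE : linfun diag =1 diag.
  by apply: linfunE => a Y Z; apply/ffunP=> i; rewrite !ffunE.
apply: (iffP memv_imgP) => -[X Xsp xE]; exists X => //.
  by rewrite xE diagE.
by rewrite diagE.
Qed.

Definition Q4 x y : R := \sum_(i < 4) QH (x i) (y i).

Definition tangent : {vspace fourfold} := orthov Q4 su4 dsp.

Lemma cbr_linearl Y : linear (cbr^~ Y).
Proof.
move=> a X1 X2; rewrite /cbr mulmxDl mulmxDr -scalemxAl -scalemxAr.
by rewrite opprD addrACA -scalerBr.
Qed.

Lemma cbr_linearr X : linear (cbr X).
Proof.
move=> a Y1 Y2; rewrite /cbr mulmxDl mulmxDr -scalemxAl -scalemxAr.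
by rewrite opprD addrACA -scalerBr.
Qed.

Lemma Q4_linearl y : linear (Q4^~ y : fourfold -> R^o).
Proof.
move=> a x1 x2; rewrite /Q4 scaler_sumr -big_split; apply: eq_bigr => i _ /=.
rewrite /QH scalerN -opprD !ffunE scaler_sumr -big_split; congr (- _).
by apply: eq_bigr => j _; rewrite cbr_linearl linearP.
Qed.

Lemma Q4_linearr x : linear (Q4 x : fourfold -> R^o).
Proof.
move=> a y1 y2; rewrite /Q4 scaler_sumr -big_split; apply: eq_bigr => i _ /=.
rewrite /QH scalerN -opprD !ffunE scaler_sumr -big_split; congr (- _).
by apply: eq_bigr => j _; rewrite cbr_linearl cbr_linearr linearP.
Qed.

Lemma tangentP x :
  reflect (x \in su4 /\ forall X, X \in sp -> Q4 x (diag X) = 0) (x \in tangent).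
Proof.
apply: (iffP (orthovP su4 dsp Q4_linearl Q4_linearr x)) => -[xsu xsp]; split=> //.
  by move=> X Xsp; apply/xsp/dspP; exists X.
by move=> _ /dspP[X Xsp ->]; apply: xsp.
Qed.

Definition Ad4 U x : fourfold := [ffun i => U *m x i *m adjmat U].

Definition einstein4 (g : fourfold -> fourfold -> R) : Prop :=
  einstein br4 su4 dsp tangent g.

(* The element of Gamma_{4,2} which permutes the factors by s and applies the  *)
(* involution in the factors i with eps i; s is in S_2 x S_2 when it maps the  *)
(* block {0, 1} to itself.                                                     *)
Definition gamma (eps : 'I_4 -> bool) (s : 'S_4) x : fourfold :=
  [ffun i => if eps i then theta (x (s i)) else x (s i)].

Definition block_preserving (s : 'S_4) : Prop :=
  forall i : 'I_4, (s i < 2)%N = (i < 2)%N.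

(* Invariant metrics of SU(2n)^4 / Delta Sp(n) fixed by Gamma_{4,2}. *)
Definition fixed_metric (g : fourfold -> fourfold -> R) : Prop :=
  [/\ inner_product tangent g,
      forall U, Sp_group U -> invariant_under tangent (Ad4 U) g
    & forall eps s, block_preserving s ->
        invariant_under tangent (gamma eps s) g].

Definition u1 : 'rV[R]_4 := (Num.sqrt 2)^-1 *: \row_j [:: 1; -1; 0; 0]`_j.
Definition u2 : 'rV[R]_4 := (Num.sqrt 2)^-1 *: \row_j [:: 0; 0; 1; -1]`_j.
Definition u3 : 'rV[R]_4 := 2^-1 *: \row_j [:: 1; 1; -1; -1]`_j.

(* u1, u2, u3 are orthonormal, so for unit vectors u among them the component  *)
(* of x in u \otimes k is u \otimes coef u x.                                  *)
Definition coef (u : 'rV[R]_4) x : cmat R n := \sum_(i < 4) u 0 i *: pr_k (x i).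

(* The metric (p, p, q, q; A, B, 1). *)
Definition metric (p q A B : R) x y : R :=
  \sum_(i < 4) (if (i < 2)%N then p else q) * QH (pr_q (x i)) (pr_q (y i))
  + A * QH (coef u1 x) (coef u1 y)
  + B * QH (coef u2 x) (coef u2 y)
  + QH (coef u3 x) (coef u3 y).

(* Up to homothety, p = q and A = B = 1. *)
Definition symmetric_metric (g : fourfold -> fourfold -> R) : Prop :=
  exists2 p, 0 < p & homothetic tangent g (metric p p 1 1).

End SU_Sp.

(* Decimals in groups of three digits: d0 + d1 / 10^3 + d2 / 10^6 + ...  A    *)
(* numeral as large as 1237252794822 would be expanded to a unary nat.         *)
Definition decimal (R : realType) (ds : seq nat) : R :=
  foldr (fun d r => d%:R + r / 1000) 0 ds.

Definition near_bal (R : realType) (p q A B : R) : Prop :=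
  [/\ `|p - decimal R [:: 1; 237; 252; 794; 822]%N| <= (10 ^+ 8)^-1,
      `|q - decimal R [:: 1; 284; 547; 470; 845]%N| <= (10 ^+ 8)^-1,
      `|A - decimal R [:: 1; 39; 683; 936; 70]%N| <= (10 ^+ 8)^-1
    & `|B - decimal R [:: 0; 963; 234; 95; 534]%N| <= (10 ^+ 8)^-1].

(* Main.v *)
From HB Require Import structures.
Require Import Defs.
From mathcomp Require Import all_boot all_order all_algebra.
From mathcomp Require Import complex reals ring lra.

Set Implicit Arguments.
Unset Strict Implicit.
Unset Printing Implicit Defensive.

Import Order.TTheory GRing.Theory Num.Theory.
Local Open Scope ring_scope.

(** Fix the metric (p, p, q, q; A, B, 1).  Its tangent space is the sum of four
    copies of q and three copies of sp(9), and the bracket of two elements of the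
    form v (x) Z is the product of the v's tensor the bracket of the Z's.  So the
    Ricci curvature needs nothing of the symmetric pair but four Casimir
    constants, and these follow from the Killing forms of su(2n) and sp(n), here
    computed as real traces on complex matrices ([killing_su], [killing_sp],
    [casimir_su]).  Traces over the tangent space are taken over weighted frames,
    [frame_trace], rather than over orthonormal bases.  The outcome is
    [einstein_metricP], five equations with a multiplier lam.

    That the family contains all metrics fixed by the group, [fixed_metric_homothetic],
    is Schur's lemma on each of the seven summands; involutions and transpositions
    make the summands orthogonal and identify their scales.  Schur's lemma is
    proved by hand: an Sp(n)-invariant form that vanishes at one rank one element
    vanishes, because the orbit of that element under the reflections of the
    quaternionic space spans.

    For n = 9 the two equations of a block (p, A) are linear in A once the ratio
    w = p / A is fixed, and parametrise a rational curve: A, lam and the share of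
    the block in the last equation are rational functions of w.  With v = q / B
    for the other block there remain two equations, Lam w = Lam v and
    Fof w + Fof v = 0.  The numerator of Fof is a positive quartic times
    quadF = 30 w^2 - 72 w + 43, and the two roots of quadF are the symmetric
    solutions, the only ones with w = v.  If w and v differ, one of them, say w,
    lies between the roots, which bounds Fof w below and keeps v near the roots.
    Lam first decreases and then increases, so w and v lie on different branches,
    in explicit intervals ([locate]).  There Lam and the shares are monotone in
    such a way that at most one pair solves both equations ([located_unique]), and
    the intermediate value theorem along the curve Lam w = Lam v produces one
    within 10^-8 of the given decimals ([exists_bal], [exists_bal_pair]).  Every
    sign or monotonicity statement is the positivity of an integer polynomial on
    an interval with rational ends, certified by the coefficients of its Moebius
    transform ([pos_certP]). *)


(** * Traces over frames *)

Section PlainLinear.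
Variables (R : realType) (V W : lmodType R) (f : V -> W).
Hypothesis lf : linear f.

Lemma lin0 : f 0 = 0.
Proof. by have := lf (-1) 0 0; rewrite scaler0 addr0 scaleN1r addNr. Qed.

Lemma linZ a x : f (a *: x) = a *: f x.
Proof. by have := lf a x 0; rewrite addr0 lin0 addr0. Qed.

Lemma linD x y : f (x + y) = f x + f y.
Proof. by have := lf 1 x y; rewrite !scale1r. Qed.

Lemma linN x : f (- x) = - f x.
Proof. by rewrite -scaleN1r linZ scaleN1r. Qed.

Lemma linB x y : f (x - y) = f x - f y.
Proof. by rewrite linD linN. Qed.

Lemma lin_sum (I : Type) (r : seq I) (P : pred I) (F : I -> V) :
  f (\sum_(i <- r | P i) F i) = \sum_(i <- r | P i) f (F i).
Proof. exact: (big_morph f linD lin0). Qed.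

End PlainLinear.

Section Frames.
Variables (R : realType) (V : vectType R).
Implicit Types (Q b g : V -> V -> R) (U m L k : {vspace V}) (x y z : V).

Definition bilin b : Prop :=
  (forall a x y z, b (a *: x + y) z = a * b x z + b y z) /\
  (forall a x y z, b z (a *: x + y) = a * b z x + b z y).

Section BilinTheory.
Variable b : V -> V -> R.
Hypothesis bb : bilin b.

Lemma bil0l z : b 0 z = 0.
Proof. by have /(_ (-1) 0 0 z) := proj1 bb; rewrite scaler0 addr0 mulN1r addNr. Qed.

Lemma bil0r z : b z 0 = 0.
Proof. by have /(_ (-1) 0 0 z) := proj2 bb; rewrite scaler0 addr0 mulN1r addNr. Qed.

Lemma bilZl a x z : b (a *: x) z = a * b x z.
Proof. by have /(_ a x 0 z) := proj1 bb; rewrite addr0 bil0l addr0. Qed.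

Lemma bilZr a x z : b z (a *: x) = a * b z x.
Proof. by have /(_ a x 0 z) := proj2 bb; rewrite addr0 bil0r addr0. Qed.

Lemma bilDl x y z : b (x + y) z = b x z + b y z.
Proof. by have /(_ 1 x y z) := proj1 bb; rewrite scale1r mul1r. Qed.

Lemma bilDr x y z : b z (x + y) = b z x + b z y.
Proof. by have /(_ 1 x y z) := proj2 bb; rewrite scale1r mul1r. Qed.

Lemma bilNl x z : b (- x) z = - b x z.
Proof. by rewrite -scaleN1r bilZl mulN1r. Qed.

Lemma bilNr x z : b z (- x) = - b z x.
Proof. by rewrite -scaleN1r bilZr mulN1r. Qed.

Lemma bilBl x y z : b (x - y) z = b x z - b y z.
Proof. by rewrite bilDl bilNl. Qed.

Lemma bilBr x y z : b z (x - y) = b z x - b z y.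
Proof. by rewrite bilDr bilNr. Qed.

Lemma bil_suml (I : Type) (r : seq I) (P : pred I) (F : I -> V) z :
  b (\sum_(i <- r | P i) F i) z = \sum_(i <- r | P i) b (F i) z.
Proof. exact: (big_morph (b^~ z) (fun x y => bilDl x y z) (bil0l z)). Qed.

Lemma bil_sumr (I : Type) (r : seq I) (P : pred I) (F : I -> V) z :
  b z (\sum_(i <- r | P i) F i) = \sum_(i <- r | P i) b z (F i).
Proof. exact: (big_morph (b z) (fun x y => bilDr x y z) (bil0r z)). Qed.

End BilinTheory.

(** Weights spare the square roots that normalising a basis would bring in, and
    redundant families are welcome: the orthogonal projection of a frame to a
    subspace is a frame of that subspace. *)
Definition frame Q U (I : finType) (w : I -> R) (f : I -> V) : Prop :=
  (forall i, f i \in U) /\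
  (forall x, x \in U -> x = \sum_i (w i * Q x (f i)) *: f i).

(** Expanding one of the two arguments in the other frame turns each side into
    the same double sum. *)
Lemma frame_trace Q U (I J : finType) w (f : I -> V) w' (f' : J -> V) b :
  (forall x y, x \in U -> y \in U -> Q x y = Q y x) ->
  bilin b -> frame Q U w f -> frame Q U w' f' ->
  \sum_i w i * b (f i) (f i) = \sum_j w' j * b (f' j) (f' j).
Proof.
move=> sQ bb [fU fE] [f'U f'E].
transitivity (\sum_i \sum_j w i * w' j * Q (f i) (f' j) * b (f' j) (f i)).
  apply: eq_bigr => i _; rewrite {1}[f i](f'E _ (fU i)) bil_suml // mulr_sumr.
  by apply: eq_bigr => j _; rewrite bilZl //; ring.
rewrite exchange_big; apply: eq_bigr => j _ /=.
have -> : b (f' j) (f' j) =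
    b (f' j) (\sum_i (w i * Q (f' j) (f i)) *: f i) by rewrite -fE.
rewrite bil_sumr // mulr_sumr.
by apply: eq_bigr => i _; rewrite bilZr // sQ //; ring.
Qed.

Lemma frame_parseval Q U (I : finType) w (f : I -> V) x :
  bilin Q -> frame Q U w f -> x \in U -> \sum_i w i * Q x (f i) ^+ 2 = Q x x.
Proof.
move=> bQ [fU fE] xU; rewrite {3}[x](fE _ xU) bil_sumr //.
by apply: eq_bigr => i _; rewrite bilZr //; ring.
Qed.

(** The trace of an endomorphism of [L] does not see the part of the frame
    expansion outside [L], so it may be taken over a frame instead of a basis. *)
Lemma killing_frame (br : V -> V -> V) L Q (I : finType) w (f : I -> V) x y :
  (forall z, linear (br z)) -> bilin Q -> frame Q L w f ->
  (forall z, z \in L -> br x (br y z) \in L) ->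
  killing br L x y = \sum_i w i * Q (br x (br y (f i))) (f i).
Proof.
move=> lbr bQ [fL fE] TL.
pose T z := br x (br y z).
have lT : linear T by move=> a u v; rewrite /T !lbr.
pose F : {linear V -> V} := HB.pack T (GRing.isLinear.Build R V V *:%R T lT).
have TE z : br x (br y z) = F z by [].
rewrite /killing.
transitivity (\sum_(i < \dim L) \sum_j
    w j * (Q (vbasis L)`_i (f j) * coord (vbasis L) i (T (f j)))).
  apply: eq_bigr => i _.
  have biL : (vbasis L)`_i \in L.
    by rewrite vbasis_mem // mem_nth // size_tuple.
  rewrite TE [in LHS](fE _ biL) !linear_sum; apply: eq_bigr => j _.
  by rewrite !linearZ /= -mulrA.
rewrite exchange_big; apply: eq_bigr => j _ /=; rewrite -mulr_sumr; congr (_ * _).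
have TfL : T (f j) \in L by apply: TL.
rewrite -[br x (br y (f j))]/(T (f j)) [in RHS](coord_vbasis TfL) bil_suml //.
by apply: eq_bigr => i _; rewrite bilZl // mulrC.
Qed.

Definition orthonormal_seq g (s : seq V) :=
  forall i j, (i < size s)%N -> (j < size s)%N -> g s`_i s`_j = (i == j)%:R.

Lemma ex_orthonormal_basis m g : inner_product m g ->
  exists e : (\dim m).-tuple V, orthonormal_basis g e.
Proof.
move=> [gl gs gp].
have g0l z : z \in m -> g 0 z = 0.
  move=> zm; have := gl (-1) 0 0 z (mem0v _) (mem0v _) zm.
  by rewrite scaler0 addr0 mulN1r addNr.
have gDl x y z : x \in m -> y \in m -> z \in m -> g (x + y) z = g x z + g y z.
  by move=> xm ym zm; have := gl 1 x y z xm ym zm; rewrite scale1r mul1r.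
have gZl a x z : x \in m -> z \in m -> g (a *: x) z = a * g x z.
  by move=> xm zm; have := gl a x 0 z xm (mem0v _) zm; rewrite addr0 g0l // addr0.
have gZr a x z : x \in m -> z \in m -> g z (a *: x) = a * g z x.
  by move=> xm zm; rewrite gs ?memvZ // gZl // gs.
have step n : (n <= \dim m)%N ->
    exists s, [/\ size s = n, {subset s <= m}, free s & orthonormal_seq g s].
  elim: n => [_|n IHn lt_nm].
    by exists [::]; split=> //; rewrite nil_free.
  have [s [sz sm fs os]] := IHn (ltnW lt_nm).
  have sub_sm : (<<s>> <= m)%VS by apply/span_subvP.
  have lt_dim : (\dim <<s>> < \dim m)%N by rewrite (eqP fs) sz.
  have [v vm vNs] : exists2 v, v \in m & v \notin <<s>>%VS.
    case: (boolP (m <= <<s>>)%VS) => [/dimvS|/subvPn //].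
    by rewrite leqNgt lt_dim.
  have nm i : (i < size s)%N -> s`_i \in m by move=> ?; apply/sm/mem_nth.
  pose pv := \sum_(i < size s) g v s`_i *: s`_i.
  have pvs : pv \in <<s>>%VS.
    by apply: memv_suml => i _; apply/memvZ/memv_span/mem_nth.
  have pvm : pv \in m by apply: (subvP sub_sm).
  pose u := v - pv.
  have um : u \in m by rewrite rpredB.
  have uNs : u \notin <<s>>%VS by rewrite rpredBr.
  have u0 : u != 0 by apply: contraNneq uNs => ->; rewrite mem0v.
  have us i : (i < size s)%N -> g u s`_i = 0.
    move=> lis; rewrite /u -scaleN1r addrC gl ?nm // mulN1r.
    suff -> : g pv s`_i = g v s`_i by rewrite addNr.
    have sumE (r : seq 'I_(size s)) : g (\sum_(j <- r) g v s`_j *: s`_j) s`_i =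
        \sum_(j <- r) g v s`_j * (j == i :> nat)%:R.
      elim: r => [|j r IH]; first by rewrite !big_nil g0l ?nm.
      rewrite !big_cons gl ?nm // ?IH ?os //.
      by apply: memv_suml => j' _; apply/memvZ/nm.
    rewrite sumE (bigD1 (Ordinal lis)) //= eqxx mulr1 big1 ?addr0 // => j.
    by rewrite -val_eqE /= => /negPf->; rewrite mulr0.
  have gu : 0 < g u u by apply: gp.
  pose c := (Num.sqrt (g u u))^-1.
  have c0 : c != 0 by rewrite invr_eq0 gt_eqF // sqrtr_gt0.
  exists (c *: u :: s); split.
  - by rewrite /= sz.
  - by move=> x; rewrite inE => /predU1P[->|/sm //]; rewrite memvZ.
  - by rewrite free_cons fs andbT rpredZeq (negPf c0).
  - move=> [|i] [|j] //=; rewrite ?ltnS => li lj.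
    + rewrite gZl ?gZr ?memvZ // mulrA -expr2 exprVn sqr_sqrtr ?ltW // mulVf //.
      by rewrite gt_eqF.
    + by rewrite gZl ?nm // us // mulr0.
    + by rewrite gZr ?nm // gs ?nm // us // mulr0.
    + by rewrite os // eqSS.
have [s [sz sm fs os]] := step _ (leqnn _).
exists (Tuple (introT eqP sz)); split; last first.
  move=> i j; rewrite !(tnth_nth 0) /= os ?sz //.
rewrite basisEfree fs /= sz leqnn andbT; apply/span_subvP => x; exact: sm.
Qed.

Lemma orthonormal_frame m g (e : (\dim m).-tuple V) :
  inner_product m g -> orthonormal_basis g e ->
  frame g m (fun _ => 1) (fun i : 'I_(\dim m) => tnth e i).
Proof.
move=> [gl gs gp] [be oe].
have em i : tnth e i \in m by apply: (basis_mem be); apply: mem_tnth.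
split=> // x xm; rewrite {1}(coord_basis be xm).
apply: eq_bigr => i _; rewrite mul1r -(tnth_nth 0); congr (_ *: _).
have g0l z : z \in m -> g 0 z = 0.
  move=> zm; have := gl (-1) 0 0 z (mem0v _) (mem0v _) zm.
  by rewrite scaler0 addr0 mulN1r addNr.
have sumE (r : seq 'I_(\dim m)) (a : 'I_(\dim m) -> R) :
    g (\sum_(j <- r) a j *: e`_j) (tnth e i) = \sum_(j <- r) a j * (j == i)%:R.
  elim: r => [|j r IH]; first by rewrite !big_nil g0l ?em.
  rewrite !big_cons -(tnth_nth 0) gl ?em // ?IH ?oe //.
  by apply: memv_suml => j' _; rewrite -(tnth_nth 0); apply/memvZ/em.
rewrite {2}(coord_basis be xm) sumE (bigD1 i) //= eqxx mulr1 big1 ?addr0 // => j.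
by move=> /negPf->; rewrite mulr0.
Qed.

(** The Ricci curvature does not change when the metric is multiplied by a
    constant: rescale the orthonormal basis. *)
Lemma einstein_homothetic (br : V -> V -> V) L k m g g' :
  inner_product m g' -> homothetic m g g' ->
  (forall x y, linear (br x) /\ linear (br^~ y)) ->
  einstein br L k m g -> einstein br L k m g'.
Proof.
move=> [gl gs gp] [c c0 gE] lbr [e [be oe] [lam ricE]].
have g0l z : z \in m -> g' 0 z = 0.
  move=> zm; have := gl (-1) 0 0 z (mem0v _) (mem0v _) zm.
  by rewrite scaler0 addr0 mulN1r addNr.
have gZl a x z : x \in m -> z \in m -> g' (a *: x) z = a * g' x z.
  by move=> xm zm; have := gl a x 0 z xm (mem0v _) zm; rewrite addr0 g0l // addr0.
have gZr a x z : x \in m -> z \in m -> g' z (a *: x) = a * g' z x.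
  by move=> xm zm; rewrite gs ?memvZ // gZl // gs.
have brZl a x y : br (a *: x) y = a *: br x y.
  exact: (linZ (proj2 (lbr x y))).
have brZr a x y : br x (a *: y) = a *: br x y.
  exact: (linZ (proj1 (lbr x y))).
pose s := Num.sqrt c.
have s0 : s != 0 by rewrite gt_eqF // sqrtr_gt0.
have ss : s * s = c by rewrite -expr2 sqr_sqrtr // ltW.
have em i : tnth e i \in m by apply: (basis_mem be); apply: mem_tnth.
pose e' : (\dim m).-tuple V := [tuple s *: tnth e i | i < \dim m].
have e'E i : tnth e' i = s *: tnth e i by rewrite tnth_mktuple.
exists e'; first split.
- rewrite basisEdim size_tuple leqnn andbT; apply/subvP => x xm.
  rewrite (coord_basis be xm); apply: memv_suml => i _.
  rewrite -(tnth_nth 0) -[tnth e i](scalerK s0) -e'E scalerA.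
  by apply/memvZ/memv_span/mem_tnth.
- move=> i j; rewrite !e'E gZl ?memvZ // gZr // mulrA ss -gE ?em //.
exists (lam * c) => x xm; rewrite -mulrA -gE // -ricE //.
rewrite /ricci; congr (_ + _ - _).
- congr (- (_ * _)); apply: eq_bigr => i _.
  rewrite e'E brZr linearZ /= gZl ?memvZ ?memv_pi // gZr ?memv_pi // mulrA ss.
  by rewrite -gE ?memv_pi.
- congr (_ * _); apply: eq_bigr => i _; apply: eq_bigr => j _.
  rewrite !e'E brZr brZl scalerA ss linearZ /= gZl ?memv_pi //.
  by rewrite -gE ?memv_pi.
Qed.

End Frames.


(** * Complex matrices as a Euclidean space *)

Section RealPart.
Variable R : realType.
Implicit Types z t : R[i].

Definition re z : R := complex.Re z.

Lemma reD z t : re (z + t) = re z + re t.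
Proof. by case: z t => [a b] [c d]. Qed.

Lemma re0 : re 0 = 0. Proof. by []. Qed.

Lemma reN z : re (- z) = - re z.
Proof. by case: z. Qed.

Lemma reZ (a : R) z : re (a%:C%C * z) = a * re z.
Proof. by case: z => [x y] /=; rewrite mul0r subr0. Qed.

Lemma reJ z : re z^*%C = re z.
Proof. by case: z. Qed.

Lemma re_sum (I : Type) (r : seq I) (P : pred I) (F : I -> R[i]) :
  re (\sum_(i <- r | P i) F i) = \sum_(i <- r | P i) re (F i).
Proof. exact: (big_morph re reD re0). Qed.

Definition ii : R[i] := 'i%C.

Lemma iiJ : ii^*%C = - ii.
Proof. by rewrite /ii; apply/eqP; rewrite eq_complex /= oppr0 !eqxx. Qed.

Lemma iiM : ii * ii = -1.
Proof. by rewrite -expr2; apply: sqr_i. Qed.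

Lemma conjcM z t : (z * t)^*%C = z^*%C * t^*%C.
Proof. exact: (rmorphM (@conjc R)). Qed.
Lemma conjcD z t : (z + t)^*%C = z^*%C + t^*%C.
Proof. exact: (rmorphD (@conjc R)). Qed.
Lemma conjcN z : (- z)^*%C = - z^*%C.
Proof. exact: (rmorphN (@conjc R)). Qed.

End RealPart.

Section MatrixOps.
Variables (R : realType) (n : nat).
Local Notation C := R[i].
Local Notation M := 'M[C]_(n + n).
Local Notation cm := (cmat R n).
Implicit Types (X Y Z : cm) (z : C) (a : R).

Lemma scale_cmatE a (X : cm) : a *: X = (a%:C%C *: (X : M)) :> M.
Proof. by []. Qed.

Lemma adjmatD X Y : adjmat (X + Y) = adjmat X + adjmat Y.
Proof. exact: (linD (@adjmat_linear R n)). Qed.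
Lemma adjmatB X Y : adjmat (X - Y) = adjmat X - adjmat Y.
Proof. exact: (linB (@adjmat_linear R n)). Qed.
Lemma adjmatZr a X : adjmat (a *: X) = a *: adjmat X.
Proof. exact: (linZ (@adjmat_linear R n)). Qed.

Lemma adjmatZ z (X : M) : adjmat (z *: X : M) = z^*%C *: (adjmat X : M) :> M.
Proof. by apply/matrixP=> i j; rewrite !mxE conjcM. Qed.

Lemma adjmatK X : adjmat (adjmat X) = X.
Proof. by apply/matrixP=> i j; rewrite !mxE conjcK. Qed.

Lemma conjmatM X Y : conjmat (X *m Y : M) = (conjmat X : M) *m (conjmat Y : M) :> M.
Proof. exact: (map_mxM (@conjc R)). Qed.

Lemma adjmatM X Y : adjmat (X *m Y : M) = (adjmat Y : M) *m (adjmat X : M) :> M.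
Proof. by rewrite /adjmat conjmatM trmx_mul. Qed.

Lemma adjmat1 : adjmat (1%:M : M) = 1%:M :> M.
Proof. by rewrite /adjmat /conjmat map_mx1 trmx1. Qed.

Lemma tr_adj X : \tr (adjmat X : M) = (\tr (X : M))^*%C.
Proof. by rewrite /adjmat mxtrace_tr /conjmat [RHS]raddf_sum; apply: eq_bigr => i _; rewrite mxE. Qed.

Local Notation JJ := (J R n : M).

Lemma JJT : JJ *m JJ^T = 1%:M.
Proof.
rewrite /J tr_block_mx trmx0 trmx1 linearN /= trmx1 mulmx_block.
by rewrite !mulmx0 !mul0mx !mulmx1 !mulNmx !mulmxN !mulmx1 opprK !addr0 !add0r -scalar_mx_block.
Qed.

Lemma trJ : JJ^T = - JJ.
Proof.
rewrite /J tr_block_mx trmx0 trmx1 linearN /= trmx1 opp_block_mx.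
by rewrite !oppr0 opprK.
Qed.

Lemma JTJ : JJ^T *m JJ = 1%:M.
Proof. by apply: mulmx1C; apply: JJT. Qed.

Lemma JJ2 : JJ *m JJ = - 1%:M.
Proof. by have := JJT; rewrite trJ mulmxN => <-; rewrite opprK. Qed.

Lemma conjJ : conjmat (J R n) = J R n.
Proof.
rewrite /conjmat /J map_block_mx map_mx0 map_mx1.
congr block_mx; apply/matrixP=> i j; rewrite !mxE conjcN; congr (- _).
exact: conjc_nat.
Qed.

Lemma thetaD X Y : theta (X + Y) = theta X + theta Y.
Proof. exact: (linD (@theta_linear R n)). Qed.
Lemma thetaN X : theta (- X) = - theta X.
Proof. exact: (linN (@theta_linear R n)). Qed.
Lemma thetaB X Y : theta (X - Y) = theta X - theta Y.
Proof. exact: (linB (@theta_linear R n)). Qed.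
Lemma thetaZr a X : theta (a *: X) = a *: theta X.
Proof. exact: (linZ (@theta_linear R n)). Qed.

Lemma thetaZ z (X : M) : theta (z *: X : M) = z^*%C *: (theta X : M) :> M.
Proof.
rewrite /theta (_ : conjmat _ = z^*%C *: (conjmat X : M) :> M).
  by rewrite -scalemxAr -scalemxAl.
by apply/matrixP=> i j; rewrite !mxE conjcM.
Qed.

Lemma thetaM X Y : theta (X *m Y : M) = (theta X : M) *m (theta Y : M) :> M.
Proof.
rewrite /theta conjmatM -!mulmxA; congr (_ *m _); rewrite !mulmxA.
by rewrite -(mulmxA _ _ JJ) JTJ mulmx1.
Qed.

Lemma theta1 : theta (1%:M : M) = 1%:M :> M.
Proof. by rewrite /theta /conjmat map_mx1 mulmx1 JJT. Qed.

Lemma thetaK X : theta (theta X) = X.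
Proof.
rewrite {1}/theta {1}/theta !conjmatM conjJ.
have -> : conjmat (J R n)^T = JJ^T :> M by rewrite /conjmat -map_trmx [map_mx _ _]conjJ.
have -> : conjmat (conjmat X) = X by apply/matrixP=> i j; rewrite !mxE conjcK.
rewrite trJ !(mulmxN, mulNmx) opprK !mulmxA JJ2 -mulmxA JJ2.
by rewrite mulNmx mul1mx mulmxN mulmx1 opprK.
Qed.

Lemma theta_adj X : theta (adjmat X) = adjmat (theta X).
Proof.
rewrite /theta {2}/adjmat !conjmatM !trmx_mul conjJ.
have -> : conjmat (J R n)^T = JJ^T :> M by rewrite /conjmat -map_trmx [map_mx _ _]conjJ.
rewrite trmxK -mulmxA; congr (_ *m (_ *m _)).
by apply/matrixP=> i j; rewrite !mxE.
Qed.

Lemma tr_theta X : \tr (theta X : M) = (\tr (X : M))^*%C.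
Proof.
rewrite /theta mxtrace_mulC mulmxA JTJ mul1mx /conjmat [RHS]raddf_sum.
by apply: eq_bigr => i _; rewrite mxE.
Qed.

Lemma theta_br X Y : theta (cbr X Y) = cbr (theta X) (theta Y).
Proof. by rewrite /cbr thetaB !thetaM. Qed.

Lemma adj_br X Y : adjmat (cbr X Y) = - cbr (adjmat X) (adjmat Y).
Proof. by rewrite /cbr adjmatB !adjmatM opprB. Qed.

Lemma cbrC X Y : cbr X Y = - cbr Y X.
Proof. by rewrite /cbr opprB. Qed.

Definition Q0 X Y : R := re (\tr ((X : M) *m (adjmat Y : M))).

Lemma Q0C X Y : Q0 X Y = Q0 Y X.
Proof. by rewrite /Q0 -reJ -tr_adj adjmatM adjmatK. Qed.

Lemma bilin_Q0 : bilin Q0.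
Proof.
have H a X Y Z : Q0 (a *: X + Y) Z = a * Q0 X Z + Q0 Y Z.
  by rewrite /Q0 mulmxDl linearD /= reD scale_cmatE -scalemxAl linearZ reZ.
by split=> // a X Y Z; rewrite !(Q0C Z).
Qed.

Lemma Q0E X Y : Q0 X Y = \sum_i \sum_j
  (complex.Re (X i j) * complex.Re (Y i j) + complex.Im (X i j) * complex.Im (Y i j)).
Proof.
rewrite /Q0 /mxtrace re_sum; apply: eq_bigr => i _; rewrite mxE re_sum.
apply: eq_bigr => j _; rewrite !mxE /re.
by case: (X i j) (Y i j) => [x1 x2] [y1 y2] /=; rewrite mulrN opprK.
Qed.

Lemma Q0_gt0 X : X != 0 -> 0 < Q0 X X.
Proof.
move=> X0; rewrite lt_def; apply/andP; split; last first.
  by rewrite Q0E; apply: sumr_ge0 => i _; apply: sumr_ge0 => j _; rewrite -!expr2 addr_ge0 ?sqr_ge0.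
apply: contraNneq X0 => /eqP; rewrite Q0E psumr_eq0; last first.
  by move=> i _; apply: sumr_ge0 => j _; rewrite -!expr2 addr_ge0 ?sqr_ge0.
move=> /allP H; apply/eqP/matrixP=> i j; rewrite !mxE.
have := H i (mem_index_enum _); rewrite implyTb psumr_eq0; last first.
  by move=> k _; rewrite -!expr2 addr_ge0 ?sqr_ge0.
move=> /allP/(_ j (mem_index_enum _)); rewrite implyTb -!expr2 paddr_eq0 ?sqr_ge0 //.
by rewrite !sqrf_eq0 => /andP[/eqP r0 /eqP i0]; case: (X i j) r0 i0 => [x y] /= -> ->.
Qed.

Lemma Q0_adj X Y : Q0 (adjmat X) (adjmat Y) = Q0 X Y.
Proof. by rewrite /Q0 adjmatK mxtrace_mulC -/(Q0 _ _) Q0C. Qed.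

Lemma Q0_adjl X Y : Q0 (adjmat X) Y = Q0 X (adjmat Y).
Proof. by rewrite -Q0_adj adjmatK. Qed.

Lemma Q0_theta X Y : Q0 (theta X) (theta Y) = Q0 X Y.
Proof. by rewrite /Q0 -theta_adj -thetaM tr_theta reJ. Qed.

Lemma Q0_thetal X Y : Q0 (theta X) Y = Q0 X (theta Y).
Proof. by rewrite -Q0_theta thetaK. Qed.

Lemma tr_mul_br (A B D : M) :
  \tr ((A *m B - B *m A) *m D) = \tr (B *m (D *m A - A *m D)).
Proof.
rewrite mulmxBl mulmxBr !raddfB /= -!mulmxA; congr (_ - _).
by rewrite mxtrace_mulC mulmxA.
Qed.

(** This is the invariance of [Q0] on skew-Hermitian matrices, where
    [adjmat X = - X]. *)
Lemma Q0_brl X Y Z : Q0 (cbr X Y) Z = Q0 Y (cbr (adjmat X) Z).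
Proof.
rewrite /Q0 adj_br adjmatK; apply: (congr1 (@re R)).
by rewrite [in RHS]/cbr opprB; apply: tr_mul_br.
Qed.

End MatrixOps.


(** * Real traces of operators on matrices *)

(** A self-adjoint projection: expand [x] in the frame of the larger space and
    apply [P] to both sides. *)
Lemma frame_proj (R : realType) (V : vectType R) (Q : V -> V -> R)
    (W U : {vspace V}) (I : finType) (w : I -> R) (f : I -> V) (P : V -> V) :
  linear P -> (forall x, x \in W -> P x \in U) -> (forall x, x \in U -> P x = x) ->
  (U <= W)%VS -> (forall x y, x \in W -> y \in W -> Q (P x) y = Q x (P y)) ->
  frame Q W w f -> frame Q U w (P \o f).
Proof.
move=> lP PU Pid UW PQ [fW fE]; split=> [i|x xU]; first exact/PU/fW.
have xW := subvP UW _ xU.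
rewrite -{1}[x](Pid _ xU) {1}[x](fE _ xW) (lin_sum lP); apply: eq_bigr => i _ /=.
by rewrite (linZ lP) -PQ // (Pid x).
Qed.

Section Units.
Variables (R : realType) (n : nat).
Local Notation C := R[i].
Local Notation N := (n + n)%N.
Local Notation M := 'M[C]_(n + n).
Local Notation cm := (cmat R n).
Implicit Types (X Y Z : cm) (z : C) (a : R).

Definition uidx : finType := ('I_N * 'I_N * bool)%type.

Definition munit (e : uidx) : cm :=
  (if e.2 then ii R else 1) *: (delta_mx e.1.1 e.1.2 : M).

Lemma Q0_munit X (e : uidx) :
  Q0 X (munit e) =
    if e.2 then complex.Im (X e.1.1 e.1.2) else complex.Re (X e.1.1 e.1.2).
Proof.
rewrite /Q0 /munit adjmatZ -scalemxAr linearZ /=.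
have -> : \tr ((X : M) *m (adjmat (delta_mx e.1.1 e.1.2 : M) : M)) = X e.1.1 e.1.2.
  have -> : adjmat (delta_mx e.1.1 e.1.2 : M) = delta_mx e.1.2 e.1.1 :> M.
    by rewrite /adjmat /conjmat map_delta_mx trmx_delta.
  rewrite mxtrace_mulC -[delta_mx _ _]mul1mx.
  rewrite /mxtrace (bigD1 e.1.2) //= big1 => [|i /negPf ie]; last first.
    by rewrite mul1mx mxE big1 // => j _; rewrite mxE ie mul0r.
  rewrite addr0 mul1mx mxE (bigD1 e.1.1) //= mxE !eqxx mul1r big1 ?addr0 // => j /negPf je.
  by rewrite mxE je andbF mul0r.
case: e.2; first by rewrite iiJ; case: (X _ _) => x y /=; rewrite /re /=; ring.
by rewrite conjc1 mul1r.
Qed.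

Lemma sum_uidx (T : zmodType) (F : uidx -> T) :
  \sum_e F e = \sum_i \sum_j (F (i, j, true) + F (i, j, false)).
Proof.
transitivity (\sum_(p : 'I_N * 'I_N) \sum_(s : bool) F (p, s)).
  by rewrite pair_big; apply: eq_bigr => -[[i j] s].
rewrite [RHS]pair_big /=; apply: eq_bigr => -[i j] _.
by rewrite big_bool.
Qed.

Lemma frame_munit : frame (@Q0 R n) fullv (fun _ => 1) munit.
Proof.
split=> [e|X _]; first exact: memvf.
rewrite sum_uidx [LHS]matrix_sum_delta.
apply: eq_bigr => i _; apply: eq_bigr => j _.
rewrite (Q0_munit X (i, j, true)) (Q0_munit X (i, j, false)) !mul1r.
have comb (z : C) (D : M) : z *: D =
    ((complex.Im z)%:C%C *: (ii R *: D) + (complex.Re z)%:C%C *: (1 *: D)).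
  rewrite scale1r scalerA -scalerDl addrC [_ * ii R]mulrC.
  by congr (_ *: _); apply: complexE.
exact: comb.
Qed.

Definition rtr (T : cm -> cm) : R := \sum_e Q0 (T (munit e)) (munit e).

Lemma eq_rtr (T T' : cm -> cm) : T =1 T' -> rtr T = rtr T'.
Proof. by move=> eT; apply: eq_bigr => e _; rewrite eT. Qed.

Lemma rtrD (T T' : cm -> cm) : rtr (fun X => T X + T' X) = rtr T + rtr T'.
Proof. by rewrite -big_split; apply: eq_bigr => e _; rewrite (bilDl (bilin_Q0 _ _)). Qed.

Lemma rtrZ a (T : cm -> cm) : rtr (fun X => a *: T X) = a * rtr T.
Proof. by rewrite mulr_sumr; apply: eq_bigr => e _; rewrite (bilZl (bilin_Q0 _ _)). Qed.

Lemma rtrN (T : cm -> cm) : rtr (fun X => - T X) = - rtr T.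
Proof. by rewrite -sumrN; apply: eq_bigr => e _; rewrite (bilNl (bilin_Q0 _ _)). Qed.

(** Multiplication by i exchanges the two halves of the basis and reverses the
    sign of the trace. *)
Lemma rtr_antilinear (T : cm -> cm) :
  (forall X, T (ii R *: (X : M)) = - (ii R *: (T X : M)) :> M) -> rtr T = 0.
Proof.
move=> HT; rewrite /rtr sum_uidx big1 // => i _; rewrite big1 // => j _.
rewrite !Q0_munit /= {1}/munit /= HT /munit /= scale1r !mxE.
by case: (T _ i j) => x y /=; ring.
Qed.

Lemma rtr_linear (T : cm -> cm) :
  (forall X, T (ii R *: (X : M)) = ii R *: (T X : M) :> M) ->
  rtr T = 2 * re (\sum_i \sum_j (T (delta_mx i j : M)) i j).
Proof.
move=> HT; rewrite /rtr sum_uidx re_sum mulr_sumr; apply: eq_bigr => i _.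
rewrite re_sum mulr_sumr; apply: eq_bigr => j _.
rewrite !Q0_munit /= {1}/munit /= HT /munit /= scale1r !mxE /re.
by case: (T _ i j) => x y /=; ring.
Qed.

Lemma sum_delta (A B : M) :
  \sum_i \sum_j (A *m delta_mx i j *m B) i j = \tr A * \tr B.
Proof.
rewrite /mxtrace big_distrlr; apply: eq_bigr => i _; apply: eq_bigr => j _ /=.
rewrite mxE (bigD1 j) //= big1 => [|k kj]; last first.
  rewrite mxE big1 ?mul0r // => l _.
  by rewrite mxE (negPf kj) andbF mulr0.
rewrite addr0 mxE (bigD1 i) //= mxE !eqxx mulr1 big1 ?addr0 // => l li.
by rewrite mxE (negPf li) mulr0.
Qed.

Lemma sum_delta_tr (A B : M) :
  \sum_i \sum_j (A *m delta_mx j i *m B) i j = \tr (A *m B^T).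
Proof.
apply: eq_bigr => i _; rewrite mxE; apply: eq_bigr => j _.
rewrite mxE (bigD1 i) //= big1 => [|k kj]; last first.
  rewrite mxE big1 ?mul0r // => l _.
  by rewrite mxE (negPf kj) andbF mulr0.
rewrite addr0 mxE (bigD1 j) //= mxE !eqxx mulr1 big1 ?addr0 ?mxE // => l li.
by rewrite mxE (negPf li) mulr0.
Qed.

Lemma adadE X Y Z : cbr X (cbr Y Z) =
  (X *m Y) *m Z *m 1%:M - X *m Z *m Y - Y *m Z *m X + 1%:M *m Z *m (Y *m X) :> M.
Proof.
rewrite /cbr mulmxBr mulmxBl !mulmxA mulmx1 mul1mx opprB addrA.
by rewrite -!addrA; congr (_ + (_ + _)); rewrite addrC.
Qed.

(** The complex trace of [Z |-> A Z B] is [tr A tr B]; the mixed terms of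
    [ad X \o ad Y] have a factor [tr X]. *)
Lemma rtr_adad X Y : \tr (X : M) = 0 ->
  rtr (fun Z => cbr X (cbr Y Z)) = 2 * (N%:R * 2) * re (\tr ((X : M) *m (Y : M))).
Proof.
move=> tX; rewrite rtr_linear; last first.
  move=> Z; rewrite /cbr -scalemxAl -scalemxAr -scalerBr.
  by rewrite -scalemxAl -scalemxAr -scalerBr.
rewrite -mulrA; congr (_ * _).
have mD (A B : M) i j : (A + B) i j = A i j + B i j by rewrite mxE.
have mN (A : M) i j : (- A) i j = - A i j by rewrite mxE.
under eq_bigr => i _ do under eq_bigr => j _ do rewrite adadE !(mD, mN).
under eq_bigr => i _ do rewrite !big_split /= !sumrN.
rewrite !big_split /= !sumrN !sum_delta.
rewrite tX mul0r mulr0 !subr0 mxtrace1 (mxtrace_mulC Y X) mulrC -mulrDl -natrD.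
have -> : ((N + N)%:R : C) = (((N + N)%:R : R)%:C)%C by rewrite rmorph_nat.
by rewrite reZ natrD; ring.
Qed.

End Units.


(** * The Killing form of su(2n), and its restriction to sp(n) *)

Section Cartan.
Variables (R : realType) (n : nat).
Hypothesis n_gt0 : (0 < n)%N.
Local Notation C := R[i].
Local Notation N := (n + n)%N.
Local Notation M := 'M[C]_(n + n).
Local Notation cm := (cmat R n).
Local Notation su := (su R n).
Local Notation sp := (sp R n).
Local Notation qp := (q_part R n).
Implicit Types (X Y Z : cm) (z : C) (a : R).

Lemma su_adj X : X \in su -> adjmat X = - X.
Proof. by move=> /suP[]. Qed.

Lemma su_br X Y : X \in su -> Y \in su -> cbr X Y \in su.
Proof.
move=> /suP[aX _] /suP[aY _]; apply/suP; split.
  by rewrite adj_br aX aY /cbr !mulNmx !mulmxN !opprK.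
by rewrite /cbr linearB /= mxtrace_mulC subrr.
Qed.

Lemma su_theta X : X \in su -> theta X \in su.
Proof.
move=> /suP[aX tX]; apply/suP; rewrite -theta_adj aX thetaN; split=> //.
by rewrite tr_theta tX conjc0.
Qed.

Lemma spE X : (X \in sp) = (X \in su) && (theta X == X).
Proof.
apply/spP/andP => -[Xsu]; move: (Xsu) => /suP[aX _].
  have conjX : conjmat X = - (X : M)^T :> M.
    by rewrite -[conjmat X]trmxK -[(conjmat X)^T]/(adjmat X) aX linearN.
  move=> H; split=> //; apply/eqP.
  rewrite /theta conjX mulmxN mulNmx trJ mulmxN opprK -mulmxA.
  move/eqP: H; rewrite addr_eq0 => /eqP ->.
  by rewrite mulmxN mulmxA JJ2 mulNmx mul1mx opprK.
move=> /eqP H; split=> //.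
have conjX : (X : M)^T = - (conjmat X : M).
  by rewrite -[X in LHS]opprK -aX linearN /= trmxK.
rewrite conjX mulNmx -{2}H /theta !mulmxA JJ2 mulNmx mul1mx mulNmx trJ mulmxN opprK.
by rewrite addNr.
Qed.

Lemma qpE X : (X \in qp) = (X \in su) && (theta X == - X).
Proof. by apply/q_partP/andP => -[Xsu /eqP]; split=> //; apply/eqP. Qed.

Lemma sp_su X : X \in sp -> X \in su.
Proof. by rewrite spE => /andP[]. Qed.
Lemma qp_su X : X \in qp -> X \in su.
Proof. by rewrite qpE => /andP[]. Qed.
Lemma sp_theta X : X \in sp -> theta X = X.
Proof. by rewrite spE => /andP[_ /eqP]. Qed.
Lemma qp_theta X : X \in qp -> theta X = - X.
Proof. by rewrite qpE => /andP[_ /eqP]. Qed.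

Lemma br_kk X Y : X \in sp -> Y \in sp -> cbr X Y \in sp.
Proof.
rewrite !spE => /andP[Xs /eqP tX] /andP[Ys /eqP tY].
by rewrite su_br //= theta_br tX tY.
Qed.

Lemma br_qq X Y : X \in qp -> Y \in qp -> cbr X Y \in sp.
Proof.
rewrite !qpE spE => /andP[Xs /eqP tX] /andP[Ys /eqP tY].
by rewrite su_br //= theta_br tX tY /cbr !mulNmx !mulmxN !opprK.
Qed.

Lemma br_kq X Y : X \in sp -> Y \in qp -> cbr X Y \in qp.
Proof.
rewrite !qpE spE => /andP[Xs /eqP tX] /andP[Ys /eqP tY].
by rewrite su_br //= theta_br tX tY /cbr mulNmx mulmxN opprB opprK addrC.
Qed.

Lemma br_qk X Y : X \in qp -> Y \in sp -> cbr X Y \in qp.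
Proof. by move=> Xq Yk; rewrite cbrC rpredN br_kq. Qed.

Lemma pr_k_linear : linear (@pr_k R n).
Proof.
by move=> a X Y; rewrite /pr_k theta_linear addrACA -[a *: X + _]scalerDr [LHS]scalerDr !scalerA mulrC.
Qed.

Lemma pr_q_linear : linear (@pr_q R n).
Proof.
by move=> a X Y; rewrite /pr_q theta_linear opprD addrACA -[a *: X - _]scalerBr [LHS]scalerDr !scalerA mulrC.
Qed.

Lemma pr_kq X : pr_k X + pr_q X = X.
Proof.
rewrite /pr_k /pr_q -scalerDr addrACA subrr addr0 -mulr2n -scaler_nat scalerA.
by rewrite mulVf ?scale1r // pnatr_eq0.
Qed.

Lemma pr_k_sp X : X \in su -> pr_k X \in sp.
Proof.
move=> Xs; rewrite spE rpredZ ?rpredD ?su_theta //=.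
by rewrite /pr_k thetaZr thetaD thetaK addrC.
Qed.

Lemma pr_q_qp X : X \in su -> pr_q X \in qp.
Proof.
move=> Xs; rewrite qpE rpredZ ?rpredB ?su_theta //=.
by rewrite /pr_q thetaZr thetaB thetaK -scalerN opprB.
Qed.

Lemma double_half X : 2^-1 *: (X + X) = X.
Proof. by rewrite -mulr2n -scaler_nat scalerA mulVf ?scale1r // pnatr_eq0. Qed.

Lemma pr_k_id X : X \in sp -> pr_k X = X.
Proof. by move=> /sp_theta tX; rewrite /pr_k tX double_half. Qed.
Lemma pr_q_id X : X \in qp -> pr_q X = X.
Proof. by move=> /qp_theta tX; rewrite /pr_q tX opprK double_half. Qed.
Lemma pr_k0 X : X \in qp -> pr_k X = 0.
Proof. by move=> /qp_theta tX; rewrite /pr_k tX subrr scaler0. Qed.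
Lemma pr_q0 X : X \in sp -> pr_q X = 0.
Proof. by move=> /sp_theta tX; rewrite /pr_q tX subrr scaler0. Qed.

Definition skewpart X : cm := 2^-1 *: (X - adjmat X).

Definition psu X : cm :=
  skewpart X - ((\tr (skewpart X : M) / N%:R)%:M : M).

Lemma skew_linear : linear skewpart.
Proof.
by move=> a X Y; rewrite /skewpart adjmat_linear opprD addrACA -[a *: X - _]scalerBr [LHS]scalerDr !scalerA mulrC.
Qed.

Lemma psu_linear : linear psu.
Proof.
move=> a X Y; rewrite /psu skew_linear.
have -> : \tr (a *: skewpart X + skewpart Y : M) = a%:C%C * \tr (skewpart X : M) + \tr (skewpart Y : M).
  by rewrite linearD /= scale_cmatE linearZ.
rewrite scalerBr mulrDl -mulrA raddfD /= opprD addrACA; congr (_ + (_ - _)).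
by rewrite -[in LHS]scale_scalar_mx.
Qed.

(** The orthogonal projections of all matrices onto sp(n) and onto q.  For sp(n)
    the trace need not be removed, since [pr_k] kills the imaginary scalars. *)
Definition pk X : cm := pr_k (skewpart X).
Definition pq X : cm := pr_q (psu X).

Lemma skew_adj X : adjmat (skewpart X) = - skewpart X.
Proof. by rewrite /skewpart adjmatZr adjmatB adjmatK -scalerN opprB. Qed.

Lemma re_tr_skew X : (\tr (skewpart X : M))^*%C = - \tr (skewpart X : M).
Proof. by rewrite -tr_adj skew_adj linearN. Qed.

Lemma N_neq0 : (N%:R : C) != 0.
Proof. by rewrite pnatr_eq0 -lt0n addn_gt0 n_gt0. Qed.

Lemma conjc_scalar z : adjmat (z%:M : M) = (z^*%C)%:M :> M.
Proof. by rewrite -scalemx1 adjmatZ adjmat1 scalemx1. Qed.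

Lemma theta_scalar z : theta (z%:M : M) = (z^*%C)%:M :> M.
Proof. by rewrite -scalemx1 thetaZ theta1 scalemx1. Qed.

Lemma conj_divN z : z^*%C = - z -> (z / N%:R)^*%C = - (z / N%:R).
Proof. by move=> zJ; rewrite conjcM zJ conjc_inv conjc_nat mulNr. Qed.

Lemma scalar_mxN z : (- z)%:M = - z%:M :> M.
Proof. exact: raddfN. Qed.

Lemma scalar_mx0 : 0%:M = 0 :> M.
Proof. exact: raddf0. Qed.

Lemma psu_su X : psu X \in su.
Proof.
apply/suP; split.
  rewrite /psu adjmatB skew_adj conjc_scalar conj_divN ?re_tr_skew //.
  by rewrite scalar_mxN opprB opprK addrC.
rewrite /psu linearB /= mxtrace_scalar -[(_ / _) *+ _]mulr_natr mulfVK ?subrr //.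
exact: N_neq0.
Qed.

Lemma skew_id X : X \in su -> skewpart X = X.
Proof. by move=> /su_adj aX; rewrite /skewpart aX opprK double_half. Qed.

Lemma psu_id X : X \in su -> psu X = X.
Proof.
move=> Xs; rewrite /psu skew_id //; move/suP: Xs => [_ ->].
by rewrite mul0r scalar_mx0 subr0.
Qed.

Lemma pkE X : pk X = pr_k (psu X).
Proof.
rewrite /psu (linB pr_k_linear) /pk [X in _ = _ - X](_ : _ = 0) ?subr0 //.
rewrite /pr_k theta_scalar conj_divN ?re_tr_skew //.
by rewrite scalar_mxN subrr scaler0.
Qed.

Lemma Q0_skewl X Y : Q0 (skewpart X) Y = Q0 X (skewpart Y).
Proof.
have b := bilin_Q0 R n.
by rewrite /skewpart (bilZl b) (bilZr b) (bilBl b) (bilBr b) Q0_adjl.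
Qed.

Lemma Q0_scalar z Y : Q0 (z%:M : M) Y = re (z * (\tr (Y : M))^*%C).
Proof. by rewrite /Q0 mul_scalar_mx linearZ /= tr_adj. Qed.

Lemma Q0_psul X Y : Q0 (psu X) Y = Q0 X (psu Y).
Proof.
have b := bilin_Q0 R n.
rewrite /psu (bilBl b) (bilBr b) Q0_skewl; congr (_ - _).
rewrite [LHS]Q0_scalar [RHS]Q0C [RHS]Q0_scalar.
have trE Z : \tr (skewpart Z : M) = (0 +i* complex.Im (\tr (Z : M)))%C.
  have -> : \tr (skewpart Z : M) = (2^-1)%:C%C * (\tr (Z : M) - (\tr (Z : M))^*%C).
    by rewrite /skewpart scale_cmatE linearZ linearB /= tr_adj.
  case: (\tr _) => x y; apply/eqP; rewrite eq_complex /= !mul0r !subr0 !addr0.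
  by apply/andP; split; apply/eqP; [rewrite subrr mulr0 | lra].
have NE : (N%:R^-1 : C) = ((N%:R^-1 : R)%:C)%C by rewrite fmorphV rmorph_nat.
rewrite !trE NE; case: (\tr (X : M)) (\tr (Y : M)) => [x1 x2] [y1 y2].
by rewrite /re /=; ring.
Qed.

Lemma frame_su : frame (@Q0 R n) su (fun _ => 1) (psu \o @munit R n).
Proof.
apply: (frame_proj psu_linear _ psu_id (subvf _) _ (@frame_munit R n)) => [x _|x y _ _].
  exact: psu_su.
exact: Q0_psul.
Qed.

Lemma Q0_pr_kl X Y : Q0 (pr_k X) Y = Q0 X (pr_k Y).
Proof.
have b := bilin_Q0 R n.
by rewrite /pr_k (bilZl b) (bilZr b) (bilDl b) (bilDr b) Q0_thetal.
Qed.

Lemma Q0_pr_ql X Y : Q0 (pr_q X) Y = Q0 X (pr_q Y).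
Proof.
have b := bilin_Q0 R n.
by rewrite /pr_q (bilZl b) (bilZr b) (bilBl b) (bilBr b) Q0_thetal.
Qed.

Lemma pk_linear : linear pk.
Proof. by move=> a X Y; rewrite /pk skew_linear pr_k_linear. Qed.

Lemma pq_linear : linear pq.
Proof. by move=> a X Y; rewrite /pq psu_linear pr_q_linear. Qed.

Lemma pk_sp X : pk X \in sp.
Proof. by rewrite pkE pr_k_sp ?psu_su. Qed.

Lemma pq_qp X : pq X \in qp.
Proof. by rewrite pr_q_qp ?psu_su. Qed.

Lemma pk_id X : X \in sp -> pk X = X.
Proof. by move=> Xk; rewrite pkE psu_id ?sp_su ?pr_k_id. Qed.

Lemma pq_id X : X \in qp -> pq X = X.
Proof. by move=> Xq; rewrite /pq psu_id ?qp_su ?pr_q_id. Qed.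

Lemma Q0_pkl X Y : Q0 (pk X) Y = Q0 X (pk Y).
Proof.
suff -> : pk Y = skewpart (pr_k Y) by rewrite /pk Q0_pr_kl Q0_skewl.
rewrite /pk /pr_k /skewpart adjmatZr -scalerBr thetaZr -scalerDr !scalerA thetaB.
by rewrite theta_adj adjmatD opprD addrACA.
Qed.

Lemma pr_q_psu Y : pr_q (psu Y) = psu (pr_q Y).
Proof.
suff H : theta (psu Y) = psu (theta Y).
  by rewrite /pr_q H (linZ psu_linear) (linB psu_linear).
have sE : theta (skewpart Y) = skewpart (theta Y).
  by rewrite /skewpart thetaZr thetaB theta_adj.
by rewrite /psu thetaB sE theta_scalar conjcM conjc_inv conjc_nat -sE tr_theta.
Qed.

Lemma Q0_pql X Y : Q0 (pq X) Y = Q0 X (pq Y).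
Proof.
exact: etrans (Q0_pr_ql _ _) (etrans (Q0_psul _ _) (congr1 (Q0 X) (esym (pr_q_psu Y)))).
Qed.

(** The trace over su(2n) is the real trace over all matrices of
    [ad X \o ad Y \o psu].  In [psu] the scalar part is killed by [ad Y] and the
    part with the adjoint is antilinear, so has no real trace; what remains is
    half of the real trace of the complex linear [ad X \o ad Y]. *)
Lemma killing_su X Y : X \in su -> Y \in su ->
  killing (@cbr R n) su X Y = - (2 * N%:R) * Q0 X Y.
Proof.
move=> Xs Ys.
rewrite (killing_frame (@cbr_linearr R n) (bilin_Q0 R n) frame_su); last first.
  by move=> Z Zs; rewrite !su_br.
have tX : \tr (X : M) = 0 by move/suP: Xs => [].
have [T TdE] : {T : cm -> cm | forall Z, T Z = cbr X (cbr Y Z)}.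
  by exists (fun Z => cbr X (cbr Y Z)).
have linT : linear T by move=> a U V; rewrite !TdE !cbr_linearr.
have Ts z : T (z%:M : M) = 0.
  by rewrite TdE {2}/cbr scalar_mxC subrr (lin0 (@cbr_linearr R n X)).
have Ti Z : T (ii R *: (Z : M) : M) = ii R *: (T Z : M) :> M.
  by rewrite !TdE /cbr -!(scalemxAl, scalemxAr) -!scalerBr -!(scalemxAl, scalemxAr) -!scalerBr.
have TE Z : T (psu Z) = 2^-1 *: (T Z + - T (adjmat Z)).
  by rewrite (linB linT) Ts subr0 (linZ linT) (linB linT).
transitivity (rtr (fun Z => 2^-1 *: (T Z + - T (adjmat Z)))).
  apply: eq_bigr => e _; rewrite mul1r /= -Q0_psul psu_id; last first.
    by rewrite !su_br // psu_su.
  by rewrite -TdE TE.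
rewrite rtrZ rtrD rtrN (eq_rtr TdE) rtr_adad // [X in _ - X]rtr_antilinear; last first.
  by move=> Z; rewrite adjmatZ iiJ scaleNr (linN linT) Ti.
rewrite /Q0 (su_adj Ys) mulmxN linearN /= reN; by field.
Qed.

Lemma QHE X Y : X \in su -> Y \in su -> QH X Y = 2 * N%:R * Q0 X Y.
Proof. by move=> Xs Ys; rewrite /QH killing_su // mulNr opprK. Qed.

Lemma bilin_QH : bilin (@QH R n).
Proof.
have comb d a (F G H : 'I_d -> R) : (forall i, F i = a * G i + H i) ->
    - \sum_i F i = a * - (\sum_i G i) + - \sum_i H i.
  by move=> FE; rewrite (eq_bigr _ (fun i _ => FE i)) big_split -mulr_sumr opprD mulrN.
split=> a X Y Z; apply: comb => i; first by rewrite cbr_linearl linearP.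
by rewrite cbr_linearl cbr_linearr linearP.
Qed.

(** [theta (adjmat Z)] is the complex linear [J Z^T J^T]; the transposition turns
    the traces of [Z |-> A Z B] into [tr (A B^T)], and elements of sp(n) absorb
    the two factors [J]. *)
Lemma rtr_theta_adj X Y : X \in sp -> Y \in sp ->
  rtr (fun Z => cbr X (cbr Y (theta (adjmat Z)))) =
  - 8 * re (\tr ((X : M) *m (Y : M))).
Proof.
move=> Xk Yk.
rewrite rtr_linear; last first.
  move=> Z; rewrite adjmatZ thetaZ conjcK /cbr.
  by rewrite -!(scalemxAl, scalemxAr) -!scalerBr -!(scalemxAl, scalemxAr) -!scalerBr.
have mD (A B : M) i j : (A + B) i j = A i j + B i j by rewrite mxE.
have mN (A : M) i j : (- A) i j = - A i j by rewrite mxE.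
pose JJ : M := J R n.
have ZE i j : theta (adjmat (delta_mx i j : M)) = JJ *m delta_mx j i *m JJ^T :> M.
  by rewrite /theta /adjmat /conjmat map_delta_mx trmx_delta map_delta_mx.
have sE (A B : M) : \sum_i \sum_j (A *m (JJ *m delta_mx j i *m JJ^T) *m B) i j =
    \tr (A *m JJ *m B^T *m JJ).
  transitivity (\sum_i \sum_j ((A *m JJ) *m delta_mx j i *m (JJ^T *m B)) i j).
    by apply: eq_bigr => i _; apply: eq_bigr => j _; rewrite !mulmxA.
  by rewrite sum_delta_tr trmx_mul trmxK !mulmxA.
have spJ (Z : cm) : Z \in sp -> JJ *m (Z : M)^T *m JJ = Z.
  move=> /spP[_ /eqP]; rewrite addr_eq0 => /eqP H.
  by rewrite -mulmxA H mulmxN mulmxA JJ2 mulNmx mul1mx opprK.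
under eq_bigr => i _ do under eq_bigr => j _ do rewrite adadE !(mD, mN) ZE.
under eq_bigr => i _ do rewrite !big_split /= !sumrN.
rewrite !big_split /= !sumrN !sE trmx1 mulmx1 -mulmxA JJ2.
rewrite -!(mulmxA (X : M)) -!(mulmxA (Y : M)) (spJ X) // (spJ Y) // mul1mx.
have -> : JJ *m (Y *m X)^T *m JJ = - (X *m Y) :> M.
  rewrite trmx_mul -[Y in RHS]spJ // -[X in RHS]spJ // !mulmxA.
  by rewrite -(mulmxA _ JJ JJ) JJ2 mulmxN mulmx1 mulNmx mulNmx opprK.
rewrite (mxtrace_mulC (Y : M)) !mulmxN mulmx1 !linearN /= !reD !reN; ring.
Qed.

(** The Casimir constant of the adjoint representation of sp(n), with respect to
    the Killing form of su(2n). *)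
Definition cas : R := (N%:R + 2) / (2 * N%:R).

(** As for su(2n), but the projection onto sp(n) has four terms: two of them are
    antilinear, the two others have the traces computed above. *)
Lemma killing_sp X Y : X \in sp -> Y \in sp ->
  \sum_e Q0 (cbr X (cbr Y (pk (@munit R n e)))) (pk (@munit R n e)) =
  - (N%:R + 2) * Q0 X Y.
Proof.
move=> Xk Yk.
have tX : \tr (X : M) = 0 by move/sp_su/suP: Xk => [].
have [T TdE] : {T : cm -> cm | forall Z, T Z = cbr X (cbr Y Z)}.
  by exists (fun Z => cbr X (cbr Y Z)).
have linT : linear T by move=> a U V; rewrite !TdE !cbr_linearr.
have Ti Z : T (ii R *: (Z : M) : M) = ii R *: (T Z : M) :> M.
  by rewrite !TdE /cbr -!(scalemxAl, scalemxAr) -!scalerBr -!(scalemxAl, scalemxAr) -!scalerBr.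
have TE Z : T (pk Z) = (2^-1 * 2^-1) *:
    ((T Z + - T (adjmat Z)) + (T (theta Z) + - T (theta (adjmat Z)))).
  rewrite /pk /pr_k /skewpart thetaZr -scalerDr scalerA thetaB (linZ linT).
  by rewrite (linD linT) !(linB linT).
transitivity (rtr (fun Z => (2^-1 * 2^-1) *:
    ((T Z + - T (adjmat Z)) + (T (theta Z) + - T (theta (adjmat Z)))))).
  apply: eq_bigr => e _; rewrite -Q0_pkl pk_id; last by rewrite !br_kk ?pk_sp.
  by rewrite -TdE TE.
have TtE Z : T (theta (adjmat Z)) = cbr X (cbr Y (theta (adjmat Z))) by [].
have rtrBB (T1 T2 T3 T4 : cm -> cm) c :
    rtr (fun Z => c *: ((T1 Z + - T2 Z) + (T3 Z + - T4 Z)))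
    = c * ((rtr T1 + - rtr T2) + (rtr T3 + - rtr T4)).
  by rewrite rtrZ !rtrD !rtrN.
rewrite (rtrBB T (T \o @adjmat R n) (T \o @theta R n)
               (fun Z => T (theta (adjmat Z)))).
rewrite (etrans (eq_rtr TdE) (rtr_adad Y tX)).
rewrite (etrans (eq_rtr TtE) (rtr_theta_adj Xk Yk)).
rewrite rtr_antilinear; last first.
  by move=> Z; rewrite /= adjmatZ iiJ scaleNr (linN linT) Ti.
rewrite rtr_antilinear; last first.
  by move=> Z; rewrite /= thetaZ iiJ scaleNr (linN linT) Ti.
rewrite /Q0 (su_adj (sp_su Yk)) mulmxN linearN /= reN; by field.
Qed.

End Cartan.


(** * Casimir constants *)

HB.lock Definition kf (R : realType) (n : nat) (e : uidx n) : cmat R n :=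
  pk (@munit R n e).
HB.lock Definition qf (R : realType) (n : nat) (e : uidx n) : cmat R n :=
  pq (@munit R n e).

Section Casimir.
Variables (R : realType) (n : nat).
Hypothesis n_gt0 : (0 < n)%N.
Local Notation C := R[i].
Local Notation N := (n + n)%N.
Local Notation M := 'M[C]_(n + n).
Local Notation cm := (cmat R n).
Local Notation su := (su R n).
Local Notation sp := (sp R n).
Local Notation qp := (q_part R n).
Implicit Types (X Y Z : cm) (z : C) (a : R).

Definition wH : R := (2 * N%:R)^-1.

Local Notation kf := (@kf R n).
Local Notation qf := (@qf R n).

Lemma twoN_gt0 : 0 < 2 * N%:R :> R.
Proof. by rewrite mulr_gt0 // ltr0n addn_gt0 n_gt0. Qed.

Lemma frame_rescale (U : {vspace cm}) (f : uidx n -> cm) :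
  (U <= su)%VS -> frame (@Q0 R n) U (fun _ => 1) f ->
  frame (@QH R n) U (fun _ => wH) f.
Proof.
move=> Us [fU fE]; split=> // x xU; rewrite {1}[x](fE _ xU).
apply: eq_bigr => e _; rewrite QHE ?(subvP Us) // mul1r.
by rewrite mulrA /wH mulVf ?mul1r // gt_eqF // twoN_gt0.
Qed.

Lemma kf_sp e : kf e \in sp.
Proof. by rewrite kf.unlock; apply: pk_sp. Qed.

Lemma qf_qp e : qf e \in qp.
Proof. by rewrite qf.unlock; apply: pq_qp. Qed.

Lemma frame_kf : frame (@QH R n) sp (fun _ => wH) kf.
Proof.
rewrite kf.unlock; apply: frame_rescale; first by apply/subvP => x /sp_su.
apply: (@frame_proj _ _ _ fullv _ _ _ (@munit R n) (@pk R n)).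
- exact: pk_linear.
- by move=> x _; exact: pk_sp.
- exact: pk_id.
- exact: subvf.
- by move=> x y _ _; exact: Q0_pkl.
- exact: frame_munit.
Qed.

Lemma frame_qf : frame (@QH R n) qp (fun _ => wH) qf.
Proof.
rewrite qf.unlock; apply: frame_rescale; first by apply/subvP => x /qp_su.
apply: (@frame_proj _ _ _ fullv _ _ _ (@munit R n) (@pq R n)).
- exact: pq_linear.
- by move=> x _; exact: pq_qp.
- exact: pq_id.
- exact: subvf.
- by move=> x y _ _; exact: Q0_pql.
- exact: frame_munit.
Qed.

Lemma frame_suH : frame (@QH R n) su (fun _ => wH) (@psu R n \o @munit R n).
Proof. exact: (frame_rescale (subvv _) (frame_su R n_gt0)). Qed.

Lemma QHC X Y : X \in su -> Y \in su -> QH X Y = QH Y X.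
Proof. by move=> Xs Ys; rewrite !QHE // Q0C. Qed.

Lemma QH_gt0 X : X \in su -> X != 0 -> 0 < QH X X.
Proof. by move=> Xs X0; rewrite QHE // mulr_gt0 ?twoN_gt0 ?Q0_gt0. Qed.

Lemma QH_eq0 X : X \in su -> QH X X = 0 -> X = 0.
Proof. by move=> Xs /eqP; apply: contraTeq => X0; rewrite gt_eqF ?QH_gt0. Qed.

Lemma QH_kq X Y : X \in sp -> Y \in qp -> QH X Y = 0.
Proof.
move=> Xk Yq; rewrite (QHE n_gt0 (sp_su Xk) (qp_su Yq)).
have H : Q0 X Y = - Q0 X Y.
  by rewrite -{1}Q0_theta sp_theta // qp_theta // (bilNr (bilin_Q0 R n)).
suff -> : Q0 X Y = 0 by rewrite mulr0.
by lra.
Qed.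

Lemma QH_qk X Y : X \in qp -> Y \in sp -> QH X Y = 0.
Proof. by move=> Xq Yk; rewrite (QHC (qp_su Xq) (sp_su Yk)) QH_kq. Qed.

Lemma QH_br X Y Z : X \in su -> Y \in su -> Z \in su ->
  QH (cbr X Y) Z = - QH Y (cbr X Z).
Proof.
move=> Xs Ys Zs; rewrite !QHE ?su_br // Q0_brl su_adj // -mulrN; congr (_ * _).
rewrite -(bilNr (bilin_Q0 R n)); congr (Q0 _ _).
by rewrite /cbr mulNmx mulmxN opprB opprK addrC.
Qed.

Lemma QH_br2 X Y : X \in su -> Y \in su ->
  QH (cbr X Y) (cbr X Y) = - QH (cbr X (cbr X Y)) Y.
Proof. by move=> Xs Ys; rewrite [in RHS]QHC ?QH_br ?su_br // ?opprK // -QHC ?su_br. Qed.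

(** The sum of |[f, X]|^2 over a frame is the same for every frame of the space;
    over su(2n) it is the Killing form. *)
Lemma casimir_su X : X \in su ->
  \sum_e wH * QH (cbr X (kf e)) (cbr X (kf e)) +
  \sum_e wH * QH (cbr X (qf e)) (cbr X (qf e)) = QH X X.
Proof.
move=> Xs; have bQ := bilin_QH R n.
have bb : bilin (fun Y Z => QH (cbr X Y) (cbr X Z)).
  by split=> a U V W; rewrite cbr_linearr; [apply: (proj1 bQ) | apply: (proj2 bQ)].
pose f (s : uidx n + uidx n) : cm := match s with inl e => kf e | inr e => qf e end.
have frf : frame (@QH R n) su (fun _ => wH) f.
  split=> [[e|e]|x xs] /=; [exact/sp_su/kf_sp | exact/qp_su/qf_qp |].
  rewrite big_sumType /= -{1}[x]pr_kq.
  have [[_ Ek] [_ Eq]] := (frame_kf, frame_qf).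
  rewrite {1}[pr_k x]Ek ?pr_k_sp // {1}[pr_q x]Eq ?pr_q_qp //.
  congr (_ + _); apply: eq_bigr => e _.
    rewrite -[in RHS](pr_kq x) (bilDl bQ) (@QH_qk (pr_q x)) ?addr0 ?pr_q_qp //.
    exact: kf_sp.
  rewrite -[in RHS](pr_kq x) (bilDl bQ) (@QH_kq (pr_k x)) ?add0r ?pr_k_sp //.
  exact: qf_qp.
have sQ x y : x \in su -> y \in su -> QH x y = QH y x by apply: QHC.
have := frame_trace sQ bb frf frame_suH.
rewrite big_sumType /= => ->.
transitivity (- \sum_e wH * QH (cbr X (cbr X (psu (@munit R n e)))) (psu (@munit R n e))).
  rewrite -sumrN; apply: eq_bigr => e _; have es := psu_su n_gt0 (@munit R n e).
  exact: etrans (congr1 ( *%R wH) (QH_br2 Xs es)) (mulrN _ _).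
rewrite -(@killing_frame R cm (@cbr R n) su (@QH R n) _ (fun _ => wH) _ X X) //.
- exact: (cbr_linearr (n := n)).
- exact: frame_suH.
- by move=> Z Zs; rewrite !su_br.
Qed.

Lemma casimir_kk X : X \in sp ->
  \sum_e wH * QH (cbr X (kf e)) (cbr X (kf e)) = cas R n * QH X X.
Proof.
move=> Xk; have Xs := sp_su Xk.
have kfs e : kf e \in su by apply/sp_su/kf_sp.
transitivity (- (\sum_e Q0 (cbr X (cbr X (kf e))) (kf e))).
  rewrite -sumrN; apply: eq_bigr => e _; rewrite QH_br2 // QHE ?su_br // mulrN.
  by rewrite mulrA /wH mulVf ?mul1r // gt_eqF // twoN_gt0.
rewrite kf.unlock (killing_sp n_gt0) // QHE // /cas; field.
by rewrite -natrD pnatr_eq0 -lt0n addn_gt0 n_gt0.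
Qed.

Lemma casimir_kq X : X \in sp ->
  \sum_e wH * QH (cbr X (qf e)) (cbr X (qf e)) = (1 - cas R n) * QH X X.
Proof.
move=> Xk.
have aux (x y c q : R) : x + y = q -> x = c * q -> y = (1 - c) * q.
  by move=> E E'; rewrite mulrBl mul1r -E' -E addrAC subrr add0r.
exact: aux (casimir_su (sp_su Xk)) (casimir_kk Xk).
Qed.

(** [ad X] exchanges sp(n) and q, so both sides are the sum of the squares of its
    matrix coefficients between the two. *)
Lemma casimir_q_swap X : X \in qp ->
  \sum_e wH * QH (cbr X (kf e)) (cbr X (kf e)) =
  \sum_e wH * QH (cbr X (qf e)) (cbr X (qf e)).
Proof.
move=> Xq; have Xs := qp_su Xq; have bQ := bilin_QH R n.
have kfk e : kf e \in sp by apply: kf_sp.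
have qfq e : qf e \in qp by apply: qf_qp.
transitivity (\sum_e \sum_e' wH * wH * QH (cbr X (kf e)) (qf e') ^+ 2).
  apply: eq_bigr => e _; rewrite -(frame_parseval bQ frame_qf) ?br_qk //.
  by rewrite mulr_sumr; apply: eq_bigr => e' _; rewrite mulrA.
rewrite exchange_big; apply: eq_bigr => e' _ /=.
rewrite -(frame_parseval bQ frame_kf) ?br_qq // mulr_sumr.
apply: eq_bigr => e _.
have [ks qs] := (sp_su (kfk e), qp_su (qfq e')).
have E : QH (cbr X (kf e)) (qf e') ^+ 2 = QH (cbr X (qf e')) (kf e) ^+ 2.
  by rewrite QH_br // sqrrN QHC // su_br.
exact: etrans (congr1 (fun t => wH * wH * t) E) (esym (mulrA wH wH _)).
Qed.

Lemma casimir_qk X : X \in qp ->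
  \sum_e wH * QH (cbr X (kf e)) (cbr X (kf e)) = 2^-1 * QH X X.
Proof.
move=> Xq.
have aux (x y q : R) : x + y = q -> x = y -> x = 2^-1 * q by lra.
exact: aux (casimir_su (qp_su Xq)) (casimir_q_swap Xq).
Qed.

Lemma casimir_qq X : X \in qp ->
  \sum_e wH * QH (cbr X (qf e)) (cbr X (qf e)) = 2^-1 * QH X X.
Proof. by move=> Xq; rewrite -(casimir_q_swap Xq); exact: casimir_qk. Qed.

End Casimir.


(** * The Ricci curvature of a fourfold symmetric pair *)

Definition i0 : 'I_4 := @Ordinal 4 0 isT.
Definition i1 : 'I_4 := @Ordinal 4 1 isT.
Definition i2 : 'I_4 := @Ordinal 4 2 isT.
Definition i3 : 'I_4 := @Ordinal 4 3 isT.

Lemma sum4 (T : nmodType) (F : 'I_4 -> T) :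
  \sum_i F i = F i0 + F i1 + F i2 + F i3.
Proof.
rewrite !big_ord_recl big_ord0 addr0 !addrA.
by congr (F _ + F _ + F _ + F _); apply: val_inj.
Qed.

Lemma forall4 (P : 'I_4 -> Prop) : P i0 -> P i1 -> P i2 -> P i3 -> forall i, P i.
Proof.
by move=> P0 P1 P2 P3 [[|[|[|[|m]]]] lt_i4] //;
  [move: P0 | move: P1 | move: P2 | move: P3]; congr P; apply: val_inj.
Qed.

Section FourfoldRicci.
Variables (R : realType) (H : vectType R) (br : H -> H -> H) (Q : H -> H -> R).
Variables (k q : {vspace H}) (prk prq : H -> H).
Hypothesis br_linl : forall y, linear (br^~ y).
Hypothesis br_linr : forall x, linear (br x).
Hypothesis bQ : bilin Q.
Hypothesis Qsym : forall x y, x \in (k + q)%VS -> y \in (k + q)%VS -> Q x y = Q y x.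
Hypothesis prk_lin : linear prk.
Hypothesis prq_lin : linear prq.
Hypothesis prk_k : forall x, x \in k -> prk x = x.
Hypothesis prk_q : forall x, x \in q -> prk x = 0.
Hypothesis prq_k : forall x, x \in k -> prq x = 0.
Hypothesis prq_q : forall x, x \in q -> prq x = x.
Hypothesis brkk : forall x y, x \in k -> y \in k -> br x y \in k.
Hypothesis brkq : forall x y, x \in k -> y \in q -> br x y \in q.
Hypothesis brqk : forall x y, x \in q -> y \in k -> br x y \in q.
Hypothesis brqq : forall x y, x \in q -> y \in q -> br x y \in k.
Variables (I : finType) (w c : R) (kf qf : I -> H).
Hypothesis kfk : forall e, kf e \in k.
Hypothesis qfq : forall e, qf e \in q.
Hypothesis cas_kk : forall x, x \in k ->
  \sum_e w * Q (br x (kf e)) (br x (kf e)) = c * Q x x.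
Hypothesis cas_kq : forall x, x \in k ->
  \sum_e w * Q (br x (qf e)) (br x (qf e)) = (1 - c) * Q x x.
Hypothesis cas_qk : forall x, x \in q ->
  \sum_e w * Q (br x (kf e)) (br x (kf e)) = 2^-1 * Q x x.
Hypothesis cas_qq : forall x, x \in q ->
  \sum_e w * Q (br x (qf e)) (br x (qf e)) = 2^-1 * Q x x.
Hypothesis dcas_kk : forall x, x \in k ->
  \sum_e \sum_e' w * w * Q (br (kf e) (kf e')) x ^+ 2 = c * Q x x.
Hypothesis dcas_qq : forall x, x \in k ->
  \sum_e \sum_e' w * w * Q (br (qf e) (qf e')) x ^+ 2 = (1 - c) * Q x x.
Hypothesis dcas_kq : forall x, x \in q ->
  \sum_e \sum_e' w * w * Q (br (kf e) (qf e')) x ^+ 2 = 2^-1 * Q x x.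
Hypothesis dcas_qk : forall x, x \in q ->
  \sum_e \sum_e' w * w * Q (br (qf e) (kf e')) x ^+ 2 = 2^-1 * Q x x.

Local Notation H4 := {ffun 'I_4 -> H}.
Implicit Types (x y z : H4) (Z : H) (v : seq R).

Definition ten v Z : H4 := [ffun i : 'I_4 => v`_i *: Z].
Definition brf x y : H4 := [ffun i => br (x i) (y i)].
Definition mulv v v' : seq R :=
  [:: v`_0 * v'`_0; v`_1 * v'`_1; v`_2 * v'`_2; v`_3 * v'`_3].

Variables (p r A B : R).
Hypotheses (p0 : p != 0) (r0 : r != 0) (A0 : A != 0) (B0 : B != 0).

(** The form (p, p, r, r; A, B, 1) on the whole fourfold space.  It only sees
    differences of the k-components, so its kernel is the diagonal copy of k:
    projecting along that copy, as the curvature formula demands, changes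
    nothing. *)
Definition fourmetric x y : R :=
  p * (Q (prq (x i0)) (prq (y i0)) + Q (prq (x i1)) (prq (y i1)))
  + r * (Q (prq (x i2)) (prq (y i2)) + Q (prq (x i3)) (prq (y i3)))
  + A / 2 * Q (prk (x i0) - prk (x i1)) (prk (y i0) - prk (y i1))
  + B / 2 * Q (prk (x i2) - prk (x i3)) (prk (y i2) - prk (y i3))
  + 4^-1 * Q (prk (x i0) + prk (x i1) - (prk (x i2) + prk (x i3)))
             (prk (y i0) + prk (y i1) - (prk (y i2) + prk (y i3))).
Local Notation G := fourmetric.

(** The element of m with q-components X0, ..., X3 and with the k-component
    having u1, u2, u3 coordinates proportional to a, b, s. *)
Definition vec (X0 X1 X2 X3 a b s : H) : H4 :=
  [ffun i : 'I_4 => nth 0 [:: X0 + 2^-1 *: (s + a); X1 + 2^-1 *: (s - a);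
     X2 + 2^-1 *: (b - s); X3 + 2^-1 *: (- b - s)] i].

Section Curvature.
Variables (X0 X1 X2 X3 a b s : H).
Hypotheses (X0q : X0 \in q) (X1q : X1 \in q) (X2q : X2 \in q) (X3q : X3 \in q).
Hypotheses (ak : a \in k) (bk : b \in k) (sk : s \in k).
Local Notation x := (vec X0 X1 X2 X3 a b s).

(** The vectors that represent the linear form [G (ten v Z) x] of [Z], for [Z] in
    k and for [Z] in q. *)
Definition kpart (v : seq R) : H :=
  (A / 2 * (v`_0 - v`_1)) *: a + (B / 2 * (v`_2 - v`_3)) *: b
  + (2^-1 * (v`_0 + v`_1 - v`_2 - v`_3)) *: s.
Definition qpart (v : seq R) : H :=
  (p * v`_0) *: X0 + (p * v`_1) *: X1 + (r * v`_2) *: X2 + (r * v`_3) *: X3.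

Lemma kpart_k v : kpart v \in k.
Proof. by rewrite !rpredD ?rpredZ. Qed.

Lemma qpart_q v : qpart v \in q.
Proof. by rewrite !rpredD ?rpredZ. Qed.

Lemma vec_prq (i : 'I_4) : prq (x i) = nth 0 [:: X0; X1; X2; X3] i.
Proof.
elim/forall4: i; rewrite ffunE /= (linD prq_lin) prq_q // prq_k ?addr0 //.
all: by rewrite rpredZ // ?rpredD ?rpredB ?rpredN.
Qed.

Lemma vec_prk (i : 'I_4) : prk (x i) =
  nth 0 [:: 2^-1 *: (s + a); 2^-1 *: (s - a); 2^-1 *: (b - s); 2^-1 *: (- b - s)] i.
Proof.
elim/forall4: i; rewrite ffunE /= (linD prk_lin) prk_q // prk_k ?add0r //.
all: by rewrite rpredZ // ?rpredD ?rpredB ?rpredN.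
Qed.

Lemma half_sum (u u' : H) : 2^-1 *: (u + u') + 2^-1 *: (u - u') = u.
Proof.
rewrite -scalerDr addrACA subrr addr0 -mulr2n -scaler_nat scalerA mulVf ?scale1r //.
by rewrite pnatr_eq0.
Qed.

Lemma half_diff (u u' : H) : 2^-1 *: (u + u') - 2^-1 *: (u - u') = u'.
Proof. by rewrite -scalerN opprB [u + u']addrC half_sum. Qed.

Lemma fourmetric_vecr z : G z x =
  p * (Q (prq (z i0)) X0 + Q (prq (z i1)) X1)
  + r * (Q (prq (z i2)) X2 + Q (prq (z i3)) X3)
  + A / 2 * Q (prk (z i0) - prk (z i1)) a
  + B / 2 * Q (prk (z i2) - prk (z i3)) b
  + 2^-1 * Q (prk (z i0) + prk (z i1) - (prk (z i2) + prk (z i3))) s.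
Proof.
rewrite /fourmetric !vec_prq !vec_prk /= half_diff.
have -> : 2^-1 *: (b - s) - 2^-1 *: (- b - s) = b.
  by rewrite [b - s]addrC [- b - s]addrC half_diff.
have -> : 2^-1 *: (s + a) + 2^-1 *: (s - a) - (2^-1 *: (b - s) + 2^-1 *: (- b - s)) = 2 *: s.
  rewrite half_sum [b - s]addrC [- b - s]addrC half_sum opprK.
  by rewrite -mulr2n -scaler_nat.
rewrite (bilZr bQ); congr (_ + _); rewrite mulrA; congr (_ * _); by field.
Qed.

Lemma fourmetric_vec_ten_k v Z : Z \in k -> G (ten v Z) x = Q Z (kpart v).
Proof.
move=> Zk; rewrite fourmetric_vecr !ffunE /= !prq_k ?rpredZ // !prk_k ?rpredZ //.
rewrite !(bil0l bQ) !(addr0, mulr0) add0r -!scalerBl -!scalerDl -scalerBl !(bilZl bQ).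
by rewrite /kpart !(bilDr bQ) !(bilZr bQ); ring.
Qed.

Lemma fourmetric_vec_ten_q v Z : Z \in q -> G (ten v Z) x = Q Z (qpart v).
Proof.
move=> Zq; rewrite fourmetric_vecr !ffunE /= !prk_q ?rpredZ // !prq_q ?rpredZ //.
rewrite !(subrr, addr0) !(bil0l bQ) !(addr0, mulr0) !(bilZl bQ).
by rewrite /qpart !(bilDr bQ) !(bilZr bQ); ring.
Qed.

Lemma brf_ten v v' Z Z' : brf (ten v Z) (ten v' Z') = ten (mulv v v') (br Z Z').
Proof.
apply/ffunP; elim/forall4; rewrite !ffunE /= (linZ (br_linl _)) (linZ (br_linr _)) scalerA //.
Qed.

(** A bracket of two frame vectors is again of the form [ten v Z], so the double
    sums reduce to those over the symmetric pair. *)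
Lemma dtrace_kk v v' :
  \sum_e \sum_e' w * w * G (brf (ten v (kf e)) (ten v' (kf e'))) x ^+ 2 =
  c * Q (kpart (mulv v v')) (kpart (mulv v v')).
Proof.
rewrite -dcas_kk ?kpart_k //; apply: eq_bigr => e _; apply: eq_bigr => e' _.
by rewrite brf_ten fourmetric_vec_ten_k // brkk.
Qed.

Lemma dtrace_qq v v' :
  \sum_e \sum_e' w * w * G (brf (ten v (qf e)) (ten v' (qf e'))) x ^+ 2 =
  (1 - c) * Q (kpart (mulv v v')) (kpart (mulv v v')).
Proof.
rewrite -dcas_qq ?kpart_k //; apply: eq_bigr => e _; apply: eq_bigr => e' _.
by rewrite brf_ten fourmetric_vec_ten_k // brqq.
Qed.

Lemma dtrace_kq v v' :
  \sum_e \sum_e' w * w * G (brf (ten v (kf e)) (ten v' (qf e'))) x ^+ 2 =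
  2^-1 * Q (qpart (mulv v v')) (qpart (mulv v v')).
Proof.
rewrite -dcas_kq ?qpart_q //; apply: eq_bigr => e _; apply: eq_bigr => e' _.
by rewrite brf_ten fourmetric_vec_ten_q // brkq.
Qed.

Lemma dtrace_qk v v' :
  \sum_e \sum_e' w * w * G (brf (ten v (qf e)) (ten v' (kf e'))) x ^+ 2 =
  2^-1 * Q (qpart (mulv v v')) (qpart (mulv v v')).
Proof.
rewrite -dcas_qk ?qpart_q //; apply: eq_bigr => e _; apply: eq_bigr => e' _.
by rewrite brf_ten fourmetric_vec_ten_q // brqk.
Qed.

Definition xi (i : nat) : H :=
  nth 0 [:: 2^-1 *: (s + a); 2^-1 *: (s - a); 2^-1 *: (b - s); 2^-1 *: (- b - s)] i.

Local Arguments xi : simpl never.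

Lemma xik i : xi i \in k.
Proof.
rewrite /xi; case: i => [|[|[|[|i]]]] /=; last by rewrite nth_nil mem0v.
all: by rewrite rpredZ // ?rpredD ?rpredB ?rpredN.
Qed.

Lemma vecE (i : 'I_4) : x i = nth 0 [:: X0; X1; X2; X3] i + xi i.
Proof. by elim/forall4: i; rewrite ffunE. Qed.

Lemma Xq (i : nat) : nth 0 [:: X0; X1; X2; X3] i \in q.
Proof. by case: i => [|[|[|[|i]]]] /=; rewrite ?nth_nil ?mem0v. Qed.

Lemma bracket_prk_k v Z (i : 'I_4) : Z \in k ->
  prk (brf x (ten v Z) i) = br (v`_i *: xi i) Z.
Proof.
move=> Zk; rewrite ffunE vecE [ten v Z i]ffunE (linZ (br_linr _)) (linD (br_linl _)).
by rewrite (linZ prk_lin) (linD prk_lin) prk_q ?brqk ?Xq // prk_k ?brkk ?xik // add0r (linZ (br_linl _)).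
Qed.

Lemma bracket_prq_k v Z (i : 'I_4) : Z \in k ->
  prq (brf x (ten v Z) i) = br (v`_i *: nth 0 [:: X0; X1; X2; X3] i) Z.
Proof.
move=> Zk; rewrite ffunE vecE [ten v Z i]ffunE (linZ (br_linr _)) (linD (br_linl _)).
by rewrite (linZ prq_lin) (linD prq_lin) prq_q ?brqk ?Xq // prq_k ?brkk ?xik // addr0 (linZ (br_linl _)).
Qed.

Lemma bracket_prk_q v Z (i : 'I_4) : Z \in q ->
  prk (brf x (ten v Z) i) = br (v`_i *: nth 0 [:: X0; X1; X2; X3] i) Z.
Proof.
move=> Zk; rewrite ffunE vecE [ten v Z i]ffunE (linZ (br_linr _)) (linD (br_linl _)).
by rewrite (linZ prk_lin) (linD prk_lin) prk_k ?brqq ?Xq // prk_q ?brkq ?xik // addr0 (linZ (br_linl _)).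
Qed.

Lemma bracket_prq_q v Z (i : 'I_4) : Z \in q ->
  prq (brf x (ten v Z) i) = br (v`_i *: xi i) Z.
Proof.
move=> Zk; rewrite ffunE vecE [ten v Z i]ffunE (linZ (br_linr _)) (linD (br_linl _)).
by rewrite (linZ prq_lin) (linD prq_lin) prq_k ?brqq ?Xq // prq_q ?brkq ?xik // add0r (linZ (br_linl _)).
Qed.

Definition nrm Z := Q Z Z.

Definition qform (f : nat -> H) (v : seq R) : R :=
  p * (nrm (v`_0 *: f 0%N) + nrm (v`_1 *: f 1%N))
  + r * (nrm (v`_2 *: f 2) + nrm (v`_3 *: f 3)).
Definition kform (f : nat -> H) (v : seq R) : R :=
  A / 2 * nrm (v`_0 *: f 0%N - v`_1 *: f 1%N)
  + B / 2 * nrm (v`_2 *: f 2 - v`_3 *: f 3)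
  + 4^-1 * nrm (v`_0 *: f 0%N + v`_1 *: f 1%N - (v`_2 *: f 2 + v`_3 *: f 3)).

Lemma trace_k v : \sum_e w * G (brf x (ten v (kf e))) (brf x (ten v (kf e))) =
  2^-1 * qform (nth 0 [:: X0; X1; X2; X3]) v + c * kform xi v.
Proof.
have [nb nbE] : {nb : H -> I -> R |
    forall Z e, nb Z e = w * Q (br Z (kf e)) (br Z (kf e))}.
  by exists (fun Z e => w * Q (br Z (kf e)) (br Z (kf e))).
transitivity (\sum_e
  (p * (nb (v`_0 *: X0) e + nb (v`_1 *: X1) e)
  + r * (nb (v`_2 *: X2) e + nb (v`_3 *: X3) e)
  + A / 2 * nb (v`_0 *: xi 0 - v`_1 *: xi 1) e
  + B / 2 * nb (v`_2 *: xi 2 - v`_3 *: xi 3) e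
  + 4^-1 * nb (v`_0 *: xi 0 + v`_1 *: xi 1 - (v`_2 *: xi 2 + v`_3 *: xi 3)) e)).
  apply: eq_bigr => e _; rewrite /fourmetric !bracket_prk_k // !bracket_prq_k //.
  rewrite -!(linB (br_linl _)) -!(linD (br_linl _)) -!(linB (br_linl _)) !nbE /=.
  by ring.
have mq u Z : Z \in q -> u *: Z \in q by apply: rpredZ.
have mk u i : u *: xi i \in k by rewrite rpredZ // xik.
have kA : v`_0 *: xi 0 - v`_1 *: xi 1 \in k by rewrite rpredB ?mk.
have kB : v`_2 *: xi 2 - v`_3 *: xi 3 \in k by rewrite rpredB ?mk.
have kC : v`_0 *: xi 0 + v`_1 *: xi 1 - (v`_2 *: xi 2 + v`_3 *: xi 3) \in k.
  by rewrite rpredB ?rpredD ?mk.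
rewrite !big_split /= -!mulr_sumr !big_split /=.
have nq Z (Zq : Z \in q) : \sum_e nb Z e = 2^-1 * Q Z Z.
  by rewrite -cas_qk //; apply: eq_bigr => e _; rewrite nbE.
have nk Z (Zk : Z \in k) : \sum_e nb Z e = c * Q Z Z.
  by rewrite -cas_kk //; apply: eq_bigr => e _; rewrite nbE.
rewrite !(nq _ (mq _ _ X0q), nq _ (mq _ _ X1q), nq _ (mq _ _ X2q), nq _ (mq _ _ X3q)).
rewrite (nk _ kA) (nk _ kB) (nk _ kC).
by rewrite /qform /kform /nrm /=; ring.
Qed.

Lemma trace_q v : \sum_e w * G (brf x (ten v (qf e))) (brf x (ten v (qf e))) =
  (1 - c) * qform xi v + 2^-1 * kform (nth 0 [:: X0; X1; X2; X3]) v.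
Proof.
have [nb nbE] : {nb : H -> I -> R |
    forall Z e, nb Z e = w * Q (br Z (qf e)) (br Z (qf e))}.
  by exists (fun Z e => w * Q (br Z (qf e)) (br Z (qf e))).
transitivity (\sum_e
  (p * (nb (v`_0 *: xi 0) e + nb (v`_1 *: xi 1) e)
  + r * (nb (v`_2 *: xi 2) e + nb (v`_3 *: xi 3) e)
  + A / 2 * nb (v`_0 *: X0 - v`_1 *: X1) e
  + B / 2 * nb (v`_2 *: X2 - v`_3 *: X3) e
  + 4^-1 * nb (v`_0 *: X0 + v`_1 *: X1 - (v`_2 *: X2 + v`_3 *: X3)) e)).
  apply: eq_bigr => e _; rewrite /fourmetric !bracket_prk_q // !bracket_prq_q //.
  rewrite -!(linB (br_linl _)) -!(linD (br_linl _)) -!(linB (br_linl _)) !nbE /=.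
  by ring.
have mq u Z : Z \in q -> u *: Z \in q by apply: rpredZ.
have mk u i : u *: xi i \in k by rewrite rpredZ // xik.
have kA : v`_0 *: X0 - v`_1 *: X1 \in q by rewrite rpredB ?mq.
have kB : v`_2 *: X2 - v`_3 *: X3 \in q by rewrite rpredB ?mq.
have kC : v`_0 *: X0 + v`_1 *: X1 - (v`_2 *: X2 + v`_3 *: X3) \in q.
  by rewrite rpredB ?rpredD ?mq.
rewrite !big_split /= -!mulr_sumr !big_split /=.
have nq Z (Zq : Z \in q) : \sum_e nb Z e = 2^-1 * Q Z Z.
  by rewrite -cas_qq //; apply: eq_bigr => e _; rewrite nbE.
have nk Z (Zk : Z \in k) : \sum_e nb Z e = (1 - c) * Q Z Z.
  by rewrite -cas_kq //; apply: eq_bigr => e _; rewrite nbE.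
rewrite !(nk _ (mk _ _)) (nq _ kA) (nq _ kB) (nq _ kC).
by rewrite /qform /kform /nrm /=; ring.
Qed.

Lemma nrmZ u Z : nrm (u *: Z) = u ^+ 2 * nrm Z.
Proof. by rewrite /nrm (bilZl bQ) (bilZr bQ); ring. Qed.

Lemma nrmD Z Z' : Z \in (k + q)%VS -> Z' \in (k + q)%VS ->
  nrm (Z + Z') = nrm Z + nrm Z' + 2 * Q Z Z'.
Proof.
move=> Zh Zh'; rewrite /nrm (bilDl bQ) !(bilDr bQ) (Qsym Zh' Zh); ring.
Qed.

Lemma k_kq Z : Z \in k -> Z \in (k + q)%VS.
Proof. by apply: subvP; apply: addvSl. Qed.

Lemma q_kq Z : Z \in q -> Z \in (k + q)%VS.
Proof. by apply: subvP; apply: addvSr. Qed.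

Lemma nrm_kpart v : nrm (kpart v) =
  (A / 2 * (v`_0 - v`_1)) ^+ 2 * nrm a + (B / 2 * (v`_2 - v`_3)) ^+ 2 * nrm b
  + (2^-1 * (v`_0 + v`_1 - v`_2 - v`_3)) ^+ 2 * nrm s
  + 2 * (A / 2 * (v`_0 - v`_1)) * (B / 2 * (v`_2 - v`_3)) * Q a b
  + 2 * (A / 2 * (v`_0 - v`_1)) * (2^-1 * (v`_0 + v`_1 - v`_2 - v`_3)) * Q a s
  + 2 * (B / 2 * (v`_2 - v`_3)) * (2^-1 * (v`_0 + v`_1 - v`_2 - v`_3)) * Q b s.
Proof.
rewrite /kpart !nrmD ?k_kq ?rpredD ?rpredZ // !nrmZ (bilDl bQ) !(bilZl bQ) !(bilZr bQ).
ring.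
Qed.

(** The frame of the tangent space: copies of a frame of q on the four factors,
    of a frame of k along multiples of u1, u2 and u3.  The weights [wq] and [wk]
    are the inverses of the squared lengths. *)
Definition vq (i : nat) : seq R :=
  nth [::] [:: [:: 1; 0; 0; 0]; [:: 0; 1; 0; 0]; [:: 0; 0; 1; 0]; [:: 0; 0; 0; 1]] i.
Definition vk (j : nat) : seq R :=
  nth [::] [:: [:: 1; -1; 0; 0]; [:: 0; 0; 1; -1]; [:: 1; 1; -1; -1]] j.
Definition wq (i : nat) : R := nth 0 [:: p^-1; p^-1; r^-1; r^-1] i.
Definition wk (j : nat) : R := nth 0 [:: (2 * A)^-1; (2 * B)^-1; 4^-1] j.

Lemma sum_kk : \sum_(i < 3) \sum_(j < 3)
    wk i * wk j * (c * nrm (kpart (mulv (vk i) (vk j)))) =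
  c * ((16 * A ^+ 2)^-1 * (4 * nrm s) + (16 * B ^+ 2)^-1 * (4 * nrm s)
       + A / 4 * nrm a + B / 4 * nrm b).
Proof.
under eq_bigr => i _ do under eq_bigr => j _ do rewrite nrm_kpart.
rewrite !big_ord_recl !big_ord0 /wk /vk /mulv /=.
by field; rewrite A0 B0.
Qed.

Lemma sum_qq : \sum_(i < 4) \sum_(j < 4)
    wq i * wq j * ((1 - c) * nrm (kpart (mulv (vq i) (vq j)))) =
  (1 - c) * (2^-1 * (p ^+ 2)^-1 * (A ^+ 2 * nrm a + nrm s)
             + 2^-1 * (r ^+ 2)^-1 * (B ^+ 2 * nrm b + nrm s)).
Proof.
under eq_bigr => i _ do under eq_bigr => j _ do rewrite nrm_kpart.
rewrite !big_ord_recl !big_ord0 /wq /vq /mulv /=.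
by field; rewrite p0 r0.
Qed.

Lemma nrm_qpart_vq i v : (i < 4)%N -> nrm (qpart (mulv (vq i) v)) =
  (nth 0 [:: p; p; r; r] i * v`_i) ^+ 2 * nrm (nth 0 [:: X0; X1; X2; X3] i).
Proof.
rewrite /qpart /mulv /vq.
case: i => [|[|[|[|i]]]] //= _; rewrite !mul0r !mulr0 !scale0r !(addr0, add0r) nrmZ; ring.
Qed.

Lemma mulvC v v' : mulv v v' = mulv v' v.
Proof. by congr [:: _; _; _; _]; apply: mulrC. Qed.

Lemma sum_qk : \sum_(i < 4) \sum_(j < 3)
    wq i * wk j * (2^-1 * nrm (qpart (mulv (vq i) (vk j)))) =
  2^-1 * (p * ((2 * A)^-1 + 4^-1) * (nrm X0 + nrm X1)
          + r * ((2 * B)^-1 + 4^-1) * (nrm X2 + nrm X3)).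
Proof.
rewrite !big_ord_recl !big_ord0 !nrm_qpart_vq // /wq /wk /vk /=.
by field; rewrite p0 r0 A0 B0.
Qed.

Lemma nrm_xi : [/\ nrm (xi 0) = 4^-1 * (nrm s + nrm a + 2 * Q s a),
    nrm (xi 1) = 4^-1 * (nrm s + nrm a - 2 * Q s a),
    nrm (xi 2) = 4^-1 * (nrm s + nrm b - 2 * Q b s) &
    nrm (xi 3) = 4^-1 * (nrm s + nrm b + 2 * Q b s)].
Proof.
have N Z : nrm (- Z) = nrm Z by rewrite /nrm (bilNl bQ) (bilNr bQ) opprK.
split; rewrite /xi /= nrmZ nrmD ?N ?k_kq ?rpredN // ?(bilNl bQ) ?(bilNr bQ); by field.
Qed.

Lemma qform_vq f i : (i < 4)%N ->
  qform f (vq i) = nth 0 [:: p; p; r; r] i * nrm (f i).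
Proof.
have n0 : nrm 0 = 0 by rewrite /nrm (bil0l bQ).
rewrite /qform /vq.
case: i => [|[|[|[|i]]]] //= _; rewrite !scale0r !scale1r !n0; ring.
Qed.

Lemma kform_vq f i : (i < 4)%N ->
  kform f (vq i) = nth 0 [:: A / 2; A / 2; B / 2; B / 2] i * nrm (f i)
                   + 4^-1 * nrm (f i).
Proof.
have n0 : nrm 0 = 0 by rewrite /nrm (bil0l bQ).
have N Z : nrm (- Z) = nrm Z by rewrite /nrm (bilNl bQ) (bilNr bQ) opprK.
rewrite /kform /vq.
case: i => [|[|[|[|i]]]] //= _;
  rewrite !scale0r !scale1r !(addr0, add0r, oppr0, N) !n0; ring.
Qed.

Lemma kform_xi_vk : [/\
  kform xi (vk 0) = A / 2 * nrm s + 4^-1 * nrm a,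
  kform xi (vk 1) = B / 2 * nrm s + 4^-1 * nrm b &
  kform xi (vk 2) = A / 2 * nrm a + B / 2 * nrm b].
Proof.
have n0 : nrm 0 = 0 by rewrite /nrm (bil0l bQ).
have N Z : nrm (- Z) = nrm Z by rewrite /nrm (bilNl bQ) (bilNr bQ) opprK.
have e23s : xi 2 + xi 3 = - s.
  by rewrite /xi /= -scalerDr addrACA subrr add0r -opprD scalerN -mulr2n -scaler_nat scalerA mulVf ?scale1r // pnatr_eq0.
have e23d : xi 2 - xi 3 = b.
  by rewrite /xi /= [b - s]addrC [- b - s]addrC half_diff.
rewrite /kform /vk; split=> /=;
  rewrite ?scale0r ?scaleN1r ?scale1r ?opprK ?(addr0, add0r, oppr0, N) ?n0.
- by rewrite /xi /= half_sum half_diff; ring.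
- by rewrite e23s e23d N; ring.
- have -> : - xi 2 + xi 3 = - b by rewrite -e23d opprB addrC.
  have -> : xi 0 + xi 1 - (- xi 2 - xi 3) = 0.
    by rewrite -opprD opprK e23s /xi /= half_sum subrr.
  by rewrite /xi /= half_diff N n0; ring.
Qed.

Lemma sum_T1 :
  \sum_(i < 4) wq i * ((1 - c) * qform xi (vq i)
      + 2^-1 * kform (nth 0 [:: X0; X1; X2; X3]) (vq i))
  + \sum_(j < 3) wk j * (2^-1 * qform (nth 0 [:: X0; X1; X2; X3]) (vk j)
      + c * kform xi (vk j)) =
  (1 - c) * (nrm s + 2^-1 * nrm a + 2^-1 * nrm b)
  + 2^-1 * ((A / 2 + 4^-1) / p * (nrm X0 + nrm X1)
            + (B / 2 + 4^-1) / r * (nrm X2 + nrm X3))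
  + 2^-1 * (p * ((2 * A)^-1 + 4^-1) * (nrm X0 + nrm X1)
            + r * ((2 * B)^-1 + 4^-1) * (nrm X2 + nrm X3))
  + c * (2^-1 * nrm s + (8 * A)^-1 * nrm a + (8 * B)^-1 * nrm b
         + A / 8 * nrm a + B / 8 * nrm b).
Proof.
have [x0 x1 x2 x3] := nrm_xi; have [k0 k1 k2] := kform_xi_vk.
rewrite !big_ord_recl !big_ord0 !qform_vq // !kform_vq // /= x0 x1 x2 x3 k0 k1 k2.
rewrite /qform /vk /= !nrmZ /wq /wk /=.
by field; rewrite p0 r0 A0 B0.
Qed.

End Curvature.

Local Notation J := ((I * 'I_4) + (I * 'I_3))%type.

Definition mframe (j : J) : H4 :=
  match j with
  | inl (e, i) => ten (vq i) (qf e)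
  | inr (e, i) => ten (vk i) (kf e)
  end.

Definition mweight (j : J) : R :=
  match j with
  | inl (e, i) => w * wq i
  | inr (e, i) => w * wk i
  end.

Lemma sum_mframe (T : nmodType) (F : J -> T) :
  \sum_j F j = \sum_(i < 4) \sum_e F (inl (e, i)) + \sum_(i < 3) \sum_e F (inr (e, i)).
Proof.
rewrite big_sumType /=; congr (_ + _).
  rewrite exchange_big /= pair_big /=; apply: eq_bigr => -[e i] _ //.
rewrite exchange_big /= pair_big /=; apply: eq_bigr => -[e i] _ //.
Qed.

Lemma fourmetric_bilin : bilin G.
Proof.
have Dq u (x y : H4) i : prq ((u *: x + y) i) = u *: prq (x i) + prq (y i).
  by rewrite !ffunE (linD prq_lin) (linZ prq_lin).
have Dk u (x y : H4) i : prk ((u *: x + y) i) = u *: prk (x i) + prk (y i).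
  by rewrite !ffunE (linD prk_lin) (linZ prk_lin).
have sB (u : R) (x y x' y' : H) : u *: x + y - (u *: x' + y') = u *: (x - x') + (y - y').
  by rewrite opprD addrACA -scalerBr.
have sD (u : R) (x y x' y' : H) : u *: x + y + (u *: x' + y') = u *: (x + x') + (y + y').
  by rewrite addrACA -scalerDr.
split=> u x y z; rewrite /fourmetric !Dq !Dk !(sB, sD).
  by rewrite !(proj1 bQ); ring.
by rewrite !(proj2 bQ); ring.
Qed.

Lemma fourmetric_symm x y :
  (forall i, prk (x i) \in k) -> (forall i, prq (x i) \in q) ->
  (forall i, prk (y i) \in k) -> (forall i, prq (y i) \in q) -> G x y = G y x.
Proof.
move=> xk xq yk yq; rewrite /fourmetric.
rewrite !(fun i => Qsym (q_kq (xq i)) (q_kq (yq i))); congr (_ + _ * _ + _ * _ + _ * _).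
- by rewrite Qsym ?rpredB ?k_kq.
- by rewrite Qsym ?rpredB ?k_kq.
- by rewrite Qsym ?rpredB ?rpredD ?k_kq.
Qed.

Variable m : {vspace H4}.
Hypothesis m_vec : forall x, x \in m ->
  exists X0 X1 X2 X3 a b s,
    [/\ [/\ X0 \in q, X1 \in q, X2 \in q & X3 \in q],
        [/\ a \in k, b \in k & s \in k] & x = vec X0 X1 X2 X3 a b s].
Hypothesis m_ten_q : forall v Z, Z \in q -> ten v Z \in m.
Hypothesis m_ten_k : forall v Z, Z \in k ->
  v`_0 + v`_1 + v`_2 + v`_3 = 0 -> ten v Z \in m.
Hypothesis kf_frame : forall Z, Z \in k -> Z = \sum_e (w * Q Z (kf e)) *: kf e.
Hypothesis qf_frame : forall Z, Z \in q -> Z = \sum_e (w * Q Z (qf e)) *: qf e.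

Lemma m_prk x i : x \in m -> prk (x i) \in k.
Proof.
move=> /m_vec[X0 [X1 [X2 [X3 [a [b [s [[X0q X1q X2q X3q] [ak bk sk] ->]]]]]]]].
by elim/forall4: i; rewrite vec_prk //= ?rpredZ // ?rpredD ?rpredB ?rpredN.
Qed.

Lemma m_prq x i : x \in m -> prq (x i) \in q.
Proof.
move=> /m_vec[X0 [X1 [X2 [X3 [a [b [s [[X0q X1q X2q X3q] [ak bk sk] ->]]]]]]]].
by elim/forall4: i; rewrite vec_prq.
Qed.

Lemma fourmetric_sym x y : x \in m -> y \in m -> G x y = G y x.
Proof. by move=> xm ym; apply: fourmetric_symm => i; rewrite ?m_prk ?m_prq. Qed.

Lemma ten_lin v : linear (ten v).
Proof.
move=> u Z Z'; apply/ffunP => i; rewrite !ffunE scalerDr !scalerA.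
by rewrite mulrC.
Qed.

Lemma vec_tens X0 X1 X2 X3 a b s : vec X0 X1 X2 X3 a b s =
  ten (vq 0) X0 + ten (vq 1) X1 + ten (vq 2) X2 + ten (vq 3) X3
  + (ten (vk 0) (2^-1 *: a) + ten (vk 1) (2^-1 *: b) + ten (vk 2) (2^-1 *: s)).
Proof.
apply/ffunP; elim/forall4; rewrite !ffunE /= ?scale0r ?scale1r ?scaleN1r ?(addr0, add0r);
  congr (_ + _); rewrite -?scalerN -scalerDr //; congr (_ *: _); by rewrite addrC.
Qed.

Lemma frame_mframe : frame G m mweight mframe.
Proof.
have Fm j : mframe j \in m.
  case: j => -[e [i lti]] /=; first by rewrite m_ten_q.
  by rewrite m_ten_k //; case: i lti => [|[|[|i]]] //= _; rewrite /vk /=; ring.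
split=> // x xm.
have [X0 [X1 [X2 [X3 [a [b [s [[X0q X1q X2q X3q] [ak bk sk] xE]]]]]]]] := m_vec xm.
have Gq i e : (i < 4)%N -> G x (ten (vq i) (qf e)) =
    nth 0 [:: p; p; r; r] i * Q (nth 0 [:: X0; X1; X2; X3] i) (qf e).
  move=> lti; rewrite fourmetric_sym ?m_ten_q // xE fourmetric_vec_ten_q //.
  rewrite Qsym ?q_kq ?qpart_q // /qpart /vq.
  case: i lti => [|[|[|[|i]]]] //= _;
    by rewrite !mulr0 ?mulr1 !scale0r ?(addr0, add0r) (bilZl bQ).
have Gk i e : (i < 3)%N -> G x (ten (vk i) (kf e)) =
    nth 0 [:: A; B; 2] i * Q (nth 0 [:: a; b; s] i) (kf e).
  move=> lti; rewrite fourmetric_sym ?m_ten_k //; last first.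
    by case: i lti => [|[|[|i]]] //= _; rewrite /vk /=; ring.
  rewrite xE fourmetric_vec_ten_k // Qsym ?k_kq ?kpart_k // /kpart /vk.
  rewrite !(bilDl bQ) !(bilZl bQ).
  by case: i lti => [|[|[|i]]] //= _; field.
have partq i Z u : Z \in q -> \sum_e (w * wq i * (u * Q Z (qf e))) *: ten (vq i) (qf e)
    = (wq i * u) *: ten (vq i) Z.
  move=> Zq; rewrite [Z in RHS]qf_frame // (lin_sum (ten_lin _)) scaler_sumr.
  by apply: eq_bigr => e _; rewrite (linZ (ten_lin _)) scalerA; congr (_ *: _); ring.
have partk i Z u : Z \in k -> \sum_e (w * wk i * (u * Q Z (kf e))) *: ten (vk i) (kf e)
    = (wk i * u) *: ten (vk i) Z.
  move=> Zk; rewrite [Z in RHS]kf_frame // (lin_sum (ten_lin _)) scaler_sumr.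
  by apply: eq_bigr => e _; rewrite (linZ (ten_lin _)) scalerA; congr (_ *: _); ring.
rewrite sum_mframe /=.
under eq_bigr => i _ do under eq_bigr => e _ do rewrite Gq //.
under [X in _ + X]eq_bigr => i _ do under eq_bigr => e _ do rewrite Gk //.
rewrite !big_ord_recl !big_ord0 /= !partq // !partk // /wq /wk /= !mulVf // !scale1r.
rewrite !invfM !mulfVK // !addr0 [in LHS]xE vec_tens !(linZ (ten_lin _)).
rewrite !addrA (_ : 4^-1 * 2 = 2^-1) //; by field.
Qed.

(** Both traces are independent of the frame, hence may be computed over
    [mframe]; the symmetric pair enters only through its Casimir constants. *)
Lemma fourfold_traces (L : finType) (e : L -> H4) X0 X1 X2 X3 a b s :
  X0 \in q -> X1 \in q -> X2 \in q -> X3 \in q -> a \in k -> b \in k -> s \in k ->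
  let x := vec X0 X1 X2 X3 a b s in
  frame G m (fun _ => 1) e ->
  \sum_i G (brf x (e i)) (brf x (e i)) =
    (1 - c) * (nrm s + 2^-1 * nrm a + 2^-1 * nrm b)
    + 2^-1 * ((A / 2 + 4^-1) / p * (nrm X0 + nrm X1)
              + (B / 2 + 4^-1) / r * (nrm X2 + nrm X3))
    + 2^-1 * (p * ((2 * A)^-1 + 4^-1) * (nrm X0 + nrm X1)
              + r * ((2 * B)^-1 + 4^-1) * (nrm X2 + nrm X3))
    + c * (2^-1 * nrm s + (8 * A)^-1 * nrm a + (8 * B)^-1 * nrm b
           + A / 8 * nrm a + B / 8 * nrm b) /\
  \sum_i \sum_j G (brf (e i) (e j)) x ^+ 2 =
    (1 - c) * (2^-1 * (p ^+ 2)^-1 * (A ^+ 2 * nrm a + nrm s)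
               + 2^-1 * (r ^+ 2)^-1 * (B ^+ 2 * nrm b + nrm s))
    + (p * ((2 * A)^-1 + 4^-1) * (nrm X0 + nrm X1)
       + r * ((2 * B)^-1 + 4^-1) * (nrm X2 + nrm X3))
    + c * ((16 * A ^+ 2)^-1 * (4 * nrm s) + (16 * B ^+ 2)^-1 * (4 * nrm s)
           + A / 4 * nrm a + B / 4 * nrm b).
Proof.
move=> X0q X1q X2q X3q ak bk sk x fre.
have bG := fourmetric_bilin.
have brfl z u y y' : brf (u *: y + y') z = u *: brf y z + brf y' z.
  by apply/ffunP => i; rewrite !ffunE br_linl.
have brfr z u y y' : brf z (u *: y + y') = u *: brf z y + brf z y'.
  by apply/ffunP => i; rewrite !ffunE br_linr.
have frF := frame_mframe.
have trE := frame_trace fourmetric_sym _ fre frF.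
split.
  transitivity (\sum_i 1 * G (brf x (e i)) (brf x (e i))).
    by apply: eq_bigr => i _; rewrite mul1r.
  rewrite (trE (fun y z => G (brf x y) (brf x z))); last first.
    by split=> u y y' z; rewrite brfr; [apply: (proj1 bG) | apply: (proj2 bG)].
  rewrite -sum_T1 // sum_mframe /=; congr (_ + _); apply: eq_bigr => i _.
    rewrite -trace_q // mulr_sumr; apply: eq_bigr => f _; ring.
  rewrite -trace_k // mulr_sumr; apply: eq_bigr => f _; ring.
pose S j j' := mweight j * mweight j' * G (brf (mframe j) (mframe j')) x ^+ 2.
have brF0 : bilin (fun y z => \sum_j G (brf y (e j)) x * G (brf z (e j)) x).
  split=> u y y' z; rewrite mulr_sumr -big_split; apply: eq_bigr => j _ /=;
    rewrite brfl (proj1 bG); ring.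
have brF1 j : bilin (fun y z => G (brf (mframe j) y) x * G (brf (mframe j) z) x).
  by split=> u y y' z; rewrite brfr (proj1 bG); ring.
transitivity (\sum_j \sum_j' S j j').
  have := trE _ brF0.
  rewrite (eq_bigr (fun i => \sum_j G (brf (e i) (e j)) x ^+ 2)); last first.
    by move=> i _; rewrite mul1r; apply: eq_bigr => j _; rewrite expr2.
  move=> ->; apply: eq_bigr => j _.
  have := trE _ (brF1 j).
  rewrite (eq_bigr (fun i => G (brf (mframe j) (e i)) x * G (brf (mframe j) (e i)) x)).
    move=> ->; rewrite mulr_sumr; apply: eq_bigr => j' _; rewrite /S; ring.
  by move=> i _; rewrite mul1r.
have regroup (K K' : finType) (SS : K -> I -> K' -> I -> R) :
    \sum_i \sum_f \sum_i' \sum_f' SS i f i' f' = \sum_i \sum_i' \sum_f \sum_f' SS i f i' f'.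
  by apply: eq_bigr => i _; rewrite exchange_big.
rewrite sum_mframe.
under eq_bigr => i _ do under eq_bigr => f _ do rewrite sum_mframe.
under [X in _ + X]eq_bigr => i _ do under eq_bigr => f _ do rewrite sum_mframe.
under eq_bigr => i _ do rewrite big_split.
under [X in _ + X]eq_bigr => i _ do rewrite big_split.
rewrite !big_split !regroup /=.
have Sqq : \sum_(i < 4) \sum_(i' < 4) \sum_f \sum_f' S (inl (f, i)) (inl (f', i')) =
    (1 - c) * (2^-1 * (p ^+ 2)^-1 * (A ^+ 2 * nrm a + nrm s)
               + 2^-1 * (r ^+ 2)^-1 * (B ^+ 2 * nrm b + nrm s)).
  rewrite -(sum_qq ak bk sk); apply: eq_bigr => i _; apply: eq_bigr => i' _.
  rewrite -(dtrace_qq X0q X1q X2q X3q ak bk sk) mulr_sumr; apply: eq_bigr => f _.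
  by rewrite mulr_sumr; apply: eq_bigr => f' _; rewrite /S /=; ring.
have Skk : \sum_(i < 3) \sum_(i' < 3) \sum_f \sum_f' S (inr (f, i)) (inr (f', i')) =
    c * ((16 * A ^+ 2)^-1 * (4 * nrm s) + (16 * B ^+ 2)^-1 * (4 * nrm s)
         + A / 4 * nrm a + B / 4 * nrm b).
  rewrite -(sum_kk ak bk sk); apply: eq_bigr => i _; apply: eq_bigr => i' _.
  rewrite -(dtrace_kk X0q X1q X2q X3q ak bk sk) mulr_sumr; apply: eq_bigr => f _.
  by rewrite mulr_sumr; apply: eq_bigr => f' _; rewrite /S /=; ring.
have Sqk : \sum_(i < 4) \sum_(i' < 3) \sum_f \sum_f' S (inl (f, i)) (inr (f', i')) =
    2^-1 * (p * ((2 * A)^-1 + 4^-1) * (nrm X0 + nrm X1)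
            + r * ((2 * B)^-1 + 4^-1) * (nrm X2 + nrm X3)).
  rewrite -sum_qk; apply: eq_bigr => i _; apply: eq_bigr => i' _.
  rewrite -(dtrace_qk X0q X1q X2q X3q ak bk sk) mulr_sumr; apply: eq_bigr => f _.
  by rewrite mulr_sumr; apply: eq_bigr => f' _; rewrite /S /=; ring.
have Skq : \sum_(i < 3) \sum_(i' < 4) \sum_f \sum_f' S (inr (f, i)) (inl (f', i')) =
    2^-1 * (p * ((2 * A)^-1 + 4^-1) * (nrm X0 + nrm X1)
            + r * ((2 * B)^-1 + 4^-1) * (nrm X2 + nrm X3)).
  rewrite exchange_big -sum_qk; apply: eq_bigr => i _; apply: eq_bigr => i' _ /=.
  rewrite mulvC -(dtrace_kq X0q X1q X2q X3q ak bk sk) mulr_sumr; apply: eq_bigr => f _.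
  by rewrite mulr_sumr; apply: eq_bigr => f' _; rewrite /S /=; ring.
have aux (t u v : R) : t + 2^-1 * u + (2^-1 * u + v) = t + u + v by field.
by rewrite Sqq Skk Sqk Skq aux.
Qed.

End FourfoldRicci.


(** * The tangent space of SU(2n)^4 / Sp(n) *)

Lemma lincomb4 (R : pzRingType) (V : lmodType R) (h a b c d : R) (u v u' v' : V) :
  (h * a) *: u + (h * b) *: v + (h * c) *: u' + (h * d) *: v' =
  h *: (a *: u + b *: v + (c *: u' + d *: v')).
Proof. by rewrite !scalerDr !scalerA !addrA. Qed.

Lemma vec_of_parts (R : realType) (V : vectType R) (X0 X1 X2 X3 k0 k1 k2 k3 : V) :
  k0 + k1 + (k2 + k3) = 0 ->
  forall i : 'I_4, nth 0 [:: X0 + k0; X1 + k1; X2 + k2; X3 + k3] i =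
    vec X0 X1 X2 X3 (k0 - k1) (k2 - k3) (k0 + k1) i.
Proof.
move=> /eqP; rewrite addr_eq0 => /eqP E.
have h1 (u v : V) : 2^-1 *: (u + v + (u - v)) = u.
  by rewrite scalerDr half_sum.
have h2 (u v : V) : 2^-1 *: (u + v - (u - v)) = v.
  by rewrite scalerBr half_diff.
elim/forall4; rewrite ffunE /=.
- by rewrite h1.
- by rewrite h2.
- by rewrite E opprK addrC [k2 - k3 + _]addrC h1 addrC.
- by rewrite E opprK [- (k2 - k3) + _]addrC h2.
Qed.

Lemma fourmetric_shift (R : realType) (H : vectType R) (Q : H -> H -> R)
    (prk prq : H -> H) p r A B (z z' y : {ffun 'I_4 -> H}) S :
  (forall i, prq (z' i) = prq (z i)) -> (forall i, prk (z' i) = prk (z i) - S) ->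
  fourmetric Q prk prq p r A B z' y = fourmetric Q prk prq p r A B z y.
Proof.
move=> qE kE; rewrite /fourmetric !qE !kE.
have e1 (u v w : H) : u - w - (v - w) = u - v by rewrite opprB addrA subrK.
have e2 (u v u' v' : H) : u - S + (v - S) - (u' - S + (v' - S)) = u + v - (u' + v').
  by rewrite (addrACA u) (addrACA u') -!(opprD S) e1.
by rewrite !e1 e2.
Qed.

Section ConcreteRicci.
Variables (R : realType) (n : nat).
Hypothesis n_gt0 : (0 < n)%N.
Local Notation N := (n + n)%N.
Local Notation cm := (cmat R n).
Local Notation su := (su R n).
Local Notation sp := (sp R n).
Local Notation qp := (q_part R n).
Local Notation H4 := (fourfold R n).
Local Notation kf := (@kf R n).
Local Notation qf := (@qf R n).
Local Notation wH := (wH R n).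
Local Notation cas := (cas R n).
Local Notation fm := (fourmetric (@QH R n) (@pr_k R n) (@pr_q R n)).
Implicit Types (X Y Z : cm) (x y z : H4).

Lemma metricE p q A B x y : metric p q A B x y = fm p q A B x y.
Proof.
have bQ := bilin_QH R n.
pose t : R := (Num.sqrt 2)^-1.
have tt : t * t = 2^-1 by rewrite -expr2 exprVn sqr_sqrtr // ler0n.
have cE (u : 'rV[R]_4) (h a b c d : R) z :
    u 0 i0 = h * a -> u 0 i1 = h * b -> u 0 i2 = h * c -> u 0 i3 = h * d ->
    coef u z = h *: (a *: pr_k (z i0) + b *: pr_k (z i1) + (c *: pr_k (z i2) + d *: pr_k (z i3))).
  by move=> e0 e1 e2 e3; rewrite /coef sum4 e0 e1 e2 e3; apply: lincomb4.
have E0 (u v u' v' : cm) : 1 *: u + -1 *: v + (0 *: u' + 0 *: v') = u - v.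
  by rewrite scale1r scaleN1r !scale0r !addr0.
have E1 (u v u' v' : cm) : 0 *: u + 0 *: v + (1 *: u' + -1 *: v') = u' - v'.
  by rewrite scale1r scaleN1r !scale0r !add0r.
have E2 (u v u' v' : cm) : 1 *: u + 1 *: v + (-1 *: u' + -1 *: v') = u + v - (u' + v').
  by rewrite !scale1r !scaleN1r -opprD.
have c1 z : coef (u1 R) z = t *: (pr_k (z i0) - pr_k (z i1)).
  by rewrite (@cE _ t 1 (-1) 0 0) ?E0 // !mxE.
have c2 z : coef (u2 R) z = t *: (pr_k (z i2) - pr_k (z i3)).
  by rewrite (@cE _ t 0 0 1 (-1)) ?E1 // !mxE.
have c3 z : coef (u3 R) z =
    2^-1 *: (pr_k (z i0) + pr_k (z i1) - (pr_k (z i2) + pr_k (z i3))).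
  have [e0 e1 e2 e3] : [/\ u3 R 0 i0 = 2^-1 * 1, u3 R 0 i1 = 2^-1 * 1,
      u3 R 0 i2 = 2^-1 * (-1) & u3 R 0 i3 = 2^-1 * (-1)] by split; rewrite !mxE.
  exact: etrans (cE _ _ _ _ _ _ _ e0 e1 e2 e3)
    (congr1 (fun X : cm => 2^-1 *: X) (E2 _ _ _ _)).
have qz h (u v : cm) : QH (h *: u) (h *: v) = h * h * QH u v.
  by rewrite (bilZl bQ) (bilZr bQ) mulrA.
have e1 : QH (coef (u1 R) x) (coef (u1 R) y) =
    2^-1 * QH (pr_k (x i0) - pr_k (x i1)) (pr_k (y i0) - pr_k (y i1)).
  rewrite (c1 x) (c1 y) qz tt; reflexivity.
have e2 : QH (coef (u2 R) x) (coef (u2 R) y) =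
    2^-1 * QH (pr_k (x i2) - pr_k (x i3)) (pr_k (y i2) - pr_k (y i3)).
  rewrite (c2 x) (c2 y) qz tt; reflexivity.
have e3 : QH (coef (u3 R) x) (coef (u3 R) y) =
    2^-1 * 2^-1 * QH (pr_k (x i0) + pr_k (x i1) - (pr_k (x i2) + pr_k (x i3)))
                     (pr_k (y i0) + pr_k (y i1) - (pr_k (y i2) + pr_k (y i3))).
  rewrite (c3 x) (c3 y) qz; reflexivity.
rewrite /metric e1 e2 e3 sum4 /= /fourmetric; clear.
have comb (a b a' b' c d e : R) : p * a + p * b + q * a' + q * b' + A * (2^-1 * c)
    + B * (2^-1 * d) + 2^-1 * 2^-1 * e =
    p * (a + b) + q * (a' + b') + A / 2 * c + B / 2 * d + 4^-1 * e by field.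
exact: comb.
Qed.

Lemma QH_pr_k Z X : Z \in su -> X \in sp -> QH Z X = QH (pr_k Z) X.
Proof.
move=> Zs Xk; rewrite -{1}(pr_kq Z) (bilDl (bilin_QH R n)).
by rewrite (QH_qk n_gt0 (pr_q_qp Zs) Xk) addr0.
Qed.

Lemma tangentE x : x \in tangent R n <->
  (forall i, x i \in su) /\ \sum_i pr_k (x i) = 0.
Proof.
have bQ := bilin_QH R n.
have QE X : (forall i, x i \in su) -> X \in sp ->
    Q4 x (diag X) = QH (\sum_i pr_k (x i)) X.
  move=> xs Xk; rewrite (bil_suml bQ); apply: eq_bigr => i _.
  by rewrite ffunE QH_pr_k.
split=> [/tangentP[/su4P xs H] | [xs H]].
  split=> //; have sk : \sum_i pr_k (x i) \in sp.
    by apply: memv_suml => i _; apply: pr_k_sp.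
  by apply: (QH_eq0 n_gt0 (sp_su sk)); rewrite -QE ?H.
apply/tangentP; split; first exact/su4P.
by move=> X Xk; rewrite QE // H (bil0l bQ).
Qed.

Lemma tangent_su x i : x \in tangent R n -> x i \in su.
Proof. by move=> /tangentE[]. Qed.

Lemma tangent_su4 x : x \in tangent R n -> x \in su4 R n.
Proof. by move=> /tangentE[xs _]; apply/su4P. Qed.

Lemma tangent_pr_q x i : x \in tangent R n -> pr_q (x i) \in qp.
Proof. by move=> xm; rewrite pr_q_qp ?tangent_su. Qed.

Lemma tangent_pr_k x i : x \in tangent R n -> pr_k (x i) \in sp.
Proof. by move=> xm; rewrite pr_k_sp ?tangent_su. Qed.

Lemma tangent_vec x : x \in tangent R n ->
  x = vec (pr_q (x i0)) (pr_q (x i1)) (pr_q (x i2)) (pr_q (x i3))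
    (pr_k (x i0) - pr_k (x i1)) (pr_k (x i2) - pr_k (x i3)) (pr_k (x i0) + pr_k (x i1)).
Proof.
move=> /tangentE[_]; rewrite sum4 -addrA => E.
apply/ffunP => i; rewrite -(vec_of_parts _ _ _ _ E); elim/forall4: i => /=;
  by rewrite addrC pr_kq.
Qed.

Lemma vec_tangent X0 X1 X2 X3 a b s :
  X0 \in qp -> X1 \in qp -> X2 \in qp -> X3 \in qp -> a \in sp -> b \in sp -> s \in sp ->
  vec X0 X1 X2 X3 a b s \in tangent R n.
Proof.
move=> X0q X1q X2q X3q ak bk sk.
have pk i := vec_prk (@pr_k_linear R n) (@pr_k_id R n) (@pr_k0 R n)
  X0q X1q X2q X3q ak bk sk i.
apply/tangentE; split; last first.
  rewrite sum4 !pk /= half_sum [b - s]addrC [- b - s]addrC.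
  by rewrite -addrA half_sum subrr.
elim/forall4; rewrite ffunE /=; apply: rpredD; first [exact: qp_su | apply/sp_su/rpredZ];
  by rewrite ?rpredD ?rpredB ?rpredN.
Qed.

Lemma tangent_dsp : (tangent R n :&: dsp R n = 0)%VS.
Proof.
apply/eqP; rewrite -subv0; apply/subvP => x /memv_capP[/tangentE[_ H] /dspP[X Xk xE]].
move: H; rewrite sum4 xE !ffunE pr_k_id // -!mulr2n -mulrSr -mulrSr.
rewrite -scaler_nat => /eqP; rewrite scaler_eq0 pnatr_eq0 /= => /eqP ->.
by rewrite memv0; apply/eqP/ffunP => i; rewrite !ffunE.
Qed.

(** Projecting to the tangent space subtracts a diagonal vector, which the metric
    does not see. *)
Lemma metric_daddv p q A B z y : z \in su4 R n ->
  metric p q A B (daddv_pi (tangent R n) (dsp R n) z) y = metric p q A B z y.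
Proof.
move=> /su4P zs; pose S := 4^-1 *: \sum_i pr_k (z i).
have Sk : S \in sp by apply/rpredZ/memv_suml => i _; apply: pr_k_sp.
pose z' := z - diag S.
have z'm : z' \in tangent R n.
  apply/tangentE; split=> [i|].
    by rewrite !ffunE; apply: rpredB; [exact: zs | exact: sp_su].
  under eq_bigr => i _ do rewrite !ffunE (linB (@pr_k_linear R n)) (pr_k_id Sk).
  rewrite big_split /= sumrN sumr_const card_ord -scaler_nat /S scalerA.
  by rewrite divff ?scale1r ?subrr // pnatr_eq0.
have -> : daddv_pi (tangent R n) (dsp R n) z = z'.
  rewrite -[z](subrK (diag S)) -/z' linearD /= daddv_pi_id ?tangent_dsp //.
  have := daddv_pi_add tangent_dsp (w := diag S); rewrite [X in _ + X]daddv_pi_id; last 2 first.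
  - by rewrite capvC tangent_dsp.
  - by apply/dspP; exists S.
  have dS : diag S \in (tangent R n + dsp R n)%VS.
    by apply: (subvP (addvSr _ _)); apply/dspP; exists S.
  by move=> /(_ dS) /(canRL (addrK _)) ->; rewrite subrr addr0.
rewrite !metricE /fourmetric.
have qE i : pr_q (z' i) = pr_q (z i).
  by rewrite !ffunE (linB (@pr_q_linear R n)) (pr_q0 Sk) subr0.
have kE i : pr_k (z' i) = pr_k (z i) - S.
  by rewrite !ffunE (linB (@pr_k_linear R n)) (pr_k_id Sk).
exact: fourmetric_shift qE kE.
Qed.

Lemma bilin_metric p q A B : bilin (@metric R n p q A B).
Proof.
have := fourmetric_bilin (bilin_QH R n) (@pr_k_linear R n) (@pr_q_linear R n) p q A B.
by move=> [bl br]; split=> a x y z; rewrite !metricE; [apply: bl | apply: br].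
Qed.

(** Expand [cbr Z (f e)] in the frame [f'] and use the invariance of [QH]. *)
Lemma dcas (U W : {vspace cm}) (f f' : uidx n -> cm) (d : R) :
  (forall e, f e \in su) -> (forall Z, Z \in U -> Z \in su) ->
  frame (@QH R n) W (fun _ => wH) f' -> (forall Z, Z \in W -> Z \in su) ->
  (forall e Z, Z \in U -> cbr (f e) Z \in W) ->
  (forall Z, Z \in U -> \sum_e wH * QH (cbr Z (f e)) (cbr Z (f e)) = d * QH Z Z) ->
  forall Z, Z \in U ->
  \sum_e \sum_e' wH * wH * QH (cbr (f e) (f' e')) Z ^+ 2 = d * QH Z Z.
Proof.
move=> fs Us frW Ws brW casU Z ZU; rewrite -casU //; apply: eq_bigr => e _.
have bQ := bilin_QH R n.
have -> : QH (cbr Z (f e)) (cbr Z (f e)) = QH (cbr (f e) Z) (cbr (f e) Z).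
  by rewrite cbrC (bilNl bQ) (bilNr bQ) opprK.
rewrite -(frame_parseval bQ frW) ?brW // mulr_sumr; apply: eq_bigr => e' _.
have f's : f' e' \in su by apply/Ws/(proj1 frW).
have E : QH (cbr (f e) (f' e')) Z = - QH (cbr (f e) Z) (f' e').
  rewrite (QH_br n_gt0 (fs e) f's (Us _ ZU)); congr (- _).
  exact: (QHC n_gt0 f's (su_br (fs e) (Us _ ZU))).
rewrite E sqrrN mulrA; reflexivity.
Qed.

End ConcreteRicci.


(** * The Einstein equations of the family (p, p, q, q; A, B, 1) *)

Lemma vec_zero (R : realType) (V : vectType R) (X0 X1 X2 X3 a b s : V) :
  X0 = 0 -> X1 = 0 -> X2 = 0 -> X3 = 0 -> a = 0 -> b = 0 -> s = 0 ->
  vec X0 X1 X2 X3 a b s = 0.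
Proof.
move=> -> -> -> -> -> -> ->; apply/ffunP; elim/forall4;
  by rewrite !ffunE /= !(oppr0, subr0, addr0, scaler0).
Qed.

Section EinsteinEquations.
Variables (R : realType) (n : nat).
Hypothesis n_gt1 : (1 < n)%N.
Local Notation N := (n + n)%N.
Local Notation M := 'M[R[i]]_(n + n).
Local Notation cm := (cmat R n).
Local Notation su := (su R n).
Local Notation sp := (sp R n).
Local Notation qp := (q_part R n).
Local Notation H4 := (fourfold R n).
Local Notation tangent := (tangent R n).
Local Notation kf := (@kf R n).
Local Notation qf := (@qf R n).
Local Notation wH := (wH R n).
Local Notation cas := (cas R n).
Implicit Types (X Y Z : cm) (x y z : H4).

Let n_gt0 : (0 < n)%N. Proof. exact: ltnW. Qed.

Definition nrmH X : R := QH X X.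

Lemma nrmH_ge0 X : X \in su -> 0 <= nrmH X.
Proof.
move=> Xs; have [->|X0] := eqVneq X 0; first by rewrite /nrmH (bil0l (bilin_QH R n)).
exact/ltW/QH_gt0.
Qed.

Lemma nrmH0 : nrmH 0 = 0.
Proof. exact: (bil0l (bilin_QH R n)). Qed.

Lemma killing_su4 x : x \in su4 R n ->
  killing (@br4 R n) (su4 R n) x x = - \sum_i nrmH (x i).
Proof.
move=> /su4P xs.
pose inj (p : uidx n * 'I_4) : H4 := [ffun j => if j == p.2 then psu (munit R p.1) else 0].
have bQ4 : bilin (@Q4 R n).
  by split=> a u v z; [apply: (Q4_linearl z a u v) | apply: (Q4_linearr z a u v)].
have bQ := bilin_QH R n.
have Q4inj y e i : Q4 y (inj (e, i)) = QH (y i) (psu (munit R e)).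
  rewrite /Q4 (bigD1 i) //= ffunE eqxx big1 ?addr0 // => j /negPf ji.
  by rewrite ffunE /= ji (bil0r bQ).
have fr : frame (@Q4 R n) (su4 R n) (fun _ => wH) inj.
  split=> [[e i]|y /su4P ys].
    apply/su4P => j; rewrite ffunE; case: (_ == _); last exact: mem0v.
    exact: psu_su.
  apply/ffunP => j; rewrite sum_ffunE.
  have [_ fE] := frame_suH R n_gt0.
  rewrite {1}[y j](fE _ (ys j)).
  transitivity (\sum_e \sum_i ((wH * Q4 y (inj (e, i))) *: inj (e, i)) j); last first.
    by rewrite pair_big; apply: eq_bigr => -[e i] _.
  apply: eq_bigr => e _; rewrite (bigD1 j) //= big1 ?addr0 => [|i ij].
    by rewrite !ffunE eqxx Q4inj.
  by rewrite !ffunE eq_sym (negPf ij) scaler0.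
rewrite (killing_frame _ bQ4 fr); last 2 first.
- by move=> z a u v; apply/ffunP => i; rewrite !ffunE cbr_linearr.
- by move=> z /su4P zs; apply/su4P => i; rewrite !ffunE !su_br.
transitivity (\sum_i \sum_e wH * QH (cbr (x i) (cbr (x i) (psu (munit R e)))) (psu (munit R e))).
  rewrite exchange_big pair_big /=; apply: eq_bigr => -[e i] _.
  by rewrite Q4inj !ffunE eqxx.
rewrite -sumrN; apply: eq_bigr => i _.
have := @killing_frame R cm (@cbr R n) su (@QH R n) _ (fun _ => wH) _ (x i) (x i)
  (@cbr_linearr R n) bQ (frame_suH R n_gt0).
move=> <-; first by rewrite /nrmH /QH opprK.
by move=> z zs; rewrite !su_br.
Qed.

Lemma su4_prk x i : x \in su4 R n -> pr_k (x i) \in sp.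
Proof. by move=> /su4P xs; apply: pr_k_sp. Qed.

Lemma su4_prq x i : x \in su4 R n -> pr_q (x i) \in qp.
Proof. by move=> /su4P xs; apply: pr_q_qp. Qed.

Lemma su4_br x y : x \in su4 R n -> y \in su4 R n -> br4 x y \in su4 R n.
Proof. by move=> /su4P xs /su4P ys; apply/su4P => i; rewrite ffunE su_br. Qed.

Lemma QH_sym_kq X Y : X \in (sp + qp)%VS -> Y \in (sp + qp)%VS -> QH X Y = QH Y X.
Proof.
have sub Z : Z \in (sp + qp)%VS -> Z \in su.
  by move=> /memv_addP[U Uk [W Wq ->]]; apply: rpredD; [exact: sp_su | exact: qp_su].
by move=> Xs Ys; apply: (QHC n_gt0); apply: sub.
Qed.

Lemma metric_sym p q A B x y : x \in su4 R n -> y \in su4 R n ->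
  metric p q A B x y = metric p q A B y x.
Proof.
move=> xs ys; rewrite !metricE.
by apply: (fourmetric_symm QH_sym_kq) => i; rewrite ?su4_prk ?su4_prq.
Qed.

Lemma metric_vec2 p q A B X0 X1 X2 X3 a b s Y0 Y1 Y2 Y3 a' b' s' :
  X0 \in qp -> X1 \in qp -> X2 \in qp -> X3 \in qp -> a \in sp -> b \in sp -> s \in sp ->
  Y0 \in qp -> Y1 \in qp -> Y2 \in qp -> Y3 \in qp -> a' \in sp -> b' \in sp -> s' \in sp ->
  metric p q A B (vec X0 X1 X2 X3 a b s) (vec Y0 Y1 Y2 Y3 a' b' s') =
    p * (QH X0 Y0 + QH X1 Y1) + q * (QH X2 Y2 + QH X3 Y3)
    + A / 2 * QH a a' + B / 2 * QH b b' + QH s s'.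
Proof.
move=> X0q X1q X2q X3q ak bk sk Y0q Y1q Y2q Y3q a'k b'k s'k.
have bQ := bilin_QH R n.
rewrite metricE (fourmetric_vecr bQ (@pr_k_linear R n) (@pr_q_linear R n)
  (@pr_k_id R n) (@pr_k0 R n) (@pr_q0 R n) (@pr_q_id R n) p q A B
  Y0q Y1q Y2q Y3q a'k b'k s'k).
rewrite !(vec_prq (@pr_q_linear R n) (@pr_q0 R n) (@pr_q_id R n) X0q X1q X2q X3q ak bk sk).
rewrite !(vec_prk (@pr_k_linear R n) (@pr_k_id R n) (@pr_k0 R n) X0q X1q X2q X3q ak bk sk) /=.
rewrite half_diff half_sum.
have -> : 2^-1 *: (b - s) - 2^-1 *: (- b - s) = b.
  by rewrite [b - s]addrC [- b - s]addrC half_diff.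
have -> : 2^-1 *: (b - s) + 2^-1 *: (- b - s) = - s.
  by rewrite [b - s]addrC [- b - s]addrC half_sum.
have -> : QH (s - - s) s' = 2 * QH s s'.
  by rewrite opprK (bilDl bQ); ring.
have comb (u v : R) : u + 2^-1 * (2 * v) = u + v by field.
exact: comb.
Qed.

Lemma metric_vec p q A B X0 X1 X2 X3 a b s :
  X0 \in qp -> X1 \in qp -> X2 \in qp -> X3 \in qp -> a \in sp -> b \in sp -> s \in sp ->
  let x := vec X0 X1 X2 X3 a b s in
  metric p q A B x x = p * (nrmH X0 + nrmH X1) + q * (nrmH X2 + nrmH X3)
    + A / 2 * nrmH a + B / 2 * nrmH b + nrmH s.
Proof. by move=> *; apply: metric_vec2. Qed.

Lemma metric_inner p q A B : 0 < p -> 0 < q -> 0 < A -> 0 < B ->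
  inner_product tangent (@metric R n p q A B).
Proof.
move=> p0 q0 A0 B0; split.
- by move=> a x y z _ _ _; rewrite (proj1 (bilin_metric n p q A B)).
- by move=> x y xm ym; apply: metric_sym; apply: tangent_su4.
move=> x xm x0.
have qs i := tangent_pr_q n_gt0 i xm; have ks i := tangent_pr_k n_gt0 i xm.
have dk i j : pr_k (x i) - pr_k (x j) \in sp by rewrite rpredB.
have sk i j : pr_k (x i) + pr_k (x j) \in sp by rewrite rpredD.
have xE := tangent_vec n_gt0 xm.
rewrite [X in metric _ _ _ _ X X]xE metric_vec //.
have nq Z : Z \in qp -> 0 <= nrmH Z by move=> /qp_su/nrmH_ge0.
have nk Z : Z \in sp -> 0 <= nrmH Z by move=> /sp_su/nrmH_ge0.
have e0 Z : Z \in su -> nrmH Z = 0 -> Z = 0 by apply: QH_eq0.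
have pos (a0 a1 a2 a3 a b c : R) : 0 <= a0 -> 0 <= a1 -> 0 <= a2 -> 0 <= a3 ->
    0 <= a -> 0 <= b -> 0 <= c ->
    [&& a0 == 0, a1 == 0, a2 == 0, a3 == 0, a == 0, b == 0 & c == 0]
    || (0 < p * (a0 + a1) + q * (a2 + a3) + A / 2 * a + B / 2 * b + c).
  move=> h0 h1 h2 h3 ha hb hc.
  have P1 : 0 <= p * (a0 + a1) := mulr_ge0 (ltW p0) (addr_ge0 h0 h1).
  have P2 : 0 <= q * (a2 + a3) := mulr_ge0 (ltW q0) (addr_ge0 h2 h3).
  have P3 : 0 <= A / 2 * a := mulr_ge0 (divr_ge0 (ltW A0) (ler0n _ 2)) ha.
  have P4 : 0 <= B / 2 * b := mulr_ge0 (divr_ge0 (ltW B0) (ler0n _ 2)) hb.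
  have ge0 : 0 <= p * (a0 + a1) + q * (a2 + a3) + A / 2 * a + B / 2 * b + c.
    by rewrite !addr_ge0.
  rewrite lt_def ge0 andbT orbC -implyNb negbK; apply/implyP.
  rewrite !(paddr_eq0 _ hc, paddr_eq0 _ P4, paddr_eq0 _ P3, paddr_eq0 _ P2) ?addr_ge0 //.
  rewrite !mulf_eq0 !invr_eq0 !pnatr_eq0 !(gt_eqF p0, gt_eqF q0, gt_eqF A0, gt_eqF B0) /=.
  by rewrite !paddr_eq0 // => /andP[/andP[/andP[/andP[/andP[-> ->] /andP[-> ->]] ->] ->] ->].
have := pos _ _ _ _ _ _ _ (nq _ (qs i0)) (nq _ (qs i1)) (nq _ (qs i2)) (nq _ (qs i3))
  (nk _ (dk i0 i1)) (nk _ (dk i2 i3)) (nk _ (sk i0 i1)).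
case/orP => // /and5P[h0 h1 h2 h3 /and3P[ha hb hs]].
have z Z : Z \in su -> nrmH Z == 0 -> Z = 0 by move=> Zs /eqP; apply: e0.
have qz i : nrmH (pr_q (x i)) == 0 -> pr_q (x i) = 0 by apply/z/qp_su.
case/eqP: x0; rewrite xE; exact: (vec_zero (qz _ h0) (qz _ h1) (qz _ h2) (qz _ h3)
  (z _ (sp_su (dk _ _)) ha) (z _ (sp_su (dk _ _)) hb) (z _ (sp_su (sk _ _)) hs)).
Qed.

(** The Ricci curvature on the summands q_1 (or q_2), u1 (x) k and u3 (x) k; the
    other two are obtained by exchanging (p, A) and (q, B). *)
Definition ric_q (p A : R) : R := 2^-1 - (2 * A + 1) / (16 * p).
Definition ric_u (p A : R) : R :=
  cas / 4 - cas / (16 * A) + (1 - cas) * A ^+ 2 / (8 * p ^+ 2).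
Definition ric_3 (p q A B : R) : R :=
  cas / 4 + (1 - cas) / 8 * ((p ^+ 2)^-1 + (q ^+ 2)^-1)
  + cas / 16 * ((A ^+ 2)^-1 + (B ^+ 2)^-1).

Lemma ricci_metric p q A B (e : (\dim tangent).-tuple H4) X0 X1 X2 X3 a b s :
  0 < p -> 0 < q -> 0 < A -> 0 < B ->
  orthonormal_basis (metric p q A B) e ->
  X0 \in qp -> X1 \in qp -> X2 \in qp -> X3 \in qp -> a \in sp -> b \in sp -> s \in sp ->
  let x := vec X0 X1 X2 X3 a b s in
  ricci (@br4 R n) (su4 R n) (dsp R n) (metric p q A B) e x =
    ric_q p A * (nrmH X0 + nrmH X1) + ric_q q B * (nrmH X2 + nrmH X3)
    + ric_u p A * nrmH a + ric_u q B * nrmH b + ric_3 p q A B * nrmH s.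
Proof.
move=> p0 q0 A0 B0 oe X0q X1q X2q X3q ak bk sk x.
have xm : x \in tangent := vec_tangent n_gt0 X0q X1q X2q X3q ak bk sk.
have bQ := bilin_QH R n.
have fre := orthonormal_frame (metric_inner p0 q0 A0 B0) oe.
have em i : tnth e i \in tangent by apply: (proj1 fre).
have [p1 q1 A1 B1] : [/\ p != 0, q != 0, A != 0 & B != 0] by rewrite !gt_eqF.
have frG : frame (fourmetric (@QH R n) (@pr_k R n) (@pr_q R n) p q A B) tangent
    (fun _ => 1) (fun i => tnth e i).
  by split=> // y ym; rewrite {1}(proj2 fre y ym); apply: eq_bigr => i _; rewrite metricE.
have dkk := dcas n_gt0 (fun e => sp_su (kf_sp R n_gt0 e)) (@sp_su R n) (frame_kf R n_gt0)
  (@sp_su R n) (fun e Z Zk => br_kk (kf_sp R n_gt0 e) Zk) (casimir_kk n_gt0).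
have dqq := dcas n_gt0 (fun e => qp_su (qf_qp R n_gt0 e)) (@sp_su R n) (frame_qf R n_gt0)
  (@qp_su R n) (fun e Z Zk => br_qk (qf_qp R n_gt0 e) Zk) (casimir_kq n_gt0).
have dkq := dcas n_gt0 (fun e => sp_su (kf_sp R n_gt0 e)) (@qp_su R n) (frame_qf R n_gt0)
  (@qp_su R n) (fun e Z Zq => br_kq (kf_sp R n_gt0 e) Zq) (casimir_qk n_gt0).
have dqk := dcas n_gt0 (fun e => qp_su (qf_qp R n_gt0 e)) (@qp_su R n) (frame_kf R n_gt0)
  (@sp_su R n) (fun e Z Zq => br_qq (qf_qp R n_gt0 e) Zq) (casimir_qq n_gt0).
have m_vec y : y \in tangent -> exists X0 X1 X2 X3 a b s,
    [/\ [/\ X0 \in qp, X1 \in qp, X2 \in qp & X3 \in qp],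
        [/\ a \in sp, b \in sp & s \in sp] & y = vec X0 X1 X2 X3 a b s].
  move=> ym; have qs i := tangent_pr_q n_gt0 i ym; have ks i := tangent_pr_k n_gt0 i ym.
  exists (pr_q (y i0)), (pr_q (y i1)), (pr_q (y i2)), (pr_q (y i3)),
    (pr_k (y i0) - pr_k (y i1)), (pr_k (y i2) - pr_k (y i3)), (pr_k (y i0) + pr_k (y i1)).
  split; [split; exact: qs | | exact: (tangent_vec n_gt0 ym)].
  by split; [apply: rpredB | apply: rpredB | apply: rpredD]; apply: ks.
have m_q v Z : Z \in qp -> ten v Z \in tangent.
  move=> Zq; apply/(tangentE n_gt0); split=> [i|].
    by rewrite ffunE; apply/qp_su/rpredZ.
  by rewrite big1 // => i _; rewrite ffunE (linZ (@pr_k_linear R n)) pr_k0 // scaler0.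
have m_k v Z : Z \in sp -> v`_0 + v`_1 + v`_2 + v`_3 = 0 -> ten v Z \in tangent.
  move=> Zk v0; apply/(tangentE n_gt0); split=> [i|].
    by rewrite ffunE; apply/sp_su/rpredZ.
  rewrite sum4 !ffunE /= !(linZ (@pr_k_linear R n)) (pr_k_id Zk) -!scalerDl v0.
  exact: scale0r.
have [T1 T2] := fourfold_traces
  (@cbr_linearl R n) (@cbr_linearr R n) bQ QH_sym_kq (@pr_k_linear R n) (@pr_q_linear R n)
  (@pr_k_id R n) (@pr_k0 R n) (@pr_q0 R n) (@pr_q_id R n) (@br_kk R n) (@br_kq R n)
  (@br_qk R n) (@br_qq R n) (kf_sp R n_gt0) (qf_qp R n_gt0)
  (casimir_kk n_gt0) (casimir_kq n_gt0) (casimir_qk n_gt0) (casimir_qq n_gt0)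
  dkk dqq dkq dqk p1 q1 A1 B1 m_vec m_q m_k
  (proj2 (frame_kf R n_gt0)) (proj2 (frame_qf R n_gt0))
  X0q X1q X2q X3q ak bk sk frG.
have xs := tangent_su4 n_gt0 xm; have es i := tangent_su4 n_gt0 (em i).
have S1 : \sum_(i < \dim tangent) metric p q A B
      (daddv_pi tangent (dsp R n) (br4 x (tnth e i)))
      (daddv_pi tangent (dsp R n) (br4 x (tnth e i))) =
    \sum_(i < \dim tangent) fourmetric (@QH R n) (@pr_k R n) (@pr_q R n) p q A B
      (brf (@cbr R n) x (tnth e i)) (brf (@cbr R n) x (tnth e i)).
  apply: eq_bigr => i _; have bs := su4_br xs (es i).
  rewrite (metric_daddv n_gt0) // metric_sym //; last exact: (tangent_su4 n_gt0 (memv_pi _ _ _)).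
  by rewrite (metric_daddv n_gt0) // metricE.
have S2 : \sum_(i < \dim tangent) \sum_(j < \dim tangent) metric p q A B
      (daddv_pi tangent (dsp R n) (br4 (tnth e i) (tnth e j))) x ^+ 2 =
    \sum_(i < \dim tangent) \sum_(j < \dim tangent)
      fourmetric (@QH R n) (@pr_k R n) (@pr_q R n) p q A B
        (brf (@cbr R n) (tnth e i) (tnth e j)) x ^+ 2.
  apply: eq_bigr => i _; apply: eq_bigr => j _.
  rewrite (metric_daddv n_gt0) ?metricE //; exact: su4_br.
have S3 : \sum_i nrmH (x i) = nrmH X0 + nrmH X1 + nrmH X2 + nrmH X3
    + 2^-1 * nrmH a + 2^-1 * nrmH b + nrmH s.
  have nD X Y : X \in qp -> Y \in sp -> nrmH (X + Y) = nrmH X + nrmH Y.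
    move=> Xq Yk; rewrite /nrmH (bilDl bQ) !(bilDr bQ) (QH_kq n_gt0 Yk Xq) (QH_qk n_gt0 Xq Yk).
    by rewrite addr0 add0r.
  have [x0 x1 x2 x3] := nrm_xi bQ QH_sym_kq ak bk sk.
  have ks i : xi a b s i \in sp by apply: xik.
  rewrite sum4 !vecE /= (nD _ _ X0q (ks _)) (nD _ _ X1q (ks _)) (nD _ _ X2q (ks _)).
  rewrite (nD _ _ X3q (ks _)); rewrite /nrm -!/(nrmH _) in x0 x1 x2 x3.
  rewrite x0 x1 x2 x3.
  have comb (y0 y1 y2 y3 t u v w w' : R) : y0 + 4^-1 * (v + t + 2 * w)
      + (y1 + 4^-1 * (v + t - 2 * w)) + (y2 + 4^-1 * (v + u - 2 * w'))
      + (y3 + 4^-1 * (v + u + 2 * w')) =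
      y0 + y1 + y2 + y3 + 2^-1 * t + 2^-1 * u + v by field.
  exact: comb.
rewrite /ricci S1 S2 T1 T2 (killing_su4 xs) S3 /nrm -!/(nrmH _) /ric_q /ric_u /ric_3.
by field; rewrite p1 q1 A1 B1.
Qed.

End EinsteinEquations.


Section EinsteinMetric.
Variables (R : realType) (n : nat).
Hypothesis n_gt1 : (1 < n)%N.
Local Notation N := (n + n)%N.
Local Notation M := 'M[R[i]]_(n + n).
Local Notation cm := (cmat R n).
Local Notation su := (su R n).
Local Notation sp := (sp R n).
Local Notation qp := (q_part R n).
Local Notation H4 := (fourfold R n).
Local Notation tangent := (tangent R n).
Implicit Types (X Y Z : cm) (x y z : H4).

Let n_gt0 : (0 < n)%N. Proof. exact: ltnW. Qed.

Lemma sp_nonzero : exists2 X, X \in sp & X != 0.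
Proof.
have JC : conjmat (J R n) = J R n := conjJ R n.
exists (J R n).
  rewrite spE; apply/andP; split.
    apply/suP; split; first by rewrite /adjmat JC trJ.
    by rewrite /J mxtrace_block !linear0 addr0.
  by rewrite /theta JC trJ mulmxN JJ2 mulNmx opprK mul1mx.
apply/eqP => /matrixP/(_ (lshift _ (Ordinal n_gt0)) (rshift _ (Ordinal n_gt0))).
by rewrite block_mxEur !mxE eqxx => /eqP; rewrite oner_eq0.
Qed.

Lemma J_conj_diag (P : 'M[R[i]]_n) :
  (J R n : 'M_(n + n)) *m block_mx P 0 0 P *m (J R n : 'M_(n + n))^T = block_mx P 0 0 P.
Proof.
rewrite trJ /J opp_block_mx !mulmx_block !(mulmx0, mul0mx, addr0, add0r).
by rewrite !(mulNmx, mulmxN, mul1mx, mulmx1, opprK, oppr0, mulmx0, mul0mx).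
Qed.

Lemma qp_nonzero : exists2 X, X \in qp & X != 0.
Proof.
pose a := Ordinal n_gt0; pose b := Ordinal n_gt1.
pose P : 'M[R[i]]_n := delta_mx a a - delta_mx b b.
pose Z : cm := block_mx P 0 0 P.
have ZC : conjmat Z = Z.
  rewrite /conjmat map_block_mx !map_mx0; suff -> : map_mx (@conjc R) P = P by [].
  by rewrite map_mxB !map_delta_mx.
have ZT : (Z : M)^T = Z.
  rewrite tr_block_mx !trmx0; suff -> : P^T = P by [].
  by rewrite linearB /= !trmx_delta.
have td c : \tr (delta_mx c c : 'M[R[i]]_n) = 1.
  rewrite /mxtrace (bigD1 c) //= big1 ?mxE ?eqxx ?addr0 // => i /negPf ic.
  by rewrite mxE ic.
have Zt : \tr (Z : M) = 0.
  by rewrite mxtrace_block linearB /= !td subrr addr0.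
have ZJ : theta Z = Z.
  by rewrite /theta ZC; apply: J_conj_diag.
exists (ii R *: (Z : M)).
  rewrite qpE; apply/andP; split.
    apply/suP; split; first by rewrite adjmatZ iiJ scaleNr /adjmat ZC ZT.
    by rewrite linearZ /= Zt mulr0.
  by rewrite thetaZ iiJ scaleNr ZJ.
apply/eqP => /matrixP/(_ (lshift _ a) (lshift _ a)).
rewrite [LHS]mxE [RHS]mxE block_mxEul !mxE eqxx /= subr0 mulr1.
by move=> /(congr1 (@complex.Im R)) /= /eqP; rewrite oner_eq0.
Qed.

(** Both the Ricci form and the metric are diagonal in the seven summands, so the
    equation may be tested on one nonzero vector in each. *)
Lemma einstein_metricP p q A B : 0 < p -> 0 < q -> 0 < A -> 0 < B ->
  einstein4 (@metric R n p q A B) <->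
  exists lam, [/\ ric_q p A = lam * p, ric_q q B = lam * q,
    ric_u n p A = lam * (A / 2), ric_u n q B = lam * (B / 2) &
    ric_3 n p q A B = lam].
Proof.
move=> p0 q0 A0 B0.
have [K Kk K0] := sp_nonzero; have [X Xq X0] := qp_nonzero.
have zq : 0 \in qp by apply: mem0v.
have zk : 0 \in sp by apply: mem0v.
have nK : nrmH K != 0 by rewrite gt_eqF // QH_gt0 // sp_su.
have nX : nrmH X != 0 by rewrite gt_eqF // QH_gt0 // qp_su.
have n0 : nrmH (0 : cm) = 0 by apply: nrmH0.
have solve (a b t : R) : t != 0 -> a * t = b * t -> a = b by move=> t0 /(mulIf t0).
split.
  move=> [e oe [lam ric]]; exists lam.
  have H X0' X1' X2' X3' a' b' s' (m0 : X0' \in qp) (m1 : X1' \in qp) (m2 : X2' \in qp)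
      (m3 : X3' \in qp) (ma : a' \in sp) (mb : b' \in sp) (ms : s' \in sp) :
      ric_q p A * (nrmH X0' + nrmH X1') + ric_q q B * (nrmH X2' + nrmH X3')
      + ric_u n p A * nrmH a' + ric_u n q B * nrmH b' + ric_3 n p q A B * nrmH s' =
      lam * (p * (nrmH X0' + nrmH X1') + q * (nrmH X2' + nrmH X3')
        + A / 2 * nrmH a' + B / 2 * nrmH b' + nrmH s').
    rewrite -(ricci_metric n_gt1 p0 q0 A0 B0 oe m0 m1 m2 m3 ma mb ms).
    rewrite -(metric_vec p q A B m0 m1 m2 m3 ma mb ms).
    exact: ric (vec_tangent n_gt0 m0 m1 m2 m3 ma mb ms).
  have E1 := H _ _ _ _ _ _ _ Xq zq zq zq zk zk zk.
  have E2 := H _ _ _ _ _ _ _ zq zq Xq zq zk zk zk.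
  have E3 := H _ _ _ _ _ _ _ zq zq zq zq Kk zk zk.
  have E4 := H _ _ _ _ _ _ _ zq zq zq zq zk Kk zk.
  have E5 := H _ _ _ _ _ _ _ zq zq zq zq zk zk Kk.
  rewrite !n0 !(addr0, mulr0, add0r) in E1 E2 E3 E4 E5.
  split.
  - by apply: (solve _ _ _ nX); rewrite E1; exact: mulrA.
  - by apply: (solve _ _ _ nX); rewrite E2; exact: mulrA.
  - by apply: (solve _ _ _ nK); rewrite E3; exact: mulrA.
  - by apply: (solve _ _ _ nK); rewrite E4; exact: mulrA.
  - by apply: (solve _ _ _ nK); exact: E5.
move=> [lam [E1 E2 E3 E4 E5]].
have [e oe] := ex_orthonormal_basis (metric_inner n_gt1 p0 q0 A0 B0).
exists e => //; exists lam => x xm.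
have qs i := tangent_pr_q n_gt0 i xm; have ks i := tangent_pr_k n_gt0 i xm.
have dk i j : pr_k (x i) - pr_k (x j) \in sp by rewrite rpredB.
have sk i j : pr_k (x i) + pr_k (x j) \in sp by rewrite rpredD.
rewrite (tangent_vec n_gt0 xm).
rewrite (ricci_metric n_gt1 p0 q0 A0 B0 oe (qs _) (qs _) (qs _) (qs _) (dk _ _) (dk _ _) (sk _ _)).
rewrite (metric_vec _ _ _ _ (qs _) (qs _) (qs _) (qs _) (dk _ _) (dk _ _) (sk _ _)).
rewrite E1 E2 E3 E4 E5.
have comb (a0 a1 a2 a3 a b s : R) : lam * p * (a0 + a1) + lam * q * (a2 + a3)
    + lam * (A / 2) * a + lam * (B / 2) * b + lam * s =
    lam * (p * (a0 + a1) + q * (a2 + a3) + A / 2 * a + B / 2 * b + s) by ring.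
exact: comb.
Qed.

End EinsteinMetric.


(** * Reflections of the quaternionic space *)

Section Reflections.
Variables (R : realType) (n : nat).
Local Notation C := R[i].
Local Notation N := (n + n)%N.
Local Notation M := 'M[C]_(n + n).
Local Notation V := 'cV[C]_(n + n).
Local Notation cm := (cmat R n).
Implicit Types (x y u w : V) (z t : C).

Lemma Sp_groupE (U : cm) :
  Sp_group U <-> ((U : M) *m (adjmat U : M) = 1%:M /\ theta U = U).
Proof.
rewrite /Sp_group; set JJ : M := J R n.
have JC : conjmat JJ = JJ := conjJ R n.
have cc (A : cm) : conjmat (conjmat A) = A by apply/matrixP=> i j; rewrite !mxE /= conjcK.
split=> -[U1 H]; split=> //.
  have E : JJ *m (U : M) = (conjmat U : M) *m JJ.
    have UT : (conjmat U : M) *m (U : M)^T = 1%:M.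
      have := congr1 trmx U1; rewrite trmx_mul trmx1 /adjmat trmxK => <-.
      by [].
    by rewrite -{2}H !mulmxA UT mul1mx.
  have := congr1 (@conjmat R n) E; rewrite !conjmatM cc JC => E'.
  by rewrite /theta -/JJ E' -mulmxA JJT mulmx1.
have E : JJ *m (conjmat U : M) = (U : M) *m JJ.
  by rewrite -{2}H /theta -!mulmxA JTJ mulmx1.
have := congr1 (@conjmat R n) E; rewrite !conjmatM cc JC => E'.
rewrite -mulmxA E' mulmxA.
have UT : (conjmat U : M) *m (U : M)^T = 1%:M.
  have := congr1 trmx U1; rewrite trmx_mul trmx1 /adjmat trmxK => <-.
  by [].
by rewrite (mulmx1C UT) mul1mx.
Qed.

Definition adjv x : 'rV[C]_N := (map_mx (@conjc R) x)^T.
Definition r1 x y : M := x *m adjv y.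
Definition ip x y : C := (adjv x *m y) 0 0.
(** The quaternionic structure of C^2n, whose isometries form Sp(n). *)
Definition jv x : V := (J R n : M) *m map_mx (@conjc R) x.

Lemma adjvD x y : adjv (x + y) = adjv x + adjv y.
Proof. by apply/matrixP=> i j; rewrite !mxE conjcD. Qed.
Lemma adjvZ z x : adjv (z *: x) = z^*%C *: adjv x.
Proof. by apply/matrixP=> i j; rewrite !mxE conjcM. Qed.

Lemma r1Dl x y u : r1 (x + y) u = r1 x u + r1 y u.
Proof. by rewrite /r1 mulmxDl. Qed.
Lemma r1Dr x y u : r1 u (x + y) = r1 u x + r1 u y.
Proof. by rewrite /r1 adjvD mulmxDr. Qed.
Lemma r1Zl z x u : r1 (z *: x) u = z *: r1 x u.
Proof. by rewrite /r1 scalemxAl. Qed.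
Lemma r1Zr z x u : r1 u (z *: x) = z^*%C *: r1 u x.
Proof. by rewrite /r1 adjvZ scalemxAr. Qed.

Lemma ipDl x y u : ip (x + y) u = ip x u + ip y u.
Proof. by rewrite /ip adjvD mulmxDl mxE. Qed.
Lemma ipZl z x u : ip (z *: x) u = z^*%C * ip x u.
Proof. by rewrite /ip adjvZ -scalemxAl mxE. Qed.
Lemma ipDr x y u : ip u (x + y) = ip u x + ip u y.
Proof. by rewrite /ip mulmxDr mxE. Qed.
Lemma ipZr z x u : ip u (z *: x) = z * ip u x.
Proof. by rewrite /ip -scalemxAr mxE. Qed.

Lemma adj_r1 x y : adjmat (r1 x y) = r1 y x.
Proof.
rewrite /r1 /adjmat /conjmat map_mxM trmx_mul /adjv; congr (_ *m _).
by apply/matrixP=> i j; rewrite !mxE /= conjcK.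
Qed.

Lemma conj_adjv y : map_mx (@conjc R) (adjv y) = y^T.
Proof. by apply/matrixP=> i j; rewrite !mxE /= conjcK. Qed.

Lemma adjv_jv y : adjv (jv y) = y^T *m (J R n : M)^T.
Proof.
rewrite /adjv /jv map_mxM [map_mx _ (J R n)](conjJ R n) trmx_mul; congr (_ *m _).
by apply/matrixP=> i j; rewrite !mxE /= conjcK.
Qed.

Lemma theta_r1 x y : theta (r1 x y) = r1 (jv x) (jv y).
Proof.
by rewrite /theta /r1 /conjmat map_mxM conj_adjv adjv_jv /jv !mulmxA.
Qed.

Lemma Ad_r1 (U : M) x y : U *m r1 x y *m (adjmat U : M) = r1 (U *m x) (U *m y).
Proof.
rewrite /r1 !mulmxA -mulmxA; congr (_ *m _).
by rewrite /adjv map_mxM trmx_mul.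
Qed.

Lemma r1_mul x y u : r1 x y *m u = ip y u *: x.
Proof.
rewrite /r1 -mulmxA; apply/matrixP=> i j.
by rewrite !mxE big_ord1 !ord1 mulrC.
Qed.

Lemma r1M x y u w : r1 x y *m r1 u w = ip y u *: r1 x w.
Proof. by rewrite {2}/r1 mulmxA r1_mul -scalemxAl. Qed.

Lemma ip_jvl x y : ip (jv x) y = (x^T *m (J R n : M)^T *m y) 0 0.
Proof. by rewrite /ip adjv_jv. Qed.

Lemma jvD x y : jv (x + y) = jv x + jv y.
Proof. by rewrite /jv map_mxD mulmxDr. Qed.

Lemma jvZ z x : jv (z *: x) = z^*%C *: jv x.
Proof. by rewrite /jv map_mxZ scalemxAr. Qed.

Lemma ip_jv0 x : ip (jv x) x = 0.
Proof.
have H : ip (jv x) x = - ip (jv x) x.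
  rewrite ip_jvl; set A := (_ *m _ *m _).
  have AT : A^T = - A by rewrite /A !trmx_mul !trmxK trJ mulmxN mulNmx opprK mulmxA.
  have : A^T 0 0 = - A 0 0 by rewrite AT mxE.
  by rewrite mxE.
have : ip (jv x) x *+ 2 = 0 by rewrite mulr2n {1}H addNr.
by move/eqP; rewrite -mulr_natr mulf_eq0 pnatr_eq0 orbF => /eqP.
Qed.

Lemma ipC x y : (ip x y)^*%C = ip y x.
Proof.
rewrite /ip -[RHS]/((adjv y *m x) 0 0) !mxE raddf_sum; apply: eq_bigr => i _.
by rewrite !mxE /= conjcM conjcK mulrC.
Qed.

Lemma ip_jvjv x y : ip (jv x) (jv y) = ip y x.
Proof.
rewrite ip_jvl /jv -!mulmxA [X in x^T *m X]mulmxA JTJ mul1mx.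
rewrite -ipC /ip !mxE raddf_sum; apply: eq_bigr => i _.
by rewrite !mxE /= conjcM conjcK.
Qed.

Lemma jvK x : jv (jv x) = - x.
Proof.
rewrite /jv map_mxM [map_mx _ (J R n)](conjJ R n) mulmxA JJ2 mulNmx mul1mx; congr (- _).
by apply/matrixP=> i j; rewrite !mxE /= conjcK.
Qed.

(** Multiplication by a unit complex number on the line of w, hence by its
    conjugate on the line of J \bar w: the reflections of the quaternionic space. *)
Definition refl w t : M := 1%:M + t *: r1 w w + t^*%C *: r1 (jv w) (jv w).

Lemma refl_Sp w t : t + t^*%C + t * t^*%C * ip w w = 0 -> Sp_group (refl w t).
Proof.
move=> H; apply/Sp_groupE; split; last first.
  rewrite /refl !thetaD theta1 !thetaZ !theta_r1 conjcK jvK.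
  have -> : r1 (- w) (- w) = r1 w w.
    by rewrite -scaleN1r r1Zl r1Zr conjcN conjc1 scaleN1r scaleN1r opprK.
  by rewrite addrAC.
have j0 : ip w (jv w) = 0 by rewrite -ipC ip_jv0 conjc0.
rewrite /refl !adjmatD !adjmatZ adjmat1 !adj_r1 conjcK.
rewrite !mulmxDl !mulmxDr mul1mx mulmx1 -!scalemxAl -!scalemxAr !r1M ip_jv0 j0.
rewrite ip_jvjv !scale0r !scaler0 !mul1mx !mulmx1 !addr0 !scalerA.
have gen (A B I : M) (s a : C) : t + s + t * s * a = 0 ->
    I + s *: A + t *: B + (t *: A + (t * s * a) *: A) + (s *: B + (s * t * a) *: B) = I.
  move=> H0; transitivity (I + (t + s + t * s * a) *: A + (t + s + t * s * a) *: B).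
    by apply/matrixP => i j; rewrite !mxE; ring.
  by rewrite H0 !scale0r !addr0.
exact: gen.
Qed.

Definition ev (a : 'I_N) : V := delta_mx a 0.

Lemma r1_ev a b : r1 (ev a) (ev b) = delta_mx a b.
Proof.
rewrite /r1 /adjv /ev map_delta_mx trmx_delta.
by rewrite mul_delta_mx.
Qed.

Lemma ip_ev a b : ip (ev a) (ev b) = (a == b)%:R.
Proof.
rewrite /ip /adjv /ev map_delta_mx trmx_delta mul_delta_mx_cond.
by case: (a == b); rewrite ?mulr1n ?mulr0n !mxE.
Qed.

(** The index of the basis vector that J sends to e_a, up to sign. *)
Definition partner (a : 'I_N) : 'I_N :=
  match split a with inl i => rshift n i | inr i => lshift n i end.
Definition psign (a : 'I_N) : C :=
  match split a with inl _ => -1 | inr _ => 1 end.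

Lemma partner_lshift (i : 'I_n) : partner (lshift n i) = rshift n i.
Proof. by rewrite /partner (unsplitK (inl _ i)). Qed.
Lemma partner_rshift (i : 'I_n) : partner (rshift n i) = lshift n i.
Proof. by rewrite /partner (unsplitK (inr _ i)). Qed.
Lemma psign_lshift (i : 'I_n) : psign (lshift n i) = -1.
Proof. by rewrite /psign (unsplitK (inl _ i)). Qed.
Lemma psign_rshift (i : 'I_n) : psign (rshift n i) = 1.
Proof. by rewrite /psign (unsplitK (inr _ i)). Qed.

Lemma partnerK : involutive partner.
Proof.
move=> a; case: (splitP a) => i ai.
  have -> : a = lshift n i by apply: val_inj.
  by rewrite partner_lshift partner_rshift.
have -> : a = rshift n i by apply: val_inj.
by rewrite partner_rshift partner_lshift.
Qed.

Lemma partner_neq a : (partner a == a) = false.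
Proof.
apply/negbTE; case: (splitP a) => i ai.
  have -> : a = lshift n i by apply: val_inj.
  by rewrite partner_lshift eq_rlshift.
have -> : a = rshift n i by apply: val_inj.
by rewrite partner_rshift eq_lrshift.
Qed.

Lemma psign2 a : psign a * psign a = 1.
Proof. by rewrite /psign; case: split => _; rewrite ?mulrNN mulr1. Qed.

Lemma psignJ a : (psign a)^*%C = psign a.
Proof. by rewrite /psign; case: split => _; rewrite ?conjcN conjc1. Qed.

Lemma psign_partner a : psign (partner a) = - psign a.
Proof.
case: (splitP a) => i ai.
  have -> : a = lshift n i by apply: val_inj.
  by rewrite partner_lshift psign_lshift psign_rshift opprK.
have -> : a = rshift n i by apply: val_inj.
by rewrite partner_rshift psign_lshift psign_rshift.
Qed.

Lemma jv_ev a : jv (ev a) = psign a *: ev (partner a).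
Proof.
rewrite /jv /ev map_delta_mx -colE; apply/colP => i.
rewrite [LHS]mxE [RHS]mxE [X in _ * X]mxE eqxx andbT /J.
case: (split_ordP a) => a' ->; case: (split_ordP i) => i' ->.
- rewrite block_mxEul !mxE partner_lshift psign_lshift eq_lrshift mulr0 //.
- rewrite block_mxEdl !mxE partner_lshift psign_lshift eq_rshift mulN1r //.
- rewrite block_mxEur !mxE partner_rshift psign_rshift eq_lshift mul1r //.
- rewrite block_mxEdr !mxE partner_rshift psign_rshift eq_rlshift mulr0 //.
Qed.

Lemma refl_mul w t x :
  refl w t *m x = x + (t * ip w x) *: w + (t^*%C * ip (jv w) x) *: jv w.
Proof. by rewrite /refl !mulmxDl mul1mx -!scalemxAl !r1_mul !scalerA. Qed.

Lemma ip_jv_ev a c : ip (jv (ev a)) (ev c) = psign a * (partner a == c)%:R.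
Proof. by rewrite jv_ev ipZl psignJ ip_ev. Qed.

Lemma refl_fix w t x : ip w x = 0 -> ip (jv w) x = 0 -> refl w t *m x = x.
Proof. by move=> h1 h2; rewrite refl_mul h1 h2 !mulr0 !scale0r !addr0. Qed.

Definition unit2 a l b : V := ev a + l *: ev b.

Lemma ip_unit2 a l b : a != b -> l * l^*%C = 1 -> ip (unit2 a l b) (unit2 a l b) = 2.
Proof.
move=> ab ll; rewrite /unit2 !ipDl !ipDr !ipZl !ipZr !ip_ev !eqxx.
rewrite (negPf ab) [b == a]eq_sym (negPf ab) !mulr0 addr0 add0r mulr1 mulrC ll.
by rewrite -mulr2n.
Qed.

(** The reflections along [e_a + l e_b] move [e_a] out of its line, which no
    diagonal element does. *)
Lemma refl_unit2_sep a l b t : a != b -> b != partner a ->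
  refl (unit2 a l b) t *m ev a = (1 + t) *: ev a + (t * l) *: ev b.
Proof.
move=> ab bpa; rewrite refl_mul /unit2 ipDl ipZl !ip_ev eqxx [b == a]eq_sym (negPf ab).
rewrite mulr0 addr0 mulr1 jvD jvZ ipDl ipZl !ip_jv_ev partner_neq.
have -> : (partner b == a) = false.
  by apply: contraNF bpa => /eqP <-; rewrite partnerK.
rewrite !mulr0 addr0 mulr0 scale0r addr0 scalerDr scalerA addrA.
by rewrite scalerDl scale1r.
Qed.

Lemma refl_unit2_partner a l t : l * l^*%C = 1 ->
  refl (unit2 a l (partner a)) t *m ev a =
  (1 + t + t^*%C) *: ev a + (l * (t - t^*%C)) *: ev (partner a).
Proof.
move=> ll; rewrite refl_mul /unit2 ipDl ipZl !ip_ev eqxx partner_neq.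
rewrite mulr0 addr0 mulr1 jvD jvZ ipDl ipZl !ip_jv_ev partnerK eqxx partner_neq.
rewrite !jv_ev partnerK psign_partner conjcK mulr0 add0r mulr1.
rewrite !scalerDr !scalerA.
move: (psign2 a) ll; move: (psign a) l^*%C => s l' ss ll.
rewrite !scalerDl scale1r.
have -> : t^*%C * (l * - s) * l' * - s = t^*%C.
  by transitivity (t^*%C * (l * l') * (s * s)); [ring | rewrite ss ll !mulr1].
have -> : t^*%C * (l * - s) * s = - (l * t^*%C).
  by transitivity (- (l * t^*%C * (s * s))); [ring | rewrite ss mulr1].
move: (ev a) (ev (partner a)) => x y.
by apply/matrixP => i j; rewrite !mxE; ring.
Qed.

End Reflections.


(** * Schur's lemma for sp(n) and q *)

(** An invariant form [d] that vanishes at (v, v) for one vector [v = i E_00]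
    vanishes altogether.  Diagonal elements of Sp(n) act on the matrix units by
    phases, which makes [v] orthogonal to all the off-diagonal ones; once it is
    also orthogonal to the diagonal ones it lies in the radical of [d], which is
    invariant, and the orbit of [v] spans.  All forms are pulled back to the
    space of all matrices along an equivariant projection onto sp(n)
    ([eps = 1]) or onto q ([eps = -1]). *)
Section Schur.
Variables (R : realType) (n : nat).
Local Notation C := R[i].
Local Notation N := (n + n)%N.
Local Notation M := 'M[C]_(n + n).
Local Notation cm := (cmat R n).
Local Notation E a b := (delta_mx a b : M).
Local Notation ii := (ii R).
Implicit Types (X Y Z : cm) (z t : C) (U : M).

Definition Ad U X : cm := U *m (X : M) *m (adjmat U : M).

Variables (d : cm -> cm -> R) (eps : R).
Hypothesis bd : bilin d.
Hypothesis d_adjl : forall X Y, d (adjmat X) Y = - d X Y.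
Hypothesis d_adjr : forall X Y, d X (adjmat Y) = - d X Y.
Hypothesis d_thetal : forall X Y, d (theta X) Y = eps * d X Y.
Hypothesis d_thetar : forall X Y, d X (theta Y) = eps * d X Y.
Hypothesis d_Ad : forall U, Sp_group U -> forall X Y, d (Ad U X) (Ad U Y) = d X Y.
Variable a0 : 'I_N.
Local Notation v := (ii *: E a0 a0 : cm).
Hypothesis d_vv : d v v = 0.

Lemma Ad_E U z a b : Ad U (z *: E a b) = z *: r1 (U *m ev R a) (U *m ev R b).
Proof. by rewrite /Ad -scalemxAr -scalemxAl -r1_ev Ad_r1. Qed.

Lemma d_split X z a b :
  d X (z *: E a b) = complex.Re z * d X (E a b) + complex.Im z * d X (ii *: E a b).
Proof.
rewrite {1}[z]complexE scalerDl [X in X *: _ + _](_ : _ = (complex.Re z)%:C%C) //.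
rewrite -[(_ *: _ + _ : M)]/((complex.Re z *: (E a b : cm)) + (ii * (complex.Im z)%:C%C) *: E a b : cm).
rewrite (bilDr bd) (bilZr bd) mulrC [ii * _]mulrC -scalerA.
by rewrite -[(_ *: (ii *: _) : M)]/(complex.Im z *: (ii *: E a b : cm)) (bilZr bd) mulrC.
Qed.

Lemma d_v_real a r : d v (r%:C%C *: E a a) = 0.
Proof.
have : adjmat (r%:C%C *: E a a) = r%:C%C *: E a a :> M.
  by rewrite adjmatZ -r1_ev adj_r1 conjc_real.
move=> H; have := d_adjr v (r%:C%C *: E a a); rewrite H => /eqP.
by rewrite -addr_eq0 -mulr2n mulrn_eq0 /= => /eqP.
Qed.

(** The eigenvalues of the reflection along a basis vector. *)
Definition phase a z (c : 'I_N) : C :=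
  if c == a then z else if c == partner a then z^*%C else 1.

Lemma refl_ev a z c : refl (ev R a) (z - 1) *m ev R c = phase a z c *: ev R c.
Proof.
rewrite refl_mul ip_ev ip_jv_ev jv_ev /phase [c == a]eq_sym [c == _]eq_sym.
have [<-|ac] := eqVneq a c.
  by rewrite partner_neq !mulr0 scale0r addr0 mulr1 scalerBl scale1r addrC subrK.
rewrite mulr0 scale0r addr0; have [<-|pac] := eqVneq (partner a) c.
  rewrite mulr1 scalerA -mulrA psign2 mulr1 conjcD conjcN conjc1.
  by rewrite scalerBl scale1r addrC subrK.
by rewrite !mulr0 scale0r addr0 scale1r.
Qed.

Lemma phase_Sp a z : z * z^*%C = 1 -> @Sp_group R n (refl (ev R a) (z - 1)).
Proof.
move=> zz; apply: refl_Sp; rewrite ip_ev eqxx conjcD conjcN conjc1 mulr1.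
by transitivity (z * z^*%C - 1); [ring | rewrite zz subrr].
Qed.

Lemma phase_unit a z c : z * z^*%C = 1 -> phase a z c * (phase a z c)^*%C = 1.
Proof.
move=> zz; rewrite /phase; case: ifP => // _; case: ifP => _.
  by rewrite conjcK mulrC.
by rewrite conjc1 mulr1.
Qed.

Lemma Ad_phase a z t b c : Ad (refl (ev R a) (z - 1)) (t *: E b c) =
  (t * (phase a z b * (phase a z c)^*%C)) *: E b c.
Proof. by rewrite Ad_E !refl_ev r1Zl r1Zr r1_ev !scalerA mulrA. Qed.

Lemma d_v_phase a z t b c : z * z^*%C = 1 ->
  d v (t *: E b c) = d v ((t * (phase a z b * (phase a z c)^*%C)) *: E b c).
Proof.
move=> zz; rewrite -(d_Ad (phase_Sp a zz) v) !Ad_phase.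
by rewrite (phase_unit _ _ zz) mulr1.
Qed.

Lemma d_scaleN X z a b : d X ((- z) *: E a b) = - d X (z *: E a b).
Proof. by rewrite scaleNr (bilNr bd). Qed.

(** A diagonal element of Sp(n) fixes [v] and changes the sign of [E a b]: use the
    phase [i] at [a] if [b] is its partner, and [-1] otherwise. *)
Lemma d_v_offdiag z a b : a != b -> d v (z *: E a b) = 0.
Proof.
move=> ab.
suff H : d v (z *: E a b) = - d v (z *: E a b).
  by move/eqP: H; rewrite -addr_eq0 -mulr2n mulrn_eq0 /= => /eqP.
have [bpa|bpa] := eqVneq b (partner a).
  rewrite {1}(@d_v_phase a ii) ?iiJ ?mulrN ?iiM ?opprK //.
  rewrite /phase eqxx bpa partner_neq eqxx conjcK iiM mulrN1.
  exact: d_scaleN.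
rewrite {1}(@d_v_phase a (-1)) ?conjcN ?conjc1 ?mulrNN ?mulr1 //.
rewrite /phase eqxx [b == a]eq_sym (negPf ab) (negPf bpa) conjc1 mulr1 mulrN1.
exact: d_scaleN.
Qed.

Hypothesis d_diag : forall a, d v (ii *: E a a) = 0.

Lemma d_v0 Y : d v Y = 0.
Proof.
rewrite [Y]matrix_sum_delta (bil_sumr bd) big1 // => i _.
rewrite (bil_sumr bd) big1 // => j _; have [<-|ij] := eqVneq i j; last first.
  exact: d_v_offdiag.
rewrite d_split d_diag mulr0 addr0 -[E i i]scale1r -[1](rmorph1 (real_complex R)).
by rewrite d_v_real mulr0.
Qed.

Definition radical X : Prop := forall Y, d X Y = 0.

Lemma AdK U X : Sp_group U -> Ad U (Ad (adjmat U : M) X) = X.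
Proof.
move=> [U1 _]; rewrite /Ad adjmatK !mulmxA U1 mul1mx -mulmxA U1.
exact: mulmx1.
Qed.

Lemma radical_Ad U X : Sp_group U -> radical X -> radical (Ad U X).
Proof. by move=> SU X0 Y; rewrite -(AdK Y SU) d_Ad. Qed.

Lemma radicalD X Y : radical X -> radical Y -> radical (X + Y).
Proof. by move=> X0 Y0 Z; rewrite (bilDl bd) X0 Y0 addr0. Qed.

Lemma radicalZ r X : radical X -> radical (r *: X).
Proof. by move=> X0 Z; rewrite (bilZl bd) X0 mulr0. Qed.

Lemma radical_diag a : radical (ii *: E a a).
Proof.
have [-> | aa0] := eqVneq a a0; first exact: d_v0.
have [-> | apa0] := eqVneq a (partner a0).
  have H : theta v = (- ii) *: E (partner a0) (partner a0) :> M.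
    rewrite thetaZ iiJ -r1_ev theta_r1 jv_ev r1Zl r1Zr psignJ (scalerA (psign R a0)) psign2 scale1r.
    by rewrite r1_ev.
  move=> Y; have := d_thetal v Y; rewrite H d_v0 mulr0 scaleNr (bilNl bd).
  by move/eqP; rewrite oppr_eq0 => /eqP.
have m1 : (-1 : C) * (-1)^*%C = 1 by rewrite conjcN conjc1 mulrNN mulr1.
have SU : @Sp_group R n (refl (unit2 a0 (-1) a) (-1)).
  apply: refl_Sp; rewrite ip_unit2 // 1?eq_sym // conjcN conjc1 mulrNN mulr1 mul1r.
  by rewrite -opprD -mulr2n addNr.
have := radical_Ad SU d_v0.
rewrite Ad_E refl_unit2_sep ?(eq_sym a0) // subrr scale0r add0r mulrNN mulr1 scale1r.
by rewrite r1_ev.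
Qed.

(** [Ad U] maps [i E_aa] to diagonal units, which are in the radical already, plus
    [Z - adjmat Z] for the matrix [Z] of the conclusion; under [d] this is [2 Z]. *)
Lemma radical_offdiag_of U a b (al ga : C) : Sp_group U ->
  U *m ev R a = al *: ev R a + ga *: ev R b ->
  radical ((ii * (al * ga^*%C)) *: E a b).
Proof.
move=> SU Ua; have H := radical_Ad SU (radical_diag a).
rewrite Ad_E Ua r1Dl !r1Dr !r1Zl !r1Zr !r1_ev in H.
pose Z : cm := (ii * (al * ga^*%C)) *: E a b.
have adjZ : adjmat Z = (- (ii * (al^*%C * ga))) *: E b a :> M.
  by rewrite /Z adjmatZ !conjcM conjcK iiJ mulNr -r1_ev adj_r1 r1_ev.
have nrmE (z : C) : z * z^*%C = (complex.Re (z * z^*%C))%:C%C.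
  by case: z => x y; apply/eqP; rewrite eq_complex /= eqxx /=; apply/eqP; ring.
have rest : radical ((complex.Re (al * al^*%C)) *: (ii *: E a a : cm)
    + (complex.Re (ga * ga^*%C)) *: (ii *: E b b : cm)).
  by apply: radicalD; apply/radicalZ/radical_diag.
move=> Y.
have := H Y.
have -> : ii *: (al *: (al^*%C *: delta_mx a a) + al *: (ga^*%C *: delta_mx a b)
      + (ga *: (al^*%C *: delta_mx b a) + ga *: (ga^*%C *: delta_mx b b))) =
    (complex.Re (al * al^*%C)) *: (ii *: E a a : cm)
    + (complex.Re (ga * ga^*%C)) *: (ii *: E b b : cm) + (Z - adjmat Z) :> cm.
  rewrite adjZ /Z !scale_cmatE -!nrmE.
  move: (al^*%C) (ga^*%C) (delta_mx a a : M) (delta_mx a b : M) (delta_mx b a : M)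
    (delta_mx b b : M) => al' ga' A1 A2 A3 A4.
  have gen : ii *: (al *: (al' *: A1) + al *: (ga' *: A2)
      + (ga *: (al' *: A3) + ga *: (ga' *: A4))) =
    (al * al') *: (ii *: A1) + (ga * ga') *: (ii *: A4)
    + ((ii * (al * ga')) *: A2 - (- (ii * (al' * ga))) *: A3).
    by apply/matrixP => i j; rewrite !mxE; ring.
  exact: gen.
rewrite (bilDl bd) rest add0r (bilBl bd) d_adjl opprK => /eqP.
by rewrite -mulr2n mulrn_eq0 /= => /eqP.
Qed.

Lemma radical_linear_comb z a b :
  radical (E a b) -> radical (ii *: E a b) -> radical (z *: E a b).
Proof.
move=> H1 H2.
have -> : z *: E a b =
    complex.Re z *: (E a b : cm) + complex.Im z *: (ii *: E a b : cm) :> cm.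
  rewrite !scale_cmatE {1}[z]complexE.
  have gen (r s : C) (A : M) : (r + ii * s) *: A = r *: A + s *: (ii *: A).
    by rewrite scalerDl scalerA [s * _]mulrC.
  exact: gen.
by apply: radicalD; apply: radicalZ.
Qed.

Lemma radical_offdiag z a b : a != b -> radical (z *: E a b).
Proof.
move=> ab.
have key l : l * l^*%C = 1 -> radical (l^*%C *: E a b).
  move=> ll.
  have step r (t : C) : r != 0 -> t = r%:C%C * l^*%C -> radical (t *: E a b) ->
      radical (l^*%C *: E a b).
    move=> r0 -> /(radicalZ r^-1); rewrite scale_cmatE scalerA.
    suff -> : (r^-1)%:C%C * (r%:C%C * l^*%C) = l^*%C by [].
    by rewrite mulrA -rmorphM mulVf // mul1r.
  have [bpa|bpa] := eqVneq b (partner a).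
    pose t : C := ((- 5^-1) +i* (2 / 5))%C.
    have SU : @Sp_group R n (refl (unit2 a l b) t).
      apply: refl_Sp; rewrite ip_unit2 //.
      by apply/eqP; rewrite eq_complex /=; apply/andP; split; apply/eqP; lra.
    have Ua := refl_unit2_partner a t ll; rewrite -bpa in Ua.
    apply: (step (12 / 25)) (radical_offdiag_of SU Ua).
      by rewrite mulf_neq0 ?invr_eq0 ?pnatr_eq0.
    have -> : 1 + t + t^*%C = (3 / 5)%:C%C.
      by apply/eqP; rewrite eq_complex /=; apply/andP; split; apply/eqP; lra.
    have -> : t - t^*%C = (0 +i* (4 / 5))%C.
      by apply/eqP; rewrite eq_complex /=; apply/andP; split; apply/eqP; lra.
    rewrite conjcM.
    case: l {ll step SU Ua} => x y.
    by apply/eqP; rewrite eq_complex /=; apply/andP; split; apply/eqP; lra.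
  pose t : C := ((- 2^-1) +i* 2^-1)%C.
  have SU : @Sp_group R n (refl (unit2 a l b) t).
    apply: refl_Sp; rewrite ip_unit2 //.
    by apply/eqP; rewrite eq_complex /=; apply/andP; split; apply/eqP; lra.
  have Ua := refl_unit2_sep l t ab bpa.
  apply: (step 2^-1) (radical_offdiag_of SU Ua).
    by rewrite invr_eq0 pnatr_eq0.
  rewrite conjcM.
  case: l {ll step SU Ua} => x y.
  by apply/eqP; rewrite eq_complex /=; apply/andP; split; apply/eqP; lra.
apply: radical_linear_comb.
  by have := key 1; rewrite conjc1 mulr1 scale1r; apply.
by have := key (- ii); rewrite conjcN iiJ opprK mulNr iiM opprK; apply.
Qed.

Lemma radical_all X : radical X.
Proof.
have sumR (I : eqType) (r : seq I) (F : I -> cm) :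
    (forall i, radical (F i)) -> radical (\sum_(i <- r) F i).
  by move=> HF Y; rewrite (bil_suml bd) big1 // => i _; apply: HF.
rewrite [X]matrix_sum_delta; apply: (@sumR) => i; apply: (@sumR) => j.
have [<-|ij] := eqVneq i j; last exact: radical_offdiag.
apply: radical_linear_comb; last exact: radical_diag.
have H : adjmat (E i i) = E i i :> M by rewrite -r1_ev adj_r1.
move=> Y; have := d_adjl (E i i) Y; rewrite H => /eqP.
by rewrite -addr_eq0 -mulr2n mulrn_eq0 /= => /eqP.
Qed.

End Schur.

(** For [eps = 1], [theta] makes the values of [d v] at the units of [a] and of its
    partner opposite, while an element of Sp(n) that fixes [v] exchanges these
    units.  For [eps = -1], elements that fix [v] permute all diagonal units but
    two, so the values at these agree; their sum is the value at the scalar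
    matrix. *)
Section SchurDiagonal.
Variables (R : realType) (n : nat).
Local Notation C := R[i].
Local Notation N := (n + n)%N.
Local Notation M := 'M[C]_(n + n).
Local Notation cm := (cmat R n).
Local Notation E a b := (delta_mx a b : M).
Local Notation ii := (ii R).
Variables (d : cm -> cm -> R) (eps : R).
Hypothesis bd : bilin d.
Hypothesis d_thetar : forall X Y, d X (theta Y) = eps * d X Y.
Hypothesis d_Ad : forall U : M, @Sp_group R n U -> forall X Y, d (Ad U X) (Ad U Y) = d X Y.
Variable a0 : 'I_N.
Local Notation v := (ii *: E a0 a0 : cm).
Hypothesis d_vv : d v v = 0.

Lemma theta_E a : theta (ii *: E a a) = - (ii *: E (partner a) (partner a)) :> M.
Proof.
rewrite thetaZ iiJ -r1_ev theta_r1 jv_ev r1Zl r1Zr psignJ (scalerA (psign R a)).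
by rewrite psign2 scale1r r1_ev scaleNr.
Qed.

Lemma d_partner a : d v (ii *: E (partner a) (partner a)) = - (eps * d v (ii *: E a a)).
Proof. by rewrite -d_thetar theta_E (bilNr bd) opprK. Qed.

Lemma Ad_v_fix l a b t : a0 != a -> a0 != b -> partner a != a0 -> partner b != a0 ->
  Ad (refl (unit2 a l b) t) v = v.
Proof.
move=> aa ab apa apb; rewrite Ad_E refl_fix ?r1_ev //.
  by rewrite /unit2 ipDl ipZl !ip_ev ![_ == a0]eq_sym (negPf aa) (negPf ab) mulr0 addr0.
rewrite /unit2 jvD jvZ ipDl ipZl !ip_jv_ev (negPf apa) (negPf apb).
by rewrite !mulr0 addr0.
Qed.

Lemma d_diag_plus : eps = 1 -> forall a, d v (ii *: E a a) = 0.
Proof.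
move=> eps1 a.
have [->|aa0] := eqVneq a a0; first exact: d_vv.
have [->|apa0] := eqVneq a (partner a0).
  by rewrite d_partner d_vv mulr0 oppr0.
pose t : C := ((- 2^-1) +i* 2^-1)%C.
have apa : a != partner a by rewrite eq_sym partner_neq.
have one : (1 : C) * 1^*%C = 1 by rewrite conjc1 mulr1.
have SU : @Sp_group R n (refl (unit2 a 1 (partner a)) t).
  apply: refl_Sp; rewrite ip_unit2 //.
  by apply/eqP; rewrite eq_complex /=; apply/andP; split; apply/eqP; lra.
have pa0 : partner a != a0 by apply: contraNneq apa0 => <-; rewrite partnerK.
have := d_Ad SU v (ii *: E a a).
rewrite Ad_v_fix // ?partnerK // 1?eq_sym // Ad_E refl_unit2_partner // mul1r.
have -> : 1 + t + t^*%C = 0.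
  by apply/eqP; rewrite eq_complex /=; apply/andP; split; apply/eqP; lra.
have -> : t - t^*%C = ii.
  by apply/eqP; rewrite eq_complex /=; apply/andP; split; apply/eqP; lra.
rewrite scale0r add0r r1Zl r1Zr r1_ev !scalerA iiM iiJ mulN1r opprK.
rewrite d_partner eps1 mul1r => H.
have : d v (ii *: E a a) *+ 2 = 0 by rewrite mulr2n -{1}H addNr.
by move/eqP; rewrite mulrn_eq0 => /eqP.
Qed.

Lemma d_diag_minus : eps = -1 -> d v (ii *: (1%:M : M)) = 0 ->
  forall a, d v (ii *: E a a) = 0.
Proof.
move=> epsN d1.
have dp a : d v (ii *: E (partner a) (partner a)) = d v (ii *: E a a).
  by rewrite d_partner epsN mulN1r opprK.
have dpa0 : d v (ii *: E (partner a0) (partner a0)) = 0 by rewrite dp d_vv.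
have m1 : (-1 : C) * (-1)^*%C = 1 by rewrite conjcN conjc1 mulrNN mulr1.
pose good a := (a != a0) && (a != partner a0).
have goodp a : good a -> partner a != a0.
  by move=> /andP[_]; apply: contraNneq => <-; rewrite partnerK.
have same a b : good a -> good b -> d v (ii *: E a a) = d v (ii *: E b b).
  move=> ga gb; have [->//|ab] := eqVneq a b.
  have [->|bpa] := eqVneq b (partner a); first by rewrite dp.
  have SU : @Sp_group R n (refl (unit2 a (-1) b) (-1)).
    apply: refl_Sp; rewrite ip_unit2 // conjcN conjc1 mulrNN mulr1 mul1r.
    by rewrite -opprD -mulr2n addNr.
  have [/andP[a1 _] /andP[b1 _]] := (ga, gb).
  rewrite -(d_Ad SU v) Ad_v_fix ?goodp // 1?eq_sym // Ad_E refl_unit2_sep //.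
  by rewrite subrr scale0r add0r mulrNN mulr1 scale1r r1_ev.
move=> a; have [->|aa0] := eqVneq a a0; first exact: d_vv.
have [->|apa0] := eqVneq a (partner a0); first exact: dpa0.
have ga : good a by rewrite /good aa0.
have sumE : ii *: (1%:M : M) = \sum_b ii *: E b b :> cm.
  have gen : ii *: (1%:M : M) = \sum_b ii *: E b b.
    rewrite -scaler_sumr; congr (_ *: _); apply/matrixP => i j.
    rewrite summxE mxE (bigD1 i) //= mxE eqxx big1 ?addr0 ?[j == i]eq_sym // => k /negPf ki.
    by rewrite mxE eq_sym ki.
  exact: gen.
move: d1; rewrite sumE (bil_sumr bd).
rewrite (bigID good) /= [X in _ + X]big1 ?addr0; last first.
  by move=> b; rewrite negb_and !negbK => /orP[] /eqP ->.
rewrite (eq_bigr (fun=> d v (ii *: E a a))); last by move=> b gb; apply: same.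
rewrite sumr_const => /eqP; rewrite mulrn_eq0 => /orP[|/eqP//].
by move=> /eqP/card0_eq/(_ a); rewrite unfold_in => /negbT/negP.
Qed.

End SchurDiagonal.

From mathcomp Require Import all_fingroup.
Import Order.TTheory GRing.Theory Num.Theory.
Local Open Scope ring_scope.


(** * Metrics fixed by the symmetry group *)

Lemma block_preservingP (s : 'S_4) : block_preserving s ->
  ((s i0 = i0 /\ s i1 = i1) \/ (s i0 = i1 /\ s i1 = i0)) /\
  ((s i2 = i2 /\ s i3 = i3) \/ (s i2 = i3 /\ s i3 = i2)).
Proof.
move=> bs.
have lo (i : 'I_4) : (i < 2)%N -> s i = i0 \/ s i = i1.
  move=> lt_i2; have := bs i; rewrite lt_i2.
  by case: (s i) => -[|[|m]] //= H _; [left | right]; apply: val_inj.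
have hi (i : 'I_4) : (2 <= i)%N -> s i = i2 \/ s i = i3.
  move=> le_2i; have := bs i; rewrite [RHS]ltnNge le_2i /=.
  by case: (s i) => -[|[|[|[|m]]]] //= H _; [left | right]; apply: val_inj.
have inj i j : s i = s j -> i = j by apply: perm_inj.
split.
  have [a|a] := lo i0 isT; have [b|b] := lo i1 isT; auto;
  by have := inj i0 i1; rewrite a b => /(_ erefl).
have [a|a] := hi i2 isT; have [b|b] := hi i3 isT; auto;
by have := inj i2 i3; rewrite a b => /(_ erefl).
Qed.

Lemma fourmetric_block (R : realType) (H : vectType R) (Q : H -> H -> R)
    (prk prq : H -> H) p r A B (s : 'S_4) (e : 'I_4 -> bool)
    (x x' y y' : {ffun 'I_4 -> H}) : bilin Q -> block_preserving s ->
  (forall i, prq (x' i) = (-1) ^+ e i *: prq (x (s i))) ->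
  (forall i, prq (y' i) = (-1) ^+ e i *: prq (y (s i))) ->
  (forall i, prk (x' i) = prk (x (s i))) ->
  (forall i, prk (y' i) = prk (y (s i))) ->
  fourmetric Q prk prq p r A B x' y' = fourmetric Q prk prq p r A B x y.
Proof.
move=> bQ bs xq yq xk yk; rewrite /fourmetric !xq !yq !xk !yk.
have sgn b (u v : H) : Q ((-1) ^+ b *: u) ((-1) ^+ b *: v) = Q u v.
  by rewrite (bilZl bQ) (bilZr bQ) mulrA -expr2 sqrr_sign mul1r.
have opp (u v u' v' : H) : Q (u - v) (u' - v') = Q (v - u) (v' - u').
  by rewrite -opprB (bilNl bQ) -[u' - v']opprB (bilNr bQ) opprK.
rewrite !sgn.
have [[[-> ->]|[-> ->]] [[-> ->]|[-> ->]]] := block_preservingP bs => //.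
- by rewrite [Q (prq (x i3)) _ + _]addrC (opp (prk (x i3))) [prk (x i3) + _]addrC [prk (y i3) + _]addrC.
- by rewrite [Q (prq (x i1)) _ + _]addrC (opp (prk (x i1))) [prk (x i1) + _]addrC [prk (y i1) + _]addrC.
- rewrite [Q (prq (x i3)) _ + _]addrC (opp (prk (x i3))) [prk (x i3) + _]addrC [prk (y i3) + _]addrC.
  by rewrite [Q (prq (x i1)) _ + _]addrC (opp (prk (x i1))) [prk (x i1) + _]addrC [prk (y i1) + _]addrC.
Qed.

Section FixedMetrics.
Variables (R : realType) (n : nat).
Hypothesis n_gt1 : (1 < n)%N.
Local Notation N := (n + n)%N.
Local Notation M := 'M[R[i]]_(n + n).
Local Notation cm := (cmat R n).
Local Notation su := (su R n).
Local Notation sp := (sp R n).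
Local Notation qp := (q_part R n).
Local Notation H4 := (fourfold R n).
Local Notation tangent := (tangent R n).
Implicit Types (X Y Z : cm) (x y z : H4) (U : M).

Let n_gt0 : (0 < n)%N. Proof. exact: ltnW. Qed.

Lemma Ad_linear U : linear (@Ad R n U).
Proof.
by move=> a X Y; rewrite /Ad mulmxDr mulmxDl -scalemxAr -scalemxAl.
Qed.

Lemma adj_Ad U X : adjmat (Ad U X) = Ad U (adjmat X).
Proof. by rewrite /Ad !adjmatM adjmatK mulmxA. Qed.

Lemma theta_Ad U X : @Sp_group R n U -> theta (Ad U X) = Ad U (theta X).
Proof. by move=> /Sp_groupE[_ tU]; rewrite /Ad !thetaM theta_adj tU. Qed.

Lemma tr_Ad U X : @Sp_group R n U -> \tr (Ad U X : M) = \tr (X : M).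
Proof. by move=> [U1 _]; rewrite /Ad mxtrace_mulC mulmxA (mulmx1C U1) mul1mx. Qed.

Lemma AdM U X Y : @Sp_group R n U ->
  Ad U (X *m Y : M) = (Ad U X : M) *m (Ad U Y : M) :> M.
Proof.
move=> [U1 _]; rewrite /Ad -!mulmxA; congr (_ *m _); rewrite !mulmxA.
by rewrite -(mulmxA (X : M) (adjmat U : M)) (mulmx1C U1) mulmx1.
Qed.

Lemma Q0_Ad U X Y : @Sp_group R n U -> Q0 (Ad U X) (Ad U Y) = Q0 X Y.
Proof. by move=> SU; rewrite /Q0 adj_Ad -AdM // tr_Ad. Qed.

Lemma su_Ad U X : @Sp_group R n U -> X \in su -> Ad U X \in su.
Proof.
move=> SU /suP[aX tX]; apply/suP; rewrite tr_Ad // tX adj_Ad aX; split=> //.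
exact: (linN (Ad_linear U)).
Qed.

Lemma QH_Ad U X Y : @Sp_group R n U -> X \in su -> Y \in su ->
  QH (Ad U X) (Ad U Y) = QH X Y.
Proof. by move=> SU Xs Ys; rewrite !QHE ?su_Ad // Q0_Ad. Qed.

Lemma pr_k_Ad U X : @Sp_group R n U -> pr_k (Ad U X) = Ad U (pr_k X).
Proof.
by move=> SU; rewrite /pr_k theta_Ad // (linZ (Ad_linear U)) (linD (Ad_linear U)).
Qed.

Lemma pr_q_Ad U X : @Sp_group R n U -> pr_q (Ad U X) = Ad U (pr_q X).
Proof.
by move=> SU; rewrite /pr_q theta_Ad // (linZ (Ad_linear U)) (linB (Ad_linear U)).
Qed.

Lemma Ad_scalar U (z : R[i]) : @Sp_group R n U -> Ad U (z%:M : M) = z%:M :> M.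
Proof. by move=> [U1 _]; rewrite /Ad mul_mx_scalar -scalemxAl U1 scalemx1. Qed.

Lemma skew_Ad U X : skewpart (Ad U X) = Ad U (skewpart X).
Proof. by rewrite /skewpart adj_Ad (linZ (Ad_linear U)) (linB (Ad_linear U)). Qed.

Lemma psu_Ad U X : @Sp_group R n U -> psu (Ad U X) = Ad U (psu X).
Proof.
move=> SU; rewrite /psu skew_Ad tr_Ad // (linB (Ad_linear U)).
by rewrite Ad_scalar.
Qed.

Lemma pk_Ad U X : @Sp_group R n U -> pk (Ad U X) = Ad U (pk X).
Proof. by move=> SU; rewrite /pk skew_Ad pr_k_Ad. Qed.

Lemma pq_Ad U X : @Sp_group R n U -> pq (Ad U X) = Ad U (pq X).
Proof. by move=> SU; rewrite /pq psu_Ad // pr_q_Ad. Qed.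

Lemma skew_adjmat X : skewpart (adjmat X) = - skewpart X.
Proof. by rewrite /skewpart adjmatK -scalerN opprB. Qed.

Lemma psu_adjmat X : psu (adjmat X) = - psu X.
Proof.
rewrite /psu skew_adjmat linearN /= mulNr scalar_mxN opprB opprK addrC.
by [].
Qed.

Lemma pk_adj X : pk (adjmat X) = - pk X.
Proof. by rewrite /pk skew_adjmat (linN (@pr_k_linear R n)). Qed.

Lemma pq_adj X : pq (adjmat X) = - pq X.
Proof. by rewrite /pq psu_adjmat (linN (@pr_q_linear R n)). Qed.

Lemma skew_theta X : skewpart (theta X) = theta (skewpart X).
Proof. by rewrite /skewpart thetaZr thetaB theta_adj. Qed.

Lemma pk_theta X : pk (theta X) = 1 *: pk X.
Proof. by rewrite scale1r /pk skew_theta /pr_k thetaK addrC. Qed.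

Lemma pq_theta X : pq (theta X) = (-1) *: pq X.
Proof.
have H : psu (theta X) = theta (psu X).
  by rewrite /psu thetaB theta_scalar conjcM conjc_inv conjc_nat skew_theta tr_theta.
by rewrite scaleN1r /pq H /pr_q thetaK -[RHS]scalerN (opprB (psu X) (theta (psu X))).
Qed.

Lemma pq_one : pq (ii R *: (1%:M : M)) = 0.
Proof.
have nN : (N%:R : R[i]) != 0 := N_neq0 R n_gt0.
rewrite /pq scalemx1; suff -> : psu ((ii R)%:M : M) = 0 by apply: (lin0 (@pr_q_linear R n)).
have sE : skewpart ((ii R)%:M : M) = (ii R)%:M :> M.
  rewrite /skewpart conjc_scalar iiJ scalar_mxN opprK; exact: double_half.
rewrite /psu sE mxtrace_scalar -[(ii R) *+ _]mulr_natr mulfK //.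
exact: subrr.
Qed.

(** Choose [c] so that [b - c b'] vanishes at the image of [i E_00].  That [b']
    does not vanish there follows from the same lemma, applied to [b'] itself. *)
Lemma schur (P : cm -> cm) (eps : R) (b b' : cm -> cm -> R) :
  linear P -> (forall X, P (adjmat X) = - P X) ->
  (forall X, P (theta X) = eps *: P X) ->
  (forall U, @Sp_group R n U -> forall X, P (Ad U X) = Ad U (P X)) ->
  eps = 1 \/ eps = -1 /\ P (ii R *: (1%:M : M)) = 0 ->
  bilin (fun X Y => b (P X) (P Y)) -> bilin (fun X Y => b' (P X) (P Y)) ->
  (forall U, @Sp_group R n U -> forall X Y, b (Ad U (P X)) (Ad U (P Y)) = b (P X) (P Y)) ->
  (forall U, @Sp_group R n U -> forall X Y, b' (Ad U (P X)) (Ad U (P Y)) = b' (P X) (P Y)) ->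
  (exists X Y, b' (P X) (P Y) != 0) ->
  exists c, forall X Y, b (P X) (P Y) = c * b' (P X) (P Y).
Proof.
move=> lP Padj Pth PAd Peps bb bb' bAd b'Ad [X0 [Y0 b'0]].
pose a0 : 'I_N := lshift n (Ordinal n_gt0).
pose v : cm := ii R *: (delta_mx a0 a0 : M).
have zero (d : cm -> cm -> R) : bilin (fun X Y => d (P X) (P Y)) ->
    (forall U, @Sp_group R n U -> forall X Y, d (Ad U (P X)) (Ad U (P Y)) = d (P X) (P Y)) ->
    d (P v) (P v) = 0 -> forall X Y, d (P X) (P Y) = 0.
  move=> bd dAd dvv; pose D X Y := d (P X) (P Y).
  have thl X Y : D (theta X) Y = eps * D X Y.
    by rewrite -(bilZl bd) /D Pth (linZ lP).
  have thr X Y : D X (theta Y) = eps * D X Y.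
    by rewrite -(bilZr bd) /D Pth (linZ lP).
  have al X Y : D (adjmat X) Y = - D X Y by rewrite -(bilNl bd) /D Padj (linN lP).
  have ar X Y : D X (adjmat Y) = - D X Y by rewrite -(bilNr bd) /D Padj (linN lP).
  have DAd U : @Sp_group R n U -> forall X Y, D (Ad U X) (Ad U Y) = D X Y.
    by move=> SU X Y; rewrite /D !PAd // dAd.
  have diag : forall a, D v (ii R *: (delta_mx a a : M)) = 0.
    case: Peps => [e1 | [eN P1]]; first exact: (d_diag_plus bd thr DAd dvv e1).
    apply: (d_diag_minus bd thr DAd dvv eN).
    by rewrite /D P1 -[0](lin0 lP) (bil0r bd).
  move=> X; exact: (radical_all bd al ar thl DAd diag X).
have b'v : b' (P v) (P v) != 0.
  apply: contraNneq b'0 => H; by rewrite (zero b' bb' b'Ad H).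
exists (b (P v) (P v) / b' (P v) (P v)) => X Y.
pose c := b (P v) (P v) / b' (P v) (P v).
pose d X Y := b X Y - c * b' X Y.
have bd : bilin (fun X Y => d (P X) (P Y)).
  split=> a X1 X2 X3; rewrite /d.
    by rewrite (proj1 bb) (proj1 bb'); ring.
  by rewrite (proj2 bb) (proj2 bb'); ring.
have dAd U : @Sp_group R n U -> forall X Y, d (Ad U (P X)) (Ad U (P Y)) = d (P X) (P Y).
  by move=> SU X1 Y1; rewrite /d bAd // b'Ad.
have dvv : d (P v) (P v) = 0 by rewrite /d /c mulfVK // subrr.
by apply/eqP; rewrite -subr_eq0; apply/eqP; exact: (zero d bd dAd dvv X Y).
Qed.

Lemma Ad4_ten U v Z : Ad4 U (ten v Z) = ten v (Ad U Z).
Proof. by apply/ffunP => i; rewrite !ffunE; apply: (linZ (Ad_linear U) _ Z). Qed.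

Lemma ten_q_tangent v Z : Z \in qp -> ten v Z \in tangent.
Proof.
move=> Zq; apply/tangentE => //; split=> [i|].
  by rewrite ffunE; apply/rpredZ/qp_su.
rewrite big1 // => i _; rewrite ffunE (linZ (@pr_k_linear R n)) pr_k0 //.
exact: scaler0.
Qed.

Lemma ten_k_tangent v Z : Z \in sp ->
  v`_0 + v`_1 + v`_2 + v`_3 = 0 -> ten v Z \in tangent.
Proof.
move=> Zk v0; apply/tangentE => //; split=> [i|].
  by rewrite ffunE; apply/rpredZ/sp_su.
rewrite sum4 !ffunE /= !(linZ (@pr_k_linear R n)) (pr_k_id Zk) -!scalerDl v0.
exact: scale0r.
Qed.

Section Classification.
Variable g : H4 -> H4 -> R.
Hypothesis fg : fixed_metric g.

(** The values of [g] matter on the tangent space only; composing with a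
    projection makes it bilinear everywhere. *)
Definition gm x y : R := g (projv tangent x) (projv tangent y).

Lemma gmE x y : x \in tangent -> y \in tangent -> gm x y = g x y.
Proof. by move=> xm ym; rewrite /gm !projv_id. Qed.

Lemma bilin_gm : bilin gm.
Proof.
have [[gl gs _] _ _] := fg.
have pm x : projv tangent x \in tangent by apply: memv_proj.
have gl' a x y z : gm (a *: x + y) z = a * gm x z + gm y z.
  by rewrite /gm linearP; exact: (gl a _ _ _ (pm x) (pm y) (pm z)).
have sy x y : gm x y = gm y x := gs _ _ (pm x) (pm y).
by split=> // a x y z; rewrite sy gl' !(sy _ z).
Qed.

Lemma bilin_gm_ten v v' : bilin (fun X Y : cm => gm (ten v X) (ten v' Y)).
Proof.
by split=> a X Y Z; rewrite ten_lin; [apply: (proj1 bilin_gm) | apply: (proj2 bilin_gm)].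
Qed.

Lemma bilin_comp (b : cm -> cm -> R) (P : cm -> cm) : linear P -> bilin b ->
  bilin (fun X Y => b (P X) (P Y)).
Proof.
by move=> lP bb; split=> a X Y Z; rewrite lP; [apply: (proj1 bb) | apply: (proj2 bb)].
Qed.

Lemma gm_ten_q v : exists c, forall X Y, X \in qp -> Y \in qp ->
  gm (ten v X) (ten v Y) = c * QH X Y.
Proof.
have [_ gAd _] := fg.
have [X0 X0q X00] := qp_nonzero R n_gt1.
have [||||||||||c H] := @schur (@pq R n) (-1) (fun X Y => gm (ten v X) (ten v Y)) (@QH R n).
- exact: pq_linear.
- exact: pq_adj.
- exact: pq_theta.
- by move=> U SU X; apply: pq_Ad.
- by right; split=> //; apply: pq_one.
- exact: (bilin_comp (@pq_linear R n) (bilin_gm_ten v v)).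
- exact: (bilin_comp (@pq_linear R n) (bilin_QH R n)).
- move=> U SU X Y; have Xq := pq_qp n_gt0 X; have Yq := pq_qp n_gt0 Y.
  have AX : Ad U (pq X) \in qp.
    by have := pq_qp n_gt0 (Ad U X); rewrite (pq_Ad X SU).
  have AY : Ad U (pq Y) \in qp.
    by have := pq_qp n_gt0 (Ad U Y); rewrite (pq_Ad Y SU).
  have tm Z (Zm : Z \in qp) : ten v Z \in tangent := ten_q_tangent v Zm.
  have H := gAd _ SU _ _ (tm _ Xq) (tm _ Yq).
  have H' := esym (congr2 g (Ad4_ten U v (pq X)) (Ad4_ten U v (pq Y))).
  exact: etrans (gmE (tm _ AX) (tm _ AY))
    (etrans H' (etrans H (esym (gmE (tm _ Xq) (tm _ Yq))))).
- by move=> U SU X Y; apply: QH_Ad => //; apply/qp_su/pq_qp.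
- by exists X0, X0; rewrite pq_id // gt_eqF // QH_gt0 // qp_su.
by exists c => X Y Xq Yq; rewrite -{1}(pq_id Xq) -{1}(pq_id Yq) H !pq_id.
Qed.

Lemma gm_ten_k v : v`_0 + v`_1 + v`_2 + v`_3 = 0 ->
  exists c, forall X Y, X \in sp -> Y \in sp ->
  gm (ten v X) (ten v Y) = c * QH X Y.
Proof.
move=> v0; have [_ gAd _] := fg.
have [X0 X0k X00] := sp_nonzero R n_gt1.
have [||||||||||c H] := @schur (@pk R n) 1 (fun X Y => gm (ten v X) (ten v Y)) (@QH R n).
- exact: pk_linear.
- exact: pk_adj.
- exact: pk_theta.
- by move=> U SU X; apply: pk_Ad.
- by left.
- exact: (bilin_comp (@pk_linear R n) (bilin_gm_ten v v)).
- exact: (bilin_comp (@pk_linear R n) (bilin_QH R n)).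
- move=> U SU X Y; have Xk := pk_sp n_gt0 X; have Yk := pk_sp n_gt0 Y.
  have AX : Ad U (pk X) \in sp.
    by have := pk_sp n_gt0 (Ad U X); rewrite (pk_Ad X SU).
  have AY : Ad U (pk Y) \in sp.
    by have := pk_sp n_gt0 (Ad U Y); rewrite (pk_Ad Y SU).
  have tm Z (Zm : Z \in sp) : ten v Z \in tangent := ten_k_tangent Zm v0.
  have H := gAd _ SU _ _ (tm _ Xk) (tm _ Yk).
  have H' := esym (congr2 g (Ad4_ten U v (pk X)) (Ad4_ten U v (pk Y))).
  exact: etrans (gmE (tm _ AX) (tm _ AY))
    (etrans H' (etrans H (esym (gmE (tm _ Xk) (tm _ Yk))))).
- by move=> U SU X Y; apply: QH_Ad => //; apply/sp_su/pk_sp.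
- by exists X0, X0; rewrite pk_id // gt_eqF // QH_gt0 // sp_su.
by exists c => X Y Xk Yk; rewrite -{1}(pk_id Xk) -{1}(pk_id Yk) H !pk_id.
Qed.

End Classification.

End FixedMetrics.


Lemma bilin_diag (R : realType) (V : vectType R) (I : finType) (b : V -> V -> R)
    (f h : I -> V) :
  bilin b -> (forall i j, i != j -> b (f i) (h j) = 0) ->
  b (\sum_i f i) (\sum_i h i) = \sum_i b (f i) (h i).
Proof.
move=> bb off; rewrite bil_suml //; apply: eq_bigr => i _.
rewrite bil_sumr // (bigD1 i) //= big1 ?addr0 // => j ji.
by apply: off; rewrite eq_sym.
Qed.

Lemma sum3 (T : nmodType) (F : 'I_3 -> T) :
  \sum_i F i = F ord0 + F (lift ord0 ord0) + F (lift ord0 (lift ord0 ord0)).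
Proof. by rewrite !big_ord_recl big_ord0 addr0 !addrA. Qed.

Section Classify.
Variables (R : realType) (n : nat).
Hypothesis n_gt1 : (1 < n)%N.
Local Notation cm := (cmat R n).
Local Notation su := (su R n).
Local Notation sp := (sp R n).
Local Notation qp := (q_part R n).
Local Notation H4 := (fourfold R n).
Local Notation tangent := (tangent R n).
Local Notation vq := (vq R).
Local Notation vk := (vk R).
Implicit Types (X Y Z : cm) (x y z : H4).

Let n_gt0 : (0 < n)%N. Proof. exact: ltnW. Qed.

Lemma gamma_ten e s v Z : gamma e s (ten v Z) =
  [ffun i : 'I_4 => v`_(s i) *: (if e i then theta Z else Z)].
Proof.
apply/ffunP => i; rewrite !ffunE; case: (e i) => //.
exact: thetaZr.
Qed.

Lemma block_tperm01 : block_preserving (tperm i0 i1).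
Proof. by apply: forall4; rewrite permE. Qed.

Lemma block_tperm23 : block_preserving (tperm i2 i3).
Proof. by apply: forall4; rewrite permE. Qed.

Lemma block_perm1 : block_preserving 1%g.
Proof. by move=> i; rewrite perm1. Qed.

Lemma vk_sum j : (vk j)`_0 + (vk j)`_1 + (vk j)`_2 + (vk j)`_3 = 0.
Proof. by rewrite /vk; case: j => [|[|[|j]]] /=; rewrite ?nth_nil /=; ring. Qed.

Lemma vqE (i j : 'I_4) : (vq i)`_j = (i == j)%:R.
Proof. by elim/forall4: i; elim/forall4: j. Qed.

Section Metric.
Variable g : H4 -> H4 -> R.
Hypothesis fg : fixed_metric g.
Local Notation gm := (gm g).

Lemma gm_sym x y : gm x y = gm y x.
Proof. by have [[_ gs _] _ _] := fg; apply: gs; apply: memv_proj. Qed.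

(** An element of the group that acts by [-1] on one summand and by [1] on another
    makes them orthogonal. *)
Lemma gm_cross e s x y : block_preserving s -> x \in tangent -> y \in tangent ->
  gamma e s x = - x -> gamma e s y = y -> gm x y = 0.
Proof.
have [_ _ gG] := fg => bs xm ym ex ey.
have H := gG e s bs x y xm ym; rewrite ex ey in H.
have xNm : - x \in tangent by rewrite rpredN.
have E : - gm x y = gm x y.
  by rewrite -(bilNl (bilin_gm fg)) (gmE g xNm ym) (gmE g xm ym).
by move/eqP: E; rewrite eq_sym -addr_eq0 -mulr2n mulrn_eq0 /= => /eqP.
Qed.

Lemma ten_opp v Z : - ten v Z = ten v (- Z).
Proof. by rewrite (linN (@ten_lin R cm v)). Qed.

Lemma cross_q (i : 'I_4) X v Z : X \in qp -> ten v Z \in tangent ->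
  v`_i = 0 \/ Z \in sp -> gm (ten (vq i) X) (ten v Z) = 0.
Proof.
move=> Xq tm vZ.
apply: (gm_cross (e := pred1 i) block_perm1) => //; first exact: ten_q_tangent.
  rewrite gamma_ten ten_opp; apply/ffunP => j; rewrite !ffunE perm1 /=.
  rewrite vqE; have [_|_] := eqVneq j i; first by rewrite qp_theta.
  by rewrite !scale0r.
rewrite gamma_ten; apply/ffunP => j; rewrite !ffunE perm1 /=.
have [->|//] := eqVneq j i; case: vZ => [->|Zk]; first by rewrite !scale0r.
by rewrite sp_theta.
Qed.

Lemma cross_k (i j : 'I_3) Z Z' : Z \in sp -> Z' \in sp -> (i < j)%N ->
  gm (ten (vk i) Z) (ten (vk j) Z') = 0.
Proof.
move=> Zk Z'k ij.
have m1 := ten_k_tangent n_gt1 Zk (vk_sum i).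
have m2 := ten_k_tangent n_gt1 Z'k (vk_sum j).
have sw (s : 'S_4) (v : seq R) (W : cm) :
    ten [seq v`_(s k) | k <- [:: i0; i1; i2; i3]] W = gamma (fun=> false) s (ten v W).
  by rewrite gamma_ten; apply/ffunP; elim/forall4; rewrite !ffunE.
case: i j ij m1 m2 => -[|[|[|i]]] // lti [[|[|[|j]]] // ltj] _ m1 m2;
  [ apply: (gm_cross (e := fun=> false) block_tperm01 m1 m2)
  | apply: (gm_cross (e := fun=> false) block_tperm01 m1 m2)
  | apply: (gm_cross (e := fun=> false) block_tperm23 m1 m2) ];
  rewrite -sw /= !permE /= ?ten_opp; apply/ffunP; elim/forall4; rewrite !ffunE /= ?scale0r ?scale1r ?scaleN1r ?opprK //.
Qed.

Definition tcoef (x : H4) (j : nat) : cm := nth 0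
  [:: pr_k (x i0) - pr_k (x i1); pr_k (x i2) - pr_k (x i3); pr_k (x i0) + pr_k (x i1)] j.

Lemma tcoef_sp x j : x \in tangent -> tcoef x j \in sp.
Proof.
move=> xm; have ks i := tangent_pr_k n_gt0 i xm.
rewrite /tcoef; case: j => [|[|[|j]]] /=; rewrite ?nth_nil ?mem0v //.
- by apply: rpredB.
- by apply: rpredB.
- by apply: rpredD.
Qed.

Definition part x (t : 'I_4 + 'I_3) : H4 :=
  match t with
  | inl i => ten (vq i) (pr_q (x i))
  | inr j => ten (vk j) (2^-1 *: tcoef x j)
  end.

Lemma sum_part x : x \in tangent -> x = \sum_t part x t.
Proof.
move=> xm; rewrite {1}(tangent_vec n_gt0 xm) vec_tens big_sumType /= sum4 sum3.
reflexivity.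
Qed.

Lemma gm_parts x y : x \in tangent -> y \in tangent ->
  gm x y = \sum_t gm (part x t) (part y t).
Proof.
move=> xm ym; rewrite {1}(sum_part xm) {1}(sum_part ym).
apply: (bilin_diag (bilin_gm fg)).
have qs z i : z \in tangent -> pr_q (z i) \in qp by move=> zm; apply: tangent_pr_q.
have ks z j : z \in tangent -> 2^-1 *: tcoef z j \in sp.
  by move=> zm; apply/rpredZ/tcoef_sp.
have cq (z z' : H4) (i : 'I_4) (j : 'I_3) : z \in tangent -> z' \in tangent ->
    gm (part z (inl i)) (part z' (inr j)) = 0.
  move=> zm z'm; apply: cross_q; [exact: qs| |right; exact: ks].
  exact: (ten_k_tangent n_gt1 (ks _ _ z'm) (vk_sum j)).
case=> [i|i] [j|j] ij.
- apply: cross_q; [exact: qs | exact/ten_q_tangent/qs | left].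
  rewrite vqE; case: eqVneq => // ji; case/eqP: ij; by rewrite ji.
- exact: cq.
- by rewrite gm_sym; apply: cq.
- case: (ltngtP i j) => [lt_ij|lt_ji|eq_ij].
  + by apply: cross_k => //; apply: ks.
  + by rewrite gm_sym; apply: cross_k => //; apply: ks.
  + by case/eqP: ij; congr inr; apply: val_inj.
Qed.

Lemma gm_ten_gt0 v Z (i : 'I_4) : ten v Z \in tangent -> Z != 0 -> v`_i != 0 ->
  0 < gm (ten v Z) (ten v Z).
Proof.
move=> tm Z0 vi; have [[_ _ gp] _ _] := fg.
rewrite (gmE g tm tm); apply: gp => //; apply: contraNneq Z0 => /ffunP/(_ i).
by rewrite !ffunE => /eqP; rewrite scaler_eq0 (negPf vi).
Qed.

Lemma gm_swap (s : 'S_4) v v' X Y : block_preserving s ->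
  ten v X \in tangent -> ten v Y \in tangent ->
  (forall i : 'I_4, v'`_i = v`_(s i)) -> gm (ten v' X) (ten v' Y) = gm (ten v X) (ten v Y).
Proof.
move=> bs mX mY v'E; have [_ _ gG] := fg.
have E Z : ten v' Z = gamma (fun=> false) s (ten v Z).
  by rewrite gamma_ten; apply/ffunP => i; rewrite !ffunE v'E.
have H := gG (fun=> false) s bs _ _ mX mY; rewrite -!E in H.
have mv' Z : ten v Z \in tangent -> ten v' Z \in tangent.
  move=> /(tangentE n_gt0)[tsu tk]; apply/(tangentE n_gt0); split=> [i|].
    by have := tsu (s i); rewrite !ffunE v'E.
  rewrite -[RHS]tk [RHS](reindex_inj (@perm_inj _ s)).
  by apply: eq_bigr => i _; rewrite !ffunE v'E.
by rewrite (gmE g (mv' _ mX) (mv' _ mY)) (gmE g mX mY).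
Qed.

(** The seven summands are mutually orthogonal, by involutions and transpositions;
    Schur's lemma leaves one scale on each, and the transpositions identify the
    scales of the summands that they exchange. *)
Lemma fixed_metric_homothetic : exists p q A B : R,
  [/\ 0 < p, 0 < q, 0 < A & 0 < B] /\ homothetic tangent g (@metric R n p q A B).
Proof.
have [K Kk K0] := sp_nonzero R n_gt1; have [X Xq X0] := qp_nonzero R n_gt1.
have QK : 0 < QH K K by rewrite QH_gt0 // sp_su.
have QX : 0 < QH X X by rewrite QH_gt0 // qp_su.
have mq v Z (Zq : Z \in qp) : ten v Z \in tangent := ten_q_tangent n_gt1 v Zq.
have mk j Z (Zk : Z \in sp) : ten (vk j) Z \in tangent := ten_k_tangent n_gt1 Zk (vk_sum j).
have [c0 H0] := gm_ten_q n_gt1 fg (vq i0); have [c1 H1] := gm_ten_q n_gt1 fg (vq i1).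
have [c2 H2] := gm_ten_q n_gt1 fg (vq i2); have [c3 H3] := gm_ten_q n_gt1 fg (vq i3).
have [d0 G0] := gm_ten_k n_gt1 fg (vk_sum 0); have [d1 G1] := gm_ten_k n_gt1 fg (vk_sum 1).
have [d2 G2] := gm_ten_k n_gt1 fg (vk_sum 2).
have pos (c Q : R) : 0 < Q -> 0 < c * Q -> 0 < c by move=> Q0; rewrite pmulr_lgt0.
have nX : QH X X != 0 by rewrite gt_eqF.
have v01 : forall i : 'I_4, (vq i1)`_i = (vq i0)`_(tperm i0 i1 i).
  by apply: forall4; rewrite permE.
have v23 : forall i : 'I_4, (vq i3)`_i = (vq i2)`_(tperm i2 i3 i).
  by apply: forall4; rewrite permE.
have c01 : c1 = c0.
  apply: (mulIf nX); have E := gm_swap block_tperm01 (mq _ _ Xq) (mq _ _ Xq) v01.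
  exact: etrans (esym (H1 _ _ Xq Xq)) (etrans E (H0 _ _ Xq Xq)).
have c23 : c3 = c2.
  apply: (mulIf nX); have E := gm_swap block_tperm23 (mq _ _ Xq) (mq _ _ Xq) v23.
  exact: etrans (esym (H3 _ _ Xq Xq)) (etrans E (H2 _ _ Xq Xq)).
have one0 : (1 : R) != 0 := oner_neq0 R.
have c0p : 0 < c0.
  apply: pos QX _; have := gm_ten_gt0 (i := i0) (mq (vq i0) _ Xq) X0 one0.
  by rewrite (H0 _ _ Xq Xq).
have c2p : 0 < c2.
  apply: pos QX _; have := gm_ten_gt0 (i := i2) (mq (vq i2) _ Xq) X0 one0.
  by rewrite (H2 _ _ Xq Xq).
have d0p : 0 < d0.
  apply: pos QK _; have := gm_ten_gt0 (i := i0) (mk 0 _ Kk) K0 one0.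
  by rewrite (G0 _ _ Kk Kk).
have d1p : 0 < d1.
  apply: pos QK _; have := gm_ten_gt0 (i := i2) (mk 1 _ Kk) K0 one0.
  by rewrite (G1 _ _ Kk Kk).
have d2p : 0 < d2.
  apply: pos QK _; have := gm_ten_gt0 (i := i0) (mk 2 _ Kk) K0 one0.
  by rewrite (G2 _ _ Kk Kk).
pose c := d2 / 4.
have cp : 0 < c by rewrite divr_gt0.
exists (c0 / c), (c2 / c), (d0 / (2 * c)), (d1 / (2 * c)); split.
  by split; apply: divr_gt0 => //; apply: mulr_gt0.
exists c => // x y xm ym.
have qs z i : z \in tangent -> pr_q (z i) \in qp by move=> zm; apply: tangent_pr_q.
have ts z j : z \in tangent -> tcoef z j \in sp by apply: tcoef_sp.
have hs z j : z \in tangent -> 2^-1 *: tcoef z j \in sp.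
  by move=> zm; apply/rpredZ/tcoef_sp.
have bQ := bilin_QH R n.
have half (t t' : cm) : QH (2^-1 *: t) (2^-1 *: t') = 4^-1 * QH t t' :> R.
  rewrite (bilZl bQ) (bilZr bQ) mulrA; congr (_ * _); by field.
have P0 := H0 _ _ (qs _ i0 xm) (qs _ i0 ym); have P1 := H1 _ _ (qs _ i1 xm) (qs _ i1 ym).
have P2 := H2 _ _ (qs _ i2 xm) (qs _ i2 ym); have P3 := H3 _ _ (qs _ i3 xm) (qs _ i3 ym).
have N0 := etrans (G0 _ _ (hs _ 0%N xm) (hs _ 0%N ym)) (congr1 ( *%R d0) (half _ _)).
have N1 := etrans (G1 _ _ (hs _ 1%N xm) (hs _ 1%N ym)) (congr1 ( *%R d1) (half _ _)).
have N2 := etrans (G2 _ _ (hs _ 2 xm) (hs _ 2 ym)) (congr1 ( *%R d2) (half _ _)).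
have ME p q A B := metric_vec2 p q A B (qs _ i0 xm) (qs _ i1 xm) (qs _ i2 xm) (qs _ i3 xm)
  (ts _ 0%N xm) (ts _ 1%N xm) (ts _ 2 xm) (qs _ i0 ym) (qs _ i1 ym) (qs _ i2 ym) (qs _ i3 ym)
  (ts _ 0%N ym) (ts _ 1%N ym) (ts _ 2 ym).
have comb (a0 a1 a2 a3 b0 b1 b2 : R) :
    c0 * a0 + c1 * a1 + c2 * a2 + c3 * a3
      + (d0 * (4^-1 * b0) + d1 * (4^-1 * b1) + d2 * (4^-1 * b2)) =
    c * (c0 / c * (a0 + a1) + c2 / c * (a2 + a3) + d0 / (2 * c) / 2 * b0
      + d1 / (2 * c) / 2 * b1 + b2).
  by rewrite c01 c23 /c; field; rewrite gt_eqF.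
have S : \sum_t gm (part x t) (part y t) =
    gm (part x (inl i0)) (part y (inl i0))
    + gm (part x (inl i1)) (part y (inl i1))
    + gm (part x (inl i2)) (part y (inl i2))
    + gm (part x (inl i3)) (part y (inl i3))
    + (gm (part x (inr ord0)) (part y (inr ord0))
    + gm (part x (inr (lift ord0 ord0))) (part y (inr (lift ord0 ord0)))
    + gm (part x (inr (lift ord0 (lift ord0 ord0)))) (part y (inr (lift ord0 (lift ord0 ord0))))).
  by rewrite big_sumType sum4 sum3.
have ME' := ME (c0 / c) (c2 / c) (d0 / (2 * c)) (d1 / (2 * c)).
have Mx := congr2 (@metric R n (c0 / c) (c2 / c) (d0 / (2 * c)) (d1 / (2 * c)))
  (tangent_vec n_gt0 xm) (tangent_vec n_gt0 ym).
have EQ := f_equal2 +%R (f_equal2 +%R (f_equal2 +%R (f_equal2 +%R P0 P1) P2) P3)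
  (f_equal2 +%R (f_equal2 +%R N0 N1) N2).
exact: etrans (esym (gmE g xm ym)) (etrans (gm_parts xm ym) (etrans S (etrans EQ
  (etrans (comb _ _ _ _ _ _ _) (congr1 ( *%R c) (esym (etrans Mx ME'))))))).
Qed.

End Metric.

End Classify.


(** * Metrics of the family *)

Lemma fourmetric_isometry (R : realType) (H : vectType R) (Q : H -> H -> R)
    (prk prq T : H -> H) (U : {vspace H}) p r A B (x x' y y' : {ffun 'I_4 -> H}) :
  linear T -> (forall u v, u \in U -> v \in U -> Q (T u) (T v) = Q u v) ->
  (forall i, prk (x i) \in U /\ prq (x i) \in U) ->
  (forall i, prk (y i) \in U /\ prq (y i) \in U) ->
  (forall i, prk (x' i) = T (prk (x i)) /\ prq (x' i) = T (prq (x i))) ->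
  (forall i, prk (y' i) = T (prk (y i)) /\ prq (y' i) = T (prq (y i))) ->
  fourmetric Q prk prq p r A B x' y' = fourmetric Q prk prq p r A B x y.
Proof.
move=> lT QT xU yU xE yE; rewrite /fourmetric.
have [xk xq] := (fun i => proj1 (xE i), fun i => proj2 (xE i)).
have [yk yq] := (fun i => proj1 (yE i), fun i => proj2 (yE i)).
rewrite !xk !xq !yk !yq -!(linB lT) -!(linD lT) -!(linB lT).
rewrite !QT ?rpredB ?rpredD //; by [apply: (proj1 (xU _)) | apply: (proj2 (xU _)) | apply: (proj1 (yU _)) | apply: (proj2 (yU _))].
Qed.

Section Family.
Variables (R : realType) (n : nat).
Hypothesis n_gt1 : (1 < n)%N.
Local Notation cm := (cmat R n).
Local Notation su := (su R n).
Local Notation sp := (sp R n).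
Local Notation qp := (q_part R n).
Local Notation H4 := (fourfold R n).
Local Notation tangent := (tangent R n).
Local Notation metric := (@metric R n).
Implicit Types (X Y Z : cm) (x y z : H4) (g : H4 -> H4 -> R).

Let n_gt0 : (0 < n)%N. Proof. exact: ltnW. Qed.

Lemma metric_fixed p q A B : 0 < p -> 0 < q -> 0 < A -> 0 < B ->
  fixed_metric (metric p q A B).
Proof.
move=> p0 q0 A0 B0; split; first exact: metric_inner.
- move=> U SU x y xm ym; rewrite !metricE.
  have kU z (zm : z \in tangent) i : pr_k (z i) \in su /\ pr_q (z i) \in su.
    split; first exact: (sp_su (tangent_pr_k n_gt0 i zm)).
    exact: (qp_su (tangent_pr_q n_gt0 i zm)).
  have eU z i : pr_k (Ad4 U z i) = Ad U (pr_k (z i)) /\ pr_q (Ad4 U z i) = Ad U (pr_q (z i)).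
    by rewrite ffunE; split; [exact: (pr_k_Ad (z i) SU) | exact: (pr_q_Ad (z i) SU)].
  apply: (fourmetric_isometry (T := Ad U) (U := su)) (kU x xm) (kU y ym) (eU x) (eU y).
  + exact: Ad_linear.
  + by move=> u v us vs; apply: QH_Ad.
- move=> eps s bs x y xm ym; rewrite !metricE.
  have thq X : pr_q (theta X) = - pr_q X by rewrite /pr_q thetaK -[RHS]scalerN (opprB X).
  have thk X : pr_k (theta X) = pr_k X by rewrite /pr_k thetaK addrC.
  have eq z i : pr_q (gamma eps s z i) = (-1) ^+ eps i *: pr_q (z (s i)).
    by rewrite ffunE; case: (eps i); rewrite ?thq ?expr1 ?expr0 ?scaleN1r ?scale1r.
  have ek z i : pr_k (gamma eps s z i) = pr_k (z (s i)).
    by rewrite ffunE; case: (eps i); rewrite ?thk.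
  exact: fourmetric_block (bilin_QH R n) bs (eq x) (eq y) (ek x) (ek y).
Qed.

Lemma homothetic_refl g : homothetic tangent g g.
Proof. by exists 1 => // x y _ _; rewrite mul1r. Qed.

Lemma homothetic_metric_inj p q A B p' q' A' B' :
  homothetic tangent (metric p q A B) (metric p' q' A' B') ->
  [/\ p = p', q = q', A = A' & B = B'].
Proof.
move=> [c _ gE].
have [K Kk K0] := sp_nonzero R n_gt1; have [X Xq X0] := qp_nonzero R n_gt1.
have nK : nrmH K != 0 by rewrite gt_eqF // QH_gt0 // sp_su.
have nX : nrmH X != 0 by rewrite gt_eqF // QH_gt0 // qp_su.
have n0 : nrmH (0 : cm) = 0 by apply: nrmH0.
have zq : 0 \in qp by apply: mem0v.
have zk : 0 \in sp by apply: mem0v.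
have H X0' X1' X2' X3' a' b' s' (m0 : X0' \in qp) (m1 : X1' \in qp) (m2 : X2' \in qp)
    (m3 : X3' \in qp) (ma : a' \in sp) (mb : b' \in sp) (ms : s' \in sp) :
    p * (nrmH X0' + nrmH X1') + q * (nrmH X2' + nrmH X3')
      + A / 2 * nrmH a' + B / 2 * nrmH b' + nrmH s' =
    c * (p' * (nrmH X0' + nrmH X1') + q' * (nrmH X2' + nrmH X3')
      + A' / 2 * nrmH a' + B' / 2 * nrmH b' + nrmH s').
  have vm := vec_tangent n_gt0 m0 m1 m2 m3 ma mb ms.
  exact: etrans (esym (metric_vec p q A B m0 m1 m2 m3 ma mb ms))
    (etrans (gE _ _ vm vm) (congr1 ( *%R c) (metric_vec p' q' A' B' m0 m1 m2 m3 ma mb ms))).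
have E1 := H _ _ _ _ _ _ _ Xq zq zq zq zk zk zk.
have E2 := H _ _ _ _ _ _ _ zq zq Xq zq zk zk zk.
have E3 := H _ _ _ _ _ _ _ zq zq zq zq Kk zk zk.
have E4 := H _ _ _ _ _ _ _ zq zq zq zq zk Kk zk.
have E5 := H _ _ _ _ _ _ _ zq zq zq zq zk zk Kk.
rewrite !n0 !(addr0, mulr0, add0r) in E1 E2 E3 E4 E5.
have c1 : c = 1 by apply: (mulIf nK); rewrite mul1r -[LHS]E5.
rewrite c1 !mul1r in E1 E2 E3 E4.
move: (mulIf nX E1) (mulIf nX E2) (mulIf nK E3) (mulIf nK E4) => h1 h2 h3 h4.
have two : (2^-1 : R) != 0 by rewrite invr_eq0 pnatr_eq0.
by split=> //; apply: (mulIf two).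
Qed.

Lemma symmetric_metricP p q A B : 0 < p ->
  symmetric_metric (metric p q A B) <-> [/\ p = q, A = 1 & B = 1].
Proof.
move=> p0; split=> [[p' p'0 /homothetic_metric_inj[-> -> -> ->]] // | [<- -> ->]].
by exists p => //; apply: homothetic_refl.
Qed.

Lemma br4_linear x y : linear (@br4 R n x) /\ linear ((@br4 R n)^~ y).
Proof.
split=> a u v; apply/ffunP => i; rewrite !ffunE.
  exact: cbr_linearr.
exact: cbr_linearl.
Qed.

Lemma einstein4_homothetic g g' : fixed_metric g' -> homothetic tangent g g' ->
  einstein4 g -> einstein4 g'.
Proof.
by move=> [ip _ _] h; apply: einstein_homothetic => // x y; apply: br4_linear.
Qed.

End Family.

From Stdlib Require Import BinInt Pnat.
From mathcomp Require Import all_boot all_order all_algebra.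
From mathcomp Require Import ring lra ssrZ.
From mathcomp Require Import boolp classical_sets functions topology normedtype derive realfun.
Import Order.TTheory GRing.Theory Num.Theory.
Import numFieldNormedType.Exports.
Local Open Scope ring_scope.


(** * Certified signs and monotonicity of rational functions *)

Section IntegerPolynomials.
Local Open Scope classical_set_scope.
Local Open Scope ring_scope.
Variable R : realType.
Implicit Types (s : seq Z) (x y t : R).

Definition of_Z (z : Z) : R := (int_of_Z z)%:~R.

Lemma of_ZD (a b : Z) : of_Z (Z.add a b) = of_Z a + of_Z b.
Proof. by rewrite /of_Z -intrD -[in RHS]rmorphD. Qed.

Lemma of_ZM (a b : Z) : of_Z (Z.mul a b) = of_Z a * of_Z b.
Proof. by rewrite /of_Z -intrM -[in RHS]rmorphM. Qed.

Lemma of_Z_ge0 (a : Z) : Z.leb Z0 a -> 0 <= of_Z a.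
Proof. by case: a => [|a|a] // _; rewrite /of_Z ler0z. Qed.

Lemma of_Z_gt0 (a : Z) : Z.ltb Z0 a -> 0 < of_Z a.
Proof.
case: a => [|a|a] // _; rewrite /of_Z ltr0z /= ltz_nat.
by apply/ssrnat.ltP; apply: Pos2Nat.is_pos.
Qed.

(** Integers are binary here, and coefficients are listed from the constant term
    on; the certificates below are evaluated by reduction. *)
Fixpoint evalZ s x : R := if s is c :: s' then of_Z c + x * evalZ s' x else 0.

Fixpoint addp s1 s2 : seq Z :=
  match s1, s2 with
  | a :: s1', b :: s2' => Z.add a b :: addp s1' s2'
  | [::], _ => s2
  | _, [::] => s1
  end.

Definition scalep (a : Z) s : seq Z := map (Z.mul a) s.

Fixpoint mulp s1 s2 : seq Z :=
  if s1 is a :: s1' then addp (scalep a s2) (Z0 :: mulp s1' s2) else [::].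

Fixpoint derp s : seq Z := if s is _ :: s' then addp s' (Z0 :: derp s') else [::].

Fixpoint expp s k : seq Z := if k is k'.+1 then mulp s (expp s k') else [:: Zpos xH].

Definition subp s1 s2 := addp s1 (scalep (Zneg xH) s2).

Lemma of_Z0 : of_Z Z0 = 0. Proof. by []. Qed.
Lemma of_Z1 : of_Z (Zpos xH) = 1. Proof. by []. Qed.

Lemma evalD s1 s2 x : evalZ (addp s1 s2) x = evalZ s1 x + evalZ s2 x.
Proof.
elim: s1 s2 => [|a s1 IH] [|b s2] /=; rewrite ?add0r ?addr0 //.
by rewrite IH of_ZD; ring.
Qed.

Lemma evalC a s x : evalZ (scalep a s) x = of_Z a * evalZ s x.
Proof. by elim: s => [|b s IH] /=; rewrite ?mulr0 // IH of_ZM; ring. Qed.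

Lemma evalM s1 s2 x : evalZ (mulp s1 s2) x = evalZ s1 x * evalZ s2 x.
Proof.
elim: s1 => [|a s1 IH] /=; first by rewrite mul0r.
by rewrite evalD /= IH evalC of_Z0; ring.
Qed.

Lemma evalB s1 s2 x : evalZ (subp s1 s2) x = evalZ s1 x - evalZ s2 x.
Proof. by rewrite /subp evalD evalC (_ : of_Z (Zneg xH) = -1) // mulN1r. Qed.

Lemma evalX s k x : evalZ (expp s k) x = evalZ s x ^+ k.
Proof.
elim: k => [|k IH] /=; first by rewrite of_Z1 mulr0 addr0.
by rewrite evalM IH exprS.
Qed.

(** The numerator of a Moebius transform: multiplied by the denominator
    [evalZ [:: c; d] t] to the power [size s], the value of [s] at
    [(a + b * t) / (c + d * t)] becomes a polynomial in [t]. *)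
Fixpoint moebius (num den s : seq Z) : seq Z :=
  if s is c :: s' then
    addp (scalep c (expp den (size s'))) (mulp num (moebius num den s'))
  else [::].

Lemma moebiusE num den s x t : x * evalZ den t = evalZ num t ->
  evalZ (moebius num den s) t * evalZ den t = evalZ den t ^+ size s * evalZ s x.
Proof.
move=> xE; elim: s => [|c s IH] /=; first by rewrite mul0r mulr0.
rewrite evalD evalC evalX evalM mulrDl -(mulrA (evalZ num t)) IH -xE exprS.
by ring.
Qed.

Definition pos_coefs s : bool :=
  if s is c :: s' then Z.ltb Z0 c && all (Z.leb Z0) s' else false.

Lemma pos_coefsP s t : 0 <= t -> pos_coefs s -> 0 < evalZ s t.
Proof.
move=> t0; case: s => //= c s /andP[/of_Z_gt0 c0 s0]; apply: ltr_wpDr => //.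
apply: mulr_ge0 => //; elim: s s0 => //= d s IH /andP[d0 /IH s0].
by apply: addr_ge0; [exact: of_Z_ge0 | exact: mulr_ge0].
Qed.

(** Positivity on the interval from [a/c] to [b/d], the second end excluded;
    [d = 0] makes it a half line.  The parameter [t = (c x - a) / (b - d x)] is
    nonnegative there, so it is enough that the numerator of the Moebius
    transform has nonnegative coefficients. *)
Definition pos_cert (a c b d : Z) s : bool :=
  Z.ltb Z0 (Z.add (Z.mul b c) (Z.mul (Zneg xH) (Z.mul a d))) && pos_coefs (moebius [:: a; b] [:: c; d] s).

Lemma pos_certP a c b d s x : pos_cert a c b d s ->
  of_Z a <= of_Z c * x -> of_Z d * x < of_Z b -> 0 < evalZ s x.
Proof.
move=> /andP[/of_Z_gt0 det s_pos] ax xb.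
have {det} : 0 < of_Z b * of_Z c - of_Z a * of_Z d.
  by move: det; rewrite of_ZD !of_ZM (_ : of_Z (Zneg xH) = -1) // mulN1r.
set a' := of_Z a in ax *; set b' := of_Z b in xb *.
set c' := of_Z c in ax *; set d' := of_Z d in xb * => det.
have bd : 0 < b' - d' * x by rewrite subr_gt0.
pose t := (c' * x - a') / (b' - d' * x).
have t0 : 0 <= t by apply: divr_ge0; [rewrite subr_ge0 | exact: ltW].
have denE : evalZ [:: c; d] t = (b' * c' - a' * d') / (b' - d' * x).
  by rewrite /= mulr0 addr0 -/c' -/d' /t; field; apply: lt0r_neq0.
have den0 : 0 < evalZ [:: c; d] t by rewrite denE divr_gt0.
have xE : x * evalZ [:: c; d] t = evalZ [:: a; b] t.
  by rewrite denE /= mulr0 addr0 -/a' -/b' /t; field; apply: lt0r_neq0.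
have := moebiusE s xE; have := pos_coefsP t0 s_pos.
set M := evalZ _ t => M0 ME.
have : 0 < evalZ [:: c; d] t ^+ size s * evalZ s x by rewrite -ME mulr_gt0.
by rewrite pmulr_rgt0 // exprn_gt0.
Qed.

Lemma is_derive_evalZ s x : is_derive x 1 (evalZ s) (evalZ (derp s) x).
Proof.
elim: s => [|c s IH]; first exact: is_derive_cst.
have -> : evalZ (c :: s) = cst (of_Z c) + (id * evalZ s).
  by apply/funext.
have D := is_deriveD (is_derive_cst (of_Z c) x 1) (is_deriveM (is_derive_id x 1) IH).
refine (is_derive_eq D _).
rewrite evalD /= of_Z0 !add0r /GRing.scale /=; ring.
Qed.

(** The numerator, over [m ^+ 3], of the derivative of [a / m ^+ 2]. *)
Definition slope (a m : seq Z) : seq Z :=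
  subp (mulp (derp a) m) (scalep 2 (mulp a (derp m))).

Definition ratZ (a m : seq Z) (x : R) : R := evalZ a x / evalZ m x ^+ 2.

Lemma is_derive_ratZ a m x : evalZ m x != 0 ->
  is_derive x 1 (ratZ a m) (evalZ (slope a m) x / evalZ m x ^+ 3).
Proof.
move=> m0.
have -> : ratZ a m = evalZ a * (fun y => ((evalZ m * evalZ m) y)^-1).
  by apply/funext => y; rewrite /ratZ expr2.
have da := is_derive_evalZ a x; have dm := is_derive_evalZ m x.
have m2 : (evalZ m * evalZ m) x != 0 by apply: mulf_neq0.
refine (is_derive_eq (is_deriveM da (is_deriveV m2 (is_deriveM dm dm))) _).
rewrite /slope evalB evalC !evalM (_ : of_Z 2 = 2) // /GRing.scale /=.
have -> : (evalZ m * evalZ m) x = evalZ m x * evalZ m x by [].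
by field.
Qed.

Lemma continuous_ratZ a m x : evalZ m x != 0 -> {for x, continuous (ratZ a m)}.
Proof.
move=> m0; apply/differentiable_continuous/derivable1_diffP.
by case: (is_derive_ratZ a m0).
Qed.

Lemma within_continuous_ratZ a m (l u : R) :
  (forall x, l <= x <= u -> 0 < evalZ m x) ->
  {within `[l, u], continuous (ratZ a m)}.
Proof.
move=> m_pos; apply: continuous_in_subspaceT => x.
rewrite mem_setE /= in_itv /= => lxu.
by apply: continuous_ratZ; rewrite gt_eqF // m_pos.
Qed.

Lemma ratZ_increasing a m (l u : R) :
  (forall x, l <= x <= u -> 0 < evalZ m x) ->
  (forall x, l <= x < u -> 0 < evalZ (slope a m) x) ->
  forall x y, l <= x -> x < y -> y <= u -> ratZ a m x < ratZ a m y.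
Proof.
move=> m_pos slope_pos x y lx xy yu.
have lu : l < u by apply: le_lt_trans lx (lt_le_trans xy yu).
have der z : z \in `]l, u[ -> is_derive z 1 (ratZ a m)
    (evalZ (slope a m) z / evalZ m z ^+ 3).
  rewrite in_itv /= => /andP[lz zu]; apply: is_derive_ratZ.
  by rewrite gt_eqF // m_pos // !ltW.
apply: (@gtr0_derive1_lt_cc _ (ratZ a m) l u) => //.
- by move=> z /der[].
- move=> z zlu; rewrite derive1E; have [_ ->] := der z zlu.
  move: zlu; rewrite in_itv /= => /andP[lz zu]; apply: divr_gt0.
    by apply: slope_pos; rewrite zu ltW.
  by apply/exprn_gt0/m_pos; rewrite !ltW.
- exact: within_continuous_ratZ.
- by rewrite in_itv /= lx (le_trans (ltW xy)).
- by rewrite in_itv /= yu (le_trans lx (ltW xy)).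
Qed.

Lemma ratZN a m x : ratZ (scalep (Zneg xH) a) m x = - ratZ a m x.
Proof. by rewrite /ratZ evalC (_ : of_Z (Zneg xH) = -1) // mulN1r mulNr. Qed.

Lemma ratZ_decreasing a m (l u : R) :
  (forall x, l <= x <= u -> 0 < evalZ m x) ->
  (forall x, l <= x < u -> 0 < evalZ (slope (scalep (Zneg xH) a) m) x) ->
  forall x y, l <= x -> x < y -> y <= u -> ratZ a m y < ratZ a m x.
Proof.
move=> m_pos slope_pos x y lx xy yu.
by have := ratZ_increasing m_pos slope_pos lx xy yu; rewrite !ratZN ltrN2.
Qed.

Definition num_at (n d : Z) s : Z := head Z0 (moebius [:: n] [:: d] s).

Lemma num_atE n d s : Z.ltb Z0 d ->
  of_Z (num_at n d s) * of_Z d = of_Z d ^+ size s * evalZ s (of_Z n / of_Z d).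
Proof.
move=> /of_Z_gt0 d0.
have := @moebiusE [:: n] [:: d] s (of_Z n / of_Z d) 0.
rewrite /= !mul0r !addr0 => <-; last by rewrite divfK // gt_eqF.
by congr (_ * _); rewrite /num_at; case: moebius => //= c s'; rewrite mul0r addr0.
Qed.

(** With equal sizes the powers of the denominators [d] and [d'] cancel, and one
    integer inequality decides the sign of a sum of two values. *)
Definition sum_cert (n d n' d' : Z) (a b m : seq Z) : bool :=
  let mm := mulp m m in
  [&& size a == size mm, size b == size mm, Z.ltb Z0 d, Z.ltb Z0 d',
      Z.ltb Z0 (num_at n d mm), Z.ltb Z0 (num_at n' d' mm)
    & Z.ltb Z0 (Z.add (Z.mul (num_at n d a) (num_at n' d' mm))
                      (Z.mul (num_at n' d' b) (num_at n d mm)))].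

Lemma sum_certP n d n' d' a b m : sum_cert n d n' d' a b m ->
  0 < ratZ a m (of_Z n / of_Z d) + ratZ b m (of_Z n' / of_Z d').
Proof.
case/and5P => /eqP sa /eqP sb d0 d'0 /and3P[/of_Z_gt0 M0 /of_Z_gt0 M'0 /of_Z_gt0].
rewrite of_ZD !of_ZM.
have ratE k e c : size c = size (mulp m m) -> Z.ltb Z0 e ->
    0 < of_Z (num_at k e (mulp m m)) ->
    ratZ c m (of_Z k / of_Z e) = of_Z (num_at k e c) / of_Z (num_at k e (mulp m m)).
  move=> sc e0 K0; have cE := num_atE k c e0; have mE := num_atE k (mulp m m) e0.
  have {}e0 := of_Z_gt0 e0.
  rewrite /ratZ expr2 -evalM; apply/eqP; rewrite eqr_div; last 2 first.
  - have : 0 < of_Z e ^+ size (mulp m m) * evalZ (mulp m m) (of_Z k / of_Z e).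
      by rewrite -mE mulr_gt0.
    by rewrite pmulr_rgt0 ?exprn_gt0 // => /lt0r_neq0.
  - exact: lt0r_neq0.
  have p0 : of_Z e ^+ (size c) * of_Z e != 0 by rewrite mulf_neq0 ?expf_neq0 ?gt_eqF.
  apply/eqP/(mulfI p0).
  transitivity ((of_Z e ^+ size c * evalZ c (of_Z k / of_Z e))
                * (of_Z (num_at k e (mulp m m)) * of_Z e)); first by ring.
  rewrite -cE mE sc; by ring.
rewrite (ratE n d a) // (ratE n' d' b) // => sum0.
rewrite addf_div ?gt_eqF //; apply: divr_gt0; last exact: mulr_gt0.
exact: sum0.
Qed.

End IntegerPolynomials.


(** * The curve of a block *)

Delimit Scope Z_scope with BinZ.

Section BlockCurve.
Variable R : realType.
Implicit Types (p q A B lam w v x y : R).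

(** In the ratio w = p / A the equations r_p = lam and r_A = lam of one block are
    linear in A.  They give A = N / (2 E), with E = 20 w^2 - 36 w + 17 and
    N = 10 w^2 - 9, and then 2 lam = [Lam w] and 2 / p^2 + 5 / (4 A^2) = [Sig w],
    two quotients by the square of m = w N.  The null summand of [Lpoly] pads it
    to the size of this square. *)
Definition Epoly : seq Z := [:: 17; -36; 20]%BinZ.
Definition mpoly : seq Z := [:: 0; -9; 0; 10]%BinZ.
Definition m2poly : seq Z := mulp mpoly mpoly.
Definition Lpoly : seq Z :=
  addp (mulp [:: -4; 0; -15; 20]%BinZ Epoly) (scalep 0 m2poly).
Definition Spoly : seq Z := mulp (mulp Epoly Epoly) [:: 8; 0; 5]%BinZ.

Definition Lam w : R := ratZ Lpoly mpoly w.
Definition Sig w : R := ratZ Spoly mpoly w.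

Let E w := 20 * w ^+ 2 - 36 * w + 17.
Let N w := 10 * w ^+ 2 - 9.

Lemma evalZ_E w : evalZ Epoly w = E w.
Proof.
rewrite /E /= (_ : of_Z R 17 = 17) // (_ : of_Z R (-36) = -36) // (_ : of_Z R 20 = 20) //.
by ring.
Qed.

Lemma evalZ_m w : evalZ mpoly w = w * N w.
Proof.
rewrite /N /= (_ : of_Z R 0 = 0) // (_ : of_Z R (-9) = -9) // (_ : of_Z R 10 = 10) //.
by ring.
Qed.

Lemma evalZ_L w : evalZ Lpoly w = (20 * w ^+ 3 - 15 * w ^+ 2 - 4) * E w.
Proof.
rewrite /Lpoly evalD evalC evalM evalZ_E (_ : of_Z R 0 = 0) // mul0r addr0; congr (_ * _).
rewrite /= (_ : of_Z R 0 = 0) // (_ : of_Z R (-4) = -4) // (_ : of_Z R (-15) = -15) //.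
by rewrite (_ : of_Z R 20 = 20) //; ring.
Qed.

Lemma evalZ_S w : evalZ Spoly w = E w ^+ 2 * (8 + 5 * w ^+ 2).
Proof.
rewrite /Spoly !evalM evalZ_E expr2; congr (_ * _).
rewrite /= (_ : of_Z R 0 = 0) // (_ : of_Z R 8 = 8) // (_ : of_Z R 5 = 5) //.
by ring.
Qed.

Lemma LamE w : Lam w = (20 * w ^+ 3 - 15 * w ^+ 2 - 4) * E w / (w * N w) ^+ 2.
Proof. by rewrite /Lam /ratZ evalZ_L evalZ_m. Qed.

Lemma SigE w : Sig w = E w ^+ 2 * (8 + 5 * w ^+ 2) / (w * N w) ^+ 2.
Proof. by rewrite /Sig /ratZ evalZ_S evalZ_m. Qed.

Lemma E_gt0 w : 0 < E w. Proof. by have := sqr_ge0 (w - 9 / 10); rewrite /E; lra. Qed.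

Lemma cas9 : cas R 9 = 5 / 9.
Proof. by rewrite /cas; field. Qed.

Definition Aof w : R := N w / (2 * E w).

Lemma block_param p A lam : 0 < p -> 0 < A ->
  ric_q p A = lam * p -> ric_u 9 p A = lam * (A / 2) ->
  let w := p / A in
  [/\ 0 < w, 0 < N w, A = Aof w, p = w * Aof w & lam = Lam w / 2].
Proof.
move=> p0 A0; rewrite /ric_q /ric_u cas9 => e1 e2; set w := p / A.
rewrite /=; have w0 : 0 < w by apply: divr_gt0.
have pE : p = w * A by rewrite /w divfK // gt_eqF.
have w1 : w != 0 by rewrite gt_eqF.
have A1 : A != 0 by rewrite gt_eqF.
have Ew := E_gt0 w; have E1 : E w != 0 by rewrite gt_eqF.
clearbody w; rewrite {}pE {p} in p0 e1 e2 *.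
have lamE : lam = (2^-1 - (2 * A + 1) / (16 * (w * A))) / (w * A).
  by rewrite e1; field; rewrite w1 A1.
have AE : A * (2 * E w) = N w.
  rewrite {}lamE in e2; move: e2 => /(congr1 (fun z => z * (288 * w ^+ 2 * A))).
  set u := LHS; have {u}-> : u = 40 * w ^+ 2 * A - 10 * w ^+ 2 + 16 * A.
    by rewrite /u; field; rewrite w1 A1.
  set u := RHS; have {u}-> : u = 72 * w * A - 18 * A - 9.
    by rewrite /u; field; rewrite w1 A1.
  by rewrite /E /N => e2; lra.
have N0 : 0 < N w by rewrite -AE; nra.
have N1 : N w != 0 by rewrite gt_eqF.
have AE' : A = Aof w.
  by rewrite /Aof -AE mulfK // gt_eqF // mulr_gt0.
split=> //; first by rewrite -AE'.
rewrite lamE AE' LamE /Aof; move: E1 N1; rewrite /E /N => E1 N1.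
by field; rewrite w1 E1 N1.
Qed.

Lemma block_param_inv w : 0 < w -> 0 < N w ->
  [/\ 0 < Aof w, ric_q (w * Aof w) (Aof w) = Lam w / 2 * (w * Aof w)
    & ric_u 9 (w * Aof w) (Aof w) = Lam w / 2 * (Aof w / 2)].
Proof.
move=> w0 N0; have Ew := E_gt0 w.
split; first by rewrite /Aof divr_gt0 // mulr_gt0.
  rewrite LamE /ric_q /Aof; move: (lt0r_neq0 w0) (lt0r_neq0 N0) (lt0r_neq0 Ew).
  by rewrite /E /N => w1 N1 E1; field; rewrite w1 E1 N1.
rewrite LamE /ric_u cas9 /Aof; move: (lt0r_neq0 w0) (lt0r_neq0 N0) (lt0r_neq0 Ew).
by rewrite /E /N => w1 N1 E1; field; rewrite w1 E1 N1.
Qed.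

Lemma ric_3_param w v lam : 0 < w -> 0 < N w -> 0 < v -> 0 < N v ->
  ric_3 9 (w * Aof w) (v * Aof v) (Aof w) (Aof v) = lam <->
  Sig w + Sig v + 5 = 36 * lam.
Proof.
move=> w0 Nw v0 Nv.
have -> : ric_3 9 (w * Aof w) (v * Aof v) (Aof w) (Aof v)
          = (Sig w + Sig v + 5) / 36; last by split=> e; lra.
rewrite /ric_3 cas9 !SigE /Aof.
move: (lt0r_neq0 w0) (lt0r_neq0 Nw) (lt0r_neq0 (E_gt0 w)).
move: (lt0r_neq0 v0) (lt0r_neq0 Nv) (lt0r_neq0 (E_gt0 v)).
have part x : x != 0 -> N x != 0 -> E x != 0 ->
    2 * (((x * (N x / (2 * E x))) ^+ 2)^-1)
    + 5 / 4 * (((N x / (2 * E x)) ^+ 2)^-1)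
    = E x ^+ 2 * (8 + 5 * x ^+ 2) / (x * N x) ^+ 2.
  by move: (E x) (N x) => e n x1 N1 E1; field; rewrite x1 N1 E1.
move=> v1 Nv1 Ev1 w1 Nw1 Ew1.
rewrite -(part w) // -(part v) //; lra.
Qed.

End BlockCurve.


(** * Uniqueness of the asymmetric solution *)

Section Uniqueness.
Variable R : realType.
Implicit Types (w v x y : R).

Lemma of_Z_nat (k : nat) : of_Z R (Z.of_nat k) = k%:R.
Proof. by rewrite /of_Z (Z_of_intK (Posz k)). Qed.

Lemma pos_on (a c b d : nat) s x :
  pos_cert (Z.of_nat a) (Z.of_nat c) (Z.of_nat b) (Z.of_nat d) s ->
  a%:R <= c%:R * x -> d%:R * x < b%:R -> 0 < evalZ s x.
Proof. by move=> cert; rewrite -!of_Z_nat; apply: pos_certP. Qed.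

Lemma evalZ_m2 x : evalZ m2poly x = evalZ mpoly x ^+ 2.
Proof. by rewrite evalM expr2. Qed.

Lemma m_gt0 x : 19 / 20 <= x -> 0 < evalZ mpoly x.
Proof. by move=> xl; apply: (@pos_on 19 20 1 0) => //; lra. Qed.

Lemma N_gt0 x : 19 / 20 <= x -> 0 < 10 * x ^+ 2 - 9.
Proof. nra. Qed.

Lemma ratZ_lin a b s t x : 0 < evalZ mpoly x ->
  ratZ (addp (scalep a s) (scalep b t)) mpoly x
  = of_Z R a * ratZ s mpoly x + of_Z R b * ratZ t mpoly x.
Proof. by move=> m0; rewrite /ratZ evalD !evalC; field; rewrite gt_eqF. Qed.

Lemma ratZ_m2 x : 0 < evalZ mpoly x -> ratZ m2poly mpoly x = 1.
Proof. by move=> m0; rewrite /ratZ evalZ_m2 divff // expf_neq0 // gt_eqF. Qed.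

Lemma Lam_sign a b x : 0 < evalZ mpoly x ->
  0 < evalZ (addp (scalep a Lpoly) (scalep b m2poly)) x ->
  0 < of_Z R a * Lam x + of_Z R b.
Proof.
move=> m0 pos0; have := ratZ_lin a b Lpoly m2poly m0.
by rewrite ratZ_m2 // mulr1 /Lam => <-; rewrite /ratZ divr_gt0 // exprn_gt0.
Qed.

Lemma Lam_decreasing x y : 11 / 10 <= x -> x < y -> y <= 49 / 40 -> Lam y < Lam x.
Proof.
apply: ratZ_decreasing => z /andP[lz zu]; first by apply: m_gt0; lra.
by apply: (@pos_on 11 10 49 40); [vm_compute | lra | lra].
Qed.

Lemma Lam_increasing x y : 63 / 50 <= x -> x < y -> y <= 67 / 50 -> Lam x < Lam y.
Proof.
apply: ratZ_increasing => z /andP[lz zu]; first by apply: m_gt0; lra.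
by apply: (@pos_on 63 50 67 50); [vm_compute | lra | lra].
Qed.

(** When [Lam w = Lam v], the last equation may be split between [w] and [v] with
    any division of its [Lam] term.  This division, with coefficients 9 and 81,
    makes the share of [w] decrease and the share of [v] increase. *)
Definition Ppoly : seq Z := addp (scalep 5 Spoly) (scalep (-9) Lpoly).
Definition Qpoly : seq Z := addp (scalep 5 Spoly) (scalep (-81) Lpoly).

Lemma P_decreasing x y : 11 / 10 <= x -> x < y -> y <= 49 / 40 ->
  ratZ Ppoly mpoly y < ratZ Ppoly mpoly x.
Proof.
apply: ratZ_decreasing => z /andP[lz zu]; first by apply: m_gt0; lra.
by apply: (@pos_on 11 10 49 40); [vm_compute | lra | lra].
Qed.

Lemma Q_increasing x y : 127 / 100 <= x -> x < y -> y <= 67 / 50 ->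
  ratZ Qpoly mpoly x < ratZ Qpoly mpoly y.
Proof.
apply: ratZ_increasing => z /andP[lz zu]; first by apply: m_gt0; lra.
by apply: (@pos_on 127 100 67 50); [vm_compute | lra | lra].
Qed.

Lemma PQ_sum w v : 19 / 20 <= w -> 19 / 20 <= v -> Lam w = Lam v ->
  Sig w + Sig v + 5 = 18 * Lam w <-> ratZ Ppoly mpoly w + ratZ Qpoly mpoly v = - 25.
Proof.
move=> w0 v0 LL; rewrite !ratZ_lin ?m_gt0 // -/(Lam w) -/(Lam v) -/(Sig w) -/(Sig v).
rewrite (_ : of_Z R 5 = 5) // (_ : of_Z R (-9) = -9) // (_ : of_Z R (-81) = -81) // LL.
by split=> e; lra.
Qed.

(** The share of one block in the last equation, with the [Lam] term divided
    equally: the equations give [Fof w + Fof v = 0]. *)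
Definition Fpoly : seq Z :=
  addp (addp (scalep 2 Spoly) (scalep (-18) Lpoly)) (scalep 5 m2poly).
Definition Fof x : R := 2 * Sig x - 18 * Lam x + 5.

Lemma FofE x : 0 < evalZ mpoly x -> Fof x = ratZ Fpoly mpoly x.
Proof.
move=> m0; have m1 := lt0r_neq0 m0.
rewrite /ratZ (evalD (addp (scalep 2 Spoly) _) (scalep 5 m2poly)).
rewrite (evalD (scalep 2 Spoly)) (evalC 2) (evalC (-18)) (evalC 5) evalZ_m2.
rewrite (_ : of_Z R 5 = 5) // (_ : of_Z R 2 = 2) // (_ : of_Z R (-18) = -18) //.
rewrite /Fof /Sig /Lam /ratZ; move: (evalZ mpoly x) m1 => m m1.
by field.
Qed.

Definition quadF x : R := 30 * x ^+ 2 - 72 * x + 43.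

(** The quadratic factor vanishes exactly at the symmetric Einstein metrics, so
    [Fof] is negative only between its two roots. *)
Lemma Fof_factor x : 19 / 20 <= x -> exists2 c, 0 < c & Fof x = c * quadF x.
Proof.
move=> xl; have m0 := m_gt0 xl.
pose quart : seq Z := [:: 136; -288; 375; -360; 150]%BinZ.
exists (evalZ quart x / evalZ mpoly x ^+ 2).
  apply: divr_gt0; last exact: exprn_gt0.
  have [x2|x2] := ltP x 2.
    by apply: (@pos_on 9 10 2 1) => //; lra.
  by apply: (@pos_on 2 1 1 0) => //; lra.
have quadE : evalZ [:: 43; -72; 30]%BinZ x = quadF x.
  rewrite /= (_ : of_Z R 43 = 43) // (_ : of_Z R (-72) = -72) // (_ : of_Z R 30 = 30) //.
  by rewrite /quadF; ring.
by rewrite FofE // /ratZ mulrAC -quadE -evalM; congr (evalZ _ x / _); vm_compute.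
Qed.

Lemma dom_ge x : 0 < x -> 0 < 10 * x ^+ 2 - 9 -> 237 / 250 <= x.
Proof. nra. Qed.

Lemma Fof_sign a b x : 0 < evalZ mpoly x ->
  0 < evalZ (addp (scalep a Fpoly) (scalep b m2poly)) x ->
  0 < of_Z R a * Fof x + of_Z R b.
Proof.
move=> m0 pos0; have := ratZ_lin a b Fpoly m2poly m0.
rewrite ratZ_m2 // mulr1 -FofE // => <-.
by rewrite /ratZ divr_gt0 // exprn_gt0.
Qed.

Lemma Fof_lower x : 559 / 500 <= x -> x < 13 / 10 -> - (1 / 10) < Fof x.
Proof.
move=> xl xu; have m0 : 0 < evalZ mpoly x by apply: m_gt0; lra.
suff : 0 < of_Z R 10 * Fof x + of_Z R 1.
  by rewrite (_ : of_Z R 10 = 10) // (_ : of_Z R 1 = 1) // => ?; lra.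
apply: Fof_sign => //; have [x1|x1] := ltP x (23 / 20).
  by apply: (@pos_on 559 500 23 20); [vm_compute | lra | lra].
have [x2|x2] := ltP x (59 / 50).
  by apply: (@pos_on 23 20 59 50); [vm_compute | lra | lra].
have [x3|x3] := ltP x (6 / 5).
  by apply: (@pos_on 59 50 6 5); [vm_compute | lra | lra].
by apply: (@pos_on 6 5 13 10); [vm_compute | lra | lra].
Qed.

(** [Fof] being bounded below by [-1/10] where it is negative, the other block
    stays close to the roots of [quadF]. *)
Lemma Fof_upper x : 237 / 250 <= x -> 0 < evalZ mpoly x -> Fof x < 1 / 10 ->
  11 / 10 <= x <= 167 / 125.
Proof.
move=> xl m0 Fx; rewrite !leNgt; apply/andP; split; apply/negP => xb.
  suff : 0 < of_Z R 10 * Fof x + of_Z R (-1).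
    by rewrite (_ : of_Z R 10 = 10) // (_ : of_Z R (-1) = -1) // => ?; lra.
  apply: Fof_sign => //.
  by apply: (@pos_on 237 250 11 10); [vm_compute | lra | lra].
suff : 0 < of_Z R 10 * Fof x + of_Z R (-1).
  by rewrite (_ : of_Z R 10 = 10) // (_ : of_Z R (-1) = -1) // => ?; lra.
apply: Fof_sign => //.
by apply: (@pos_on 167 125 1 0); [vm_compute | lra | lra].
Qed.

Lemma Lam_big x : 11 / 10 <= x -> x < 28 / 25 -> 58 / 100 < Lam x.
Proof.
move=> xl xu; have m0 : 0 < evalZ mpoly x by apply: m_gt0; lra.
suff : 0 < of_Z R 100 * Lam x + of_Z R (-58).
  by rewrite (_ : of_Z R 100 = 100) // (_ : of_Z R (-58) = -58) // => ?; lra.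
apply: Lam_sign => //.
by apply: (@pos_on 11 10 28 25); [vm_compute | lra | lra].
Qed.

Lemma Lam_small x : 49 / 40 <= x -> x < 641 / 500 + 1 / 1000 -> Lam x < 56 / 100.
Proof.
move=> xl xu; have m0 : 0 < evalZ mpoly x by apply: m_gt0; lra.
suff : 0 < of_Z R (-100) * Lam x + of_Z R 56.
  by rewrite (_ : of_Z R (-100) = -100) // (_ : of_Z R 56 = 56) // => ?; lra.
apply: Lam_sign => //.
by apply: (@pos_on 49 40 1283 1000); [vm_compute | lra | lra].
Qed.

(** [Lam] has its minimum at about [5/4]; the value [101/183] separates the
    bottom of this well from the second root of [quadF] on. *)
Lemma Lam_well x : 49 / 40 <= x -> x < 127 / 100 -> Lam x < 101 / 183.
Proof.
move=> xl xu; have m0 : 0 < evalZ mpoly x by apply: m_gt0; lra.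
suff : 0 < of_Z R (-183) * Lam x + of_Z R 101.
  by rewrite (_ : of_Z R (-183) = -183) // (_ : of_Z R 101 = 101) // => ?; lra.
apply: Lam_sign => //.
by apply: (@pos_on 49 40 127 100); [vm_compute | lra | lra].
Qed.

Lemma Lam_right x : 801 / 625 <= x -> x < 67 / 50 -> 101 / 183 < Lam x.
Proof.
move=> xl xu; have m0 : 0 < evalZ mpoly x by apply: m_gt0; lra.
suff : 0 < of_Z R 183 * Lam x + of_Z R (-101).
  by rewrite (_ : of_Z R (-101) = -101) // (_ : of_Z R 183 = 183) // => ?; lra.
apply: Lam_sign => //.
by apply: (@pos_on 801 625 67 50); [vm_compute | lra | lra].
Qed.

Lemma quadF_le0 x : quadF x <= 0 -> 559 / 500 <= x <= 641 / 500.
Proof. by rewrite /quadF => Fx; apply/andP; split; nra. Qed.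

Lemma quadF_ge0 x : 0 <= quadF x -> x <= 699 / 625 \/ 801 / 625 <= x.
Proof.
rewrite /quadF => Fx; have [x1|x1] := leP x (6 / 5); first by left; nra.
by right; nra.
Qed.

Lemma quadF_order_left x y : quadF x <= 0 -> 0 <= quadF y -> y <= 6 / 5 -> y <= x.
Proof.
move=> qx qy y1; rewrite leNgt; apply/negP => xy.
have : 0 <= (y - x) * (30 * (y + x) - 72) by move: qx qy; rewrite /quadF; nra.
by rewrite pmulr_rge0; lra.
Qed.

Lemma quadF_order_right x y : quadF x <= 0 -> 0 <= quadF y -> 6 / 5 <= y -> x <= y.
Proof.
move=> qx qy y1; rewrite leNgt; apply/negP => yx.
have : (x - y) * (30 * (y + x) - 72) <= 0 by move: qx qy; rewrite /quadF; nra.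
by rewrite pmulr_rle0; lra.
Qed.

Lemma quadF_gt0_left x : 0 <= x -> x < 11 / 10 -> 0 <= quadF x.
Proof.
move=> x0 xu; have : 0 <= (11 / 10 - x) * (72 - 30 * (x + 11 / 10)).
  by apply: mulr_ge0; lra.
by rewrite /quadF => ?; lra.
Qed.

Lemma Fof_quadF x : 0 < x -> 0 < evalZ mpoly x -> 237 / 250 <= x ->
  (Fof x <= 0 -> quadF x <= 0) /\ (0 <= Fof x -> 0 <= quadF x).
Proof.
move=> x0 mx xl; have [x95|x95] := leP (19 / 20) x.
  by have [c c0 ->] := Fof_factor x95; rewrite pmulr_rle0 // pmulr_rge0.
split=> Fx; last by apply: quadF_gt0_left; clear mx; lra.
have /andP[x1 _] : 11 / 10 <= x <= 167 / 125.
  by apply: Fof_upper => //; apply: le_lt_trans Fx _; clear; lra.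
by clear mx Fx; lra.
Qed.

(** [Lam] decreases to a minimum near [5/4] and then increases, and [w] lies
    between the roots of [quadF] while [v] does not.  If [w] and [v] were on the
    same branch they would be equal; a [v] on the left has [Lam v] above the
    values of [Lam] on the whole right part. *)
Lemma locate_core w v : quadF w <= 0 -> 0 <= quadF v -> w != v -> Lam w = Lam v ->
  11 / 10 <= v -> v <= 167 / 125 ->
  559 / 500 <= w <= 49 / 40 /\ 32 / 25 <= v <= 167 / 125.
Proof.
move=> qw qv wv LL v1 v2.
have /andP[w1 w2] := quadF_le0 qw.
have [v3|v3] := quadF_ge0 qv.
  have vw : v < w.
    by rewrite lt_neqAle eq_sym wv (quadF_order_left qw qv) //; clear -v3; lra.
  have [w3|w3] := leP w (49 / 40).
    by have := Lam_decreasing v1 vw w3; rewrite LL ltxx.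
  have v4 : v < 28 / 25 by clear -v3; lra.
  have w4 : w < 641 / 500 + 1 / 1000 by clear -w2; lra.
  have Lw := Lam_big v1 v4; have := Lam_small (ltW w3) w4.
  by rewrite LL; move: (Lam v) Lw => l; clear; lra.
have [w3|w3] := leP w (49 / 40).
  by rewrite w1 v2 /= andbT; split => //; clear -v3; lra.
have v4 : v < 67 / 50 by clear -v2; lra.
have [w4|w4] := ltP w (127 / 100).
  have := Lam_well (ltW w3) w4; have := Lam_right v3 v4.
  by rewrite LL; move: (Lam v) => l; clear; lra.
have wltv : w < v.
  by rewrite lt_neqAle wv (quadF_order_right qw qv) //; clear -v3; lra.
have w5 : 63 / 50 <= w by clear -w4; lra.
by have := Lam_increasing w5 wltv (ltW v4); rewrite LL ltxx.
Qed.

Lemma locate w v : 0 < w -> 0 < 10 * w ^+ 2 - 9 -> 0 < v -> 0 < 10 * v ^+ 2 - 9 ->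
  Lam w = Lam v -> Sig w + Sig v + 5 = 18 * Lam w -> w != v -> Fof w <= Fof v ->
  559 / 500 <= w <= 49 / 40 /\ 32 / 25 <= v <= 167 / 125.
Proof.
move=> w0 Nw v0 Nv LL SS wv Fwv.
have F0 : Fof w + Fof v = 0.
  by move: SS; rewrite /Fof -LL; move: (Lam w) (Sig w) (Sig v) => l s t; clear; lra.
have := dom_ge w0 Nw; have := dom_ge v0 Nv => vl wl.
have mw : 0 < evalZ mpoly w by rewrite evalZ_m mulr_gt0.
have mv : 0 < evalZ mpoly v by rewrite evalZ_m mulr_gt0.
have [Fw Fv] : Fof w <= 0 /\ 0 <= Fof v.
  by move: (Fof w) (Fof v) F0 Fwv => f g; clear; lra.
have qw := (Fof_quadF w0 mw wl).1 Fw; have qv := (Fof_quadF v0 mv vl).2 Fv.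
have /andP[w1 w2] := quadF_le0 qw.
have Fwl : - (1 / 10) < Fof w by apply: Fof_lower => //; clear -w2; lra.
have /andP[v1 v2] : 11 / 10 <= v <= 167 / 125.
  apply: Fof_upper => //.
  by move: (Fof w) (Fof v) F0 Fwl => f g; clear; lra.
exact: locate_core.
Qed.

(** If [w] increases, [Lam w] decreases, hence so do [v] and the share of [v],
    while the share of [w] decreases as well: their sum cannot stay at [-25]. *)
Lemma located_unique w v w' v' :
  559 / 500 <= w <= 49 / 40 -> 32 / 25 <= v <= 167 / 125 ->
  559 / 500 <= w' <= 49 / 40 -> 32 / 25 <= v' <= 167 / 125 ->
  Lam w = Lam v -> Sig w + Sig v + 5 = 18 * Lam w ->
  Lam w' = Lam v' -> Sig w' + Sig v' + 5 = 18 * Lam w' -> w = w' /\ v = v'.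
Proof.
wlog ww : w v w' v' / w <= w'.
  move=> H w1 v1 w2 v2 L1 S1 L2 S2; have [/H|/ltW/H] := leP w w'; first exact.
  by move=> /(_ _ _ w2 v2 w1 v1 L2 S2 L1 S1)[-> ->].
have wb x : 559 / 500 <= x <= 49 / 40 -> [/\ 19 / 20 <= x, 11 / 10 <= x & x <= 49 / 40].
  by case/andP=> xl xu; split=> //; clear -xl; lra.
have vb x : 32 / 25 <= x <= 167 / 125 ->
    [/\ 19 / 20 <= x, 63 / 50 <= x, 127 / 100 <= x & x <= 67 / 50].
  by case/andP=> xl xu; split=> //; clear -xl xu; lra.
move=> /wb[w1 w2 w3] /vb[v1 v2 v3 v4] /wb[w'1 w'2 w'3] /vb[v'1 v'2 v'3 v'4] L1 S1 L2 S2.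
have PQ := (PQ_sum w1 v1 L1).1 S1; have PQ' := (PQ_sum w'1 v'1 L2).1 S2.
have [ww'|ww'|eqw] := ltgtP w w'; last 2 first.
- by move: ww; rewrite leNgt ww'.
- split=> //; move: L2; rewrite -eqw L1.
  have [vv|vv|//] := ltgtP v v'.
    by have := Lam_increasing v2 vv v'4 => + E; rewrite E ltxx.
  by have := Lam_increasing v'2 vv v4 => + E; rewrite E ltxx.
have LL := Lam_decreasing w2 ww' w'3; have PP := P_decreasing w2 ww' w'3.
have [vv|vv|eqv] := ltgtP v v'.
- have := Lam_increasing v2 vv v'4; rewrite -L1 -L2.
  by move/(lt_trans LL); rewrite ltxx.
- have := Q_increasing v'3 vv v4.
  move: (ratZ Ppoly mpoly w) (ratZ Qpoly mpoly v) (ratZ Ppoly mpoly w')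
        (ratZ Qpoly mpoly v') PQ PQ' PP => a b c d; clear; lra.
- by move: LL; rewrite L1 L2 eqv ltxx.
Qed.

End Uniqueness.


(** * Existence of the asymmetric solution *)

Section Existence.
Variable R : realType.
Implicit Types (w v x y t : R).
Local Open Scope classical_set_scope.
Local Open Scope ring_scope.

Lemma increasing_ivt (f : R -> R) (a b : R) : a <= b ->
  {within `[a, b], continuous f} -> f a <= f b ->
  forall t, f a <= t <= f b -> exists2 x, a <= x <= b & f x = t.
Proof.
move=> ab cf fab t tab.
have [|x xab fx] := @IVT R f a b t ab cf.
  by rewrite (min_idPl fab) (max_idPr fab).
by exists x => //; move: xab; rewrite in_itv.
Qed.

(** The value of [f] serves as a coordinate on the arc.  Continuity of [g] in this
    coordinate is automatic, for a monotone function with an interval as image. *)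
Lemma increasing_param (f g : R -> R) (a b : R) : a < b ->
  {within `[a, b], continuous f} -> {within `[a, b], continuous g} ->
  (forall x y, a <= x -> x < y -> y <= b -> f x < f y) ->
  (forall x y, a <= x -> x < y -> y <= b -> g x < g y) ->
  exists2 phi : R -> R, {within `[f a, f b], continuous phi}
    & forall x, a <= x <= b -> phi (f x) = g x.
Proof.
move=> ab cf cg f_inc g_inc.
have le_inc (h : R -> R) : (forall x y, a <= x -> x < y -> y <= b -> h x < h y) ->
    forall x y, a <= x <= b -> a <= y <= b -> (h x <= h y) = (x <= y).
  move=> h_inc x y /andP[ax xb] /andP[ay yb].
  have [xy|yx|->] := ltgtP x y; last exact: lexx.
    by rewrite ltW // h_inc.
  by apply/negbTE; rewrite -ltNge h_inc.
have f_le := le_inc f f_inc; have g_le := le_inc g g_inc.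
have aab : a <= a <= b by rewrite lexx ltW.
have bab : a <= b <= b by rewrite lexx ltW.
have fab : f a <= f b by rewrite f_le // ltW.
have gab : g a <= g b by rewrite g_le // ltW.
pose inv t := xget a [set x | a <= x <= b /\ f x = t].
have invK x : a <= x <= b -> inv (f x) = x.
  move=> xab; rewrite /inv; case: xgetP => [y _ [yab fy]|/(_ x)[]//].
  by apply/eqP; rewrite eq_le -(f_le y x) // -(f_le x y) // fy lexx.
exists (g \o inv); last by move=> x xab /=; rewrite invK.
apply: segment_inc_surj_continuous.
  move=> s t; rewrite !in_itv /= => /(increasing_ivt (ltW ab) cf fab)[x xab <-].
  move=> /(increasing_ivt (ltW ab) cf fab)[y yab <-].
  by rewrite !invK // f_le // g_le.
move=> y /=; rewrite !invK // in_itv /= => /(increasing_ivt (ltW ab) cg gab)[x xab <-].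
exists (f x); last by rewrite /= invK.
by move: (xab) => /andP[ax xb]; rewrite /= in_itv /= !f_le // ax.
Qed.

(** The intermediate value theorem in the common coordinate [f = f'].  The point
    [v0] serves to bound [g'] at the points of the second arc that match the ends
    of the first. *)
Lemma matched_pair (f g f' g' : R -> R) (a b a' v0 b' c : R) :
  a < b -> a' < v0 -> v0 < b' ->
  {within `[a, b], continuous f} -> {within `[a, b], continuous g} ->
  (forall x y, a <= x -> x < y -> y <= b -> f x < f y) ->
  (forall x y, a <= x -> x < y -> y <= b -> g x < g y) ->
  {within `[a', b'], continuous f'} -> {within `[a', b'], continuous g'} ->
  (forall x y, a' <= x -> x < y -> y <= b' -> f' x < f' y) ->
  (forall x y, a' <= x -> x < y -> y <= b' -> g' x < g' y) ->
  f' a' < f a -> f a < f' v0 -> f' v0 < f b -> f b < f' b' ->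
  g a + g' v0 < c -> c < g b + g' v0 ->
  exists x y, [/\ a <= x <= b, a' <= y <= b', f x = f' y & g x + g' y = c].
Proof.
move=> ab a'v vb' cf cg f_inc g_inc cf' cg' f'_inc g'_inc l1 l2 l3 l4 s1 s2.
have a'b' := lt_trans a'v vb'.
have [phi cphi phiE] := increasing_param ab cf cg f_inc g_inc.
have [psi cpsi psiE] := increasing_param a'b' cf' cg' f'_inc g'_inc.
have fab : f a <= f b by rewrite ltW // f_inc.
have fab' : f' a' <= f' b' by rewrite ltW // f'_inc.
have sub t : f a <= t <= f b -> f' a' <= t <= f' b'.
  by case/andP=> at_ tb; rewrite (le_trans (ltW l1)) // (le_trans tb) // ltW.
have ivt' := increasing_ivt (ltW a'b') cf' fab'.
have aab : a <= a <= b by rewrite lexx ltW.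
have bab : a <= b <= b by rewrite lexx ltW.
have csum : {within `[f a, f b], continuous (phi \+ psi)}.
  move=> t; apply: continuousD; first exact: cphi.
  apply: (continuous_subspaceW _ cpsi) => s /=; rewrite !in_itv /=; exact: sub.
have psi_a : psi (f a) < g' v0.
  have [|y /andP[ay yb] fy] := ivt' (f a); first by apply: sub; rewrite lexx.
  rewrite -fy psiE ?ay //; apply: g'_inc => //; last exact: ltW.
  rewrite ltNge le_eqVlt; apply/negP => /orP[/eqP vy|vy].
    by move: l2; rewrite -fy vy ltxx.
  by move: l2; rewrite -fy ltNge ltW // f'_inc // ltW.
have psi_b : g' v0 < psi (f b).
  have [|y /andP[ay yb] fy] := ivt' (f b); first by apply: sub; rewrite lexx andbT.
  rewrite -fy psiE ?ay //; apply: g'_inc => //; first exact: ltW.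
  rewrite ltNge le_eqVlt; apply/negP => /orP[/eqP vy|vy].
    by move: l3; rewrite -fy vy ltxx.
  by move: l3; rewrite -fy ltNge ltW // f'_inc // ltW.
have [||t tab ht] := @increasing_ivt (phi \+ psi) (f a) (f b) fab csum _ c.
- rewrite /= !phiE // ltW // (lt_trans (_ : _ < c)) //.
    by apply: lt_trans s1; rewrite ltrD2l.
  by apply: lt_trans s2 _; rewrite ltrD2l.
- rewrite /= !phiE //; apply/andP; split; apply: ltW.
    by apply: lt_trans s1; rewrite ltrD2l.
  by apply: lt_trans s2 _; rewrite ltrD2l.
have [x xab fx] := increasing_ivt (ltW ab) cf fab tab.
have [y yab fy] := ivt' t (sub t tab).
exists x, y; split=> //; first by rewrite fx.
by move: ht; rewrite /= -{1}fx -fy phiE // psiE.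
Qed.

Lemma within_continuous_ratZN a m (l u : R) :
  (forall x, l <= x <= u -> 0 < evalZ m x) ->
  {within `[- u, - l], continuous (fun x => ratZ a m (- x))}.
Proof.
move=> m_pos; apply: continuous_in_subspaceT => x.
rewrite mem_setE /= in_itv /= => /andP[ux xl].
have m0 : evalZ m (- x) != 0.
  by rewrite gt_eqF // m_pos // lerNr xl lerNl.
apply: (@continuous_comp _ _ _ -%R (ratZ a m)); first exact: oppr_continuous.
exact: continuous_ratZ.
Qed.

(** On its arc the block [w] is traversed backwards, as [Lam] and the share of [w]
    decrease there. *)
Lemma exists_pair (w1 w2 v1 v0 v2 : R) :
  11 / 10 <= w1 -> w1 < w2 -> w2 <= 49 / 40 ->
  127 / 100 <= v1 -> v1 < v0 -> v0 < v2 -> v2 <= 67 / 50 ->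
  Lam v1 < Lam w2 -> Lam w2 < Lam v0 -> Lam v0 < Lam w1 -> Lam w1 < Lam v2 ->
  ratZ Ppoly mpoly w2 + ratZ Qpoly mpoly v0 < - 25 ->
  - 25 < ratZ Ppoly mpoly w1 + ratZ Qpoly mpoly v0 ->
  exists w v, [/\ w1 <= w <= w2, v1 <= v <= v2, Lam w = Lam v
    & ratZ Ppoly mpoly w + ratZ Qpoly mpoly v = - 25].
Proof.
move=> w1l w12 w2u v1l v10 v02 v2u l1 l2 l3 l4 s1 s2.
have mw x : w1 <= x <= w2 -> 0 < evalZ mpoly x.
  by case/andP=> x1 _; apply: m_gt0; clear -w1l x1; lra.
have mv x : v1 <= x <= v2 -> 0 < evalZ mpoly x.
  by case/andP=> x1 _; apply: m_gt0; clear -v1l x1; lra.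
have w_mono (h : R -> R) :
    (forall x y, 11 / 10 <= x -> x < y -> y <= 49 / 40 -> h y < h x) ->
    forall x y, - w2 <= x -> x < y -> y <= - w1 -> h (- x) < h (- y).
  move=> h_dec x y x1 xy y1; apply: h_dec; last 1 first.
  - by apply: le_trans w2u; rewrite lerNl.
  - by apply: le_trans w1l _; rewrite lerNr.
  - by rewrite ltrN2.
have v_mono (h : R -> R) :
    (forall x y, 127 / 100 <= x -> x < y -> y <= 67 / 50 -> h x < h y) ->
    forall x y, v1 <= x -> x < y -> y <= v2 -> h x < h y.
  by move=> h_inc x y x1 xy y1; apply: h_inc => //;
    [apply: le_trans x1 | apply: le_trans v2u].
have Lam_inc x y : 127 / 100 <= x -> x < y -> y <= 67 / 50 -> Lam x < Lam y :> R.
  by move=> x1; apply: Lam_increasing; clear -x1; lra.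
have N12 : - w2 < - w1 by rewrite ltrN2.
have cL : {within `[- w2, - w1], continuous (fun x => Lam (- x))}.
  by apply: within_continuous_ratZN.
have cP : {within `[- w2, - w1], continuous (fun x => ratZ Ppoly mpoly (- x))}.
  by apply: within_continuous_ratZN.
have cL' : {within `[v1, v2], continuous (@Lam R)} by apply: within_continuous_ratZ.
have cQ : {within `[v1, v2], continuous (ratZ Qpoly mpoly : R -> R)}.
  by apply: within_continuous_ratZ.
have [||||||x [v [xw vv LL PQ]]] := @matched_pair (fun x => Lam (- x))
  (fun x => ratZ Ppoly mpoly (- x)) (@Lam R) (ratZ Qpoly mpoly) (- w2) (- w1) v1 v0 v2
  (- 25) N12 v10 v02 cL cP (w_mono _ (@Lam_decreasing R)) (w_mono _ (@P_decreasing R))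
  cL' cQ (v_mono _ Lam_inc) (v_mono _ (@Q_increasing R)); rewrite ?opprK //.
exists (- x), v; split=> //.
by move: xw => /andP[x1 x2]; rewrite lerNr x2 lerNl.
Qed.

Lemma Lam_lt (n d n' d' : Z) :
  sum_cert n d n' d' (scalep (-1) Lpoly) Lpoly mpoly ->
  Lam (of_Z R n / of_Z R d) < Lam (of_Z R n' / of_Z R d').
Proof. by move/(@sum_certP R); rewrite ratZN addrC subr_gt0. Qed.

Lemma of_Z_le (a b : Z) : Z.leb 0 (Z.add b (Z.mul (-1) a)) -> of_Z R a <= of_Z R b.
Proof.
by move/(of_Z_ge0 R); rewrite of_ZD of_ZM (_ : of_Z R (-1) = -1) // mulN1r subr_ge0.
Qed.

Lemma of_Z_lt (a b : Z) : Z.ltb 0 (Z.add b (Z.mul (-1) a)) -> of_Z R a < of_Z R b.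
Proof.
by move/(of_Z_gt0 R); rewrite of_ZD of_ZM (_ : of_Z R (-1) = -1) // mulN1r subr_gt0.
Qed.

Lemma frac_le (a b n d : Z) : Z.ltb 0 b -> Z.ltb 0 d ->
  Z.leb 0 (Z.add (Z.mul b n) (Z.mul (-1) (Z.mul a d))) ->
  of_Z R a / of_Z R b <= of_Z R n / of_Z R d.
Proof.
move=> /(of_Z_gt0 R) b0 /(of_Z_gt0 R) d0 /of_Z_le; rewrite !of_ZM => le_ad.
by rewrite ler_pdivrMr // mulrAC ler_pdivlMr // (mulrC (of_Z R n)).
Qed.

Lemma nat_frac_le (a b : nat) (n d : Z) : Z.ltb 0 (Z.of_nat b) -> Z.ltb 0 d ->
  Z.leb 0 (Z.add (Z.mul (Z.of_nat b) n) (Z.mul (-1) (Z.mul (Z.of_nat a) d))) ->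
  a%:R / b%:R <= of_Z R n / of_Z R d.
Proof. by rewrite -!of_Z_nat; apply: frac_le. Qed.

Lemma frac_nat_le (a b : nat) (n d : Z) : Z.ltb 0 (Z.of_nat b) -> Z.ltb 0 d ->
  Z.leb 0 (Z.add (Z.mul d (Z.of_nat a)) (Z.mul (-1) (Z.mul n (Z.of_nat b)))) ->
  of_Z R n / of_Z R d <= a%:R / b%:R.
Proof. by rewrite -!of_Z_nat => b0 d0; apply: frac_le. Qed.

Lemma frac_lt (a b n d : Z) : Z.ltb 0 b -> Z.ltb 0 d ->
  Z.ltb 0 (Z.add (Z.mul b n) (Z.mul (-1) (Z.mul a d))) ->
  of_Z R a / of_Z R b < of_Z R n / of_Z R d.
Proof.
move=> /(of_Z_gt0 R) b0 /(of_Z_gt0 R) d0 /of_Z_lt; rewrite !of_ZM => lt_ad.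
by rewrite ltr_pdivrMr // mulrAC ltr_pdivlMr // (mulrC (of_Z R n)).
Qed.

Lemma PQ_lt (n d n' d' : Z) :
  sum_cert n d n' d' (addp (scalep (-1) Ppoly) (scalep (-25) m2poly))
    (scalep (-1) Qpoly) mpoly ->
  0 < evalZ mpoly (of_Z R n / of_Z R d) ->
  ratZ Ppoly mpoly (of_Z R n / of_Z R d) + ratZ Qpoly mpoly (of_Z R n' / of_Z R d') < - 25.
Proof.
move=> /(@sum_certP R) + m0; rewrite ratZ_lin // ratZ_m2 // ratZN.
rewrite (_ : of_Z R (-1) = -1) // (_ : of_Z R (-25) = -25) //.
move: (ratZ Ppoly _ _) (ratZ Qpoly _ _) => s t; clear; lra.
Qed.

Lemma PQ_gt (n d n' d' : Z) :
  sum_cert n d n' d' (addp (scalep 1 Ppoly) (scalep 25 m2poly)) Qpoly mpoly ->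
  0 < evalZ mpoly (of_Z R n / of_Z R d) ->
  - 25 < ratZ Ppoly mpoly (of_Z R n / of_Z R d) + ratZ Qpoly mpoly (of_Z R n' / of_Z R d').
Proof.
move=> /(@sum_certP R) + m0; rewrite ratZ_lin // ratZ_m2 //.
rewrite (_ : of_Z R 1 = 1) // (_ : of_Z R 25 = 25) //.
move: (ratZ Ppoly _ _) (ratZ Qpoly _ _) => s t; clear; lra.
Qed.

(* The solution is w = 1.19002780739 and v = 1.33357765968, up to 10^-11. *)
Definition ten9 : Z := 1000000000.

Lemma exists_bal : exists w v : R,
  [/\ of_Z R 1190027806 / of_Z R ten9 <= w <= of_Z R 1190027809 / of_Z R ten9,
      of_Z R 1333577655 / of_Z R ten9 <= v <= of_Z R 1333577664 / of_Z R ten9,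
      Lam w = Lam v & ratZ Ppoly mpoly w + ratZ Qpoly mpoly v = - 25].
Proof.
have w1l : 11 / 10 <= of_Z R 1190027806 / of_Z R ten9.
  by apply: nat_frac_le; vm_compute.
have w2u : of_Z R 1190027809 / of_Z R ten9 <= 49 / 40.
  by apply: frac_nat_le; vm_compute.
have v1l : 127 / 100 <= of_Z R 1333577655 / of_Z R ten9.
  by apply: nat_frac_le; vm_compute.
have v2u : of_Z R 1333577664 / of_Z R ten9 <= 67 / 50.
  by apply: frac_nat_le; vm_compute.
have mw (w : R) : 11 / 10 <= w -> 0 < evalZ mpoly w.
  by move=> w1; apply: m_gt0; clear -w1; lra.
have w12 : of_Z R 1190027806 / of_Z R ten9 < of_Z R 1190027809 / of_Z R ten9.
  by apply: frac_lt; vm_compute.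
apply: (@exists_pair _ _ _ (of_Z R 133357765967783 / of_Z R 100000000000000)).
- exact: w1l.
- exact: w12.
- exact: w2u.
- exact: v1l.
- by apply: frac_lt; vm_compute.
- by apply: frac_lt; vm_compute.
- exact: v2u.
- by apply: Lam_lt; vm_compute.
- by apply: Lam_lt; vm_compute.
- by apply: Lam_lt; vm_compute.
- by apply: Lam_lt; vm_compute.
- by apply: PQ_lt; [vm_compute | apply: mw; apply: le_trans w1l (ltW w12)].
- by apply: PQ_gt; [vm_compute | apply: mw].
Qed.

End Existence.


(** * Decimal approximation of the solution *)

Section Decimals.
Variable R : realType.
Implicit Types (w v x y : R).

Definition tenZ (k : nat) : Z := iter k (Z.mul 10) 1%BinZ.

Lemma of_Z_ten k : of_Z R (tenZ k) = 10 ^+ k.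
Proof. by elim: k => [|k IH] //; rewrite exprS -IH (_ : 10 = of_Z R 10) // -of_ZM. Qed.

Fixpoint digits (ds : seq nat) : Z :=
  if ds is d :: ds' then Z.add (Z.mul (Z.of_nat d) (tenZ (3 * size ds'))) (digits ds')
  else 0%BinZ.

Lemma decimal_digits ds : decimal R ds * 10 ^+ (3 * size ds) = 1000 * of_Z R (digits ds).
Proof.
have t3 : 10 ^+ 3 = 1000 :> R by rewrite -natrX.
elim: ds => [|d ds IH]; first by rewrite /= mul0r mulr0.
rewrite [decimal _ _]/= [digits _]/= -/(decimal R ds) of_ZD of_ZM of_Z_nat of_Z_ten.
rewrite (mulrDr 1000) -IH [size _]/= mulnS exprD t3.
move: (decimal R ds) (10 ^+ _) => D T; by field.
Qed.

Lemma decimal5 d0 d1 d2 d3 d4 :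
  decimal R [:: d0; d1; d2; d3; d4]
  = of_Z R (digits [:: d0; d1; d2; d3; d4]) / of_Z R (tenZ 12).
Proof.
have t15 : 10 ^+ (3 * 5) = 1000 * 10 ^+ 12 :> R.
  have t3 : 10 ^+ 3 = 1000 :> R by rewrite -natrX.
  by rewrite -t3 -exprD.
have t0 : (10 : R) ^+ 12 != 0 by rewrite expf_neq0 // pnatr_eq0.
have := decimal_digits [:: d0; d1; d2; d3; d4].
rewrite [size _]/= t15 of_Z_ten mulrCA => /mulfI E.
by rewrite -E ?mulfK // pnatr_eq0.
Qed.

(** The error [10 ^+ 4] in units of [(10 ^+ 12)^-1] is the tolerance 10^-8. *)
Lemma near_cert (a c b d D : Z) (num den : seq Z) x : 0 < evalZ den x ->
  of_Z R a <= of_Z R c * x -> of_Z R d * x < of_Z R b ->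
  pos_cert a c b d (addp (scalep (tenZ 12) num)
    (scalep (Z.mul (-1) (Z.add D (Z.mul (-1) (tenZ 4)))) den)) ->
  pos_cert a c b d (addp (scalep (Z.add D (tenZ 4)) den)
    (scalep (Z.mul (-1) (tenZ 12)) num)) ->
  `|evalZ num x / evalZ den x - of_Z R D / of_Z R (tenZ 12)| <= (10 ^+ 8)^-1.
Proof.
move=> den0 xl xu /pos_certP/(_ xl xu) + /pos_certP/(_ xl xu).
rewrite !evalD !evalC (of_ZM _ (-1) (tenZ 12)) (of_ZM _ (-1) (Z.add _ _)) !of_ZD.
rewrite (of_ZM _ (-1) (tenZ 4)) !of_Z_ten (_ : of_Z R (-1) = -1) //.
have -> : (10 ^+ 8)^-1 = 10 ^+ 4 / 10 ^+ 12 :> R.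
  have t0 k : (10 : R) ^+ k != 0 by rewrite expf_neq0 // pnatr_eq0.
  have e : (10 : R) ^+ 12 = 10 ^+ 4 * 10 ^+ 8 := exprD 10 4 8.
  rewrite e; move: (t0 4) (t0 8); move: (10 ^+ 4) (10 ^+ 8) => s t s0 t0'.
  by field; rewrite s0 t0'.
have : 0 < (10 : R) ^+ 12 by rewrite exprn_gt0 // ltr0n.
move: (evalZ num x) (evalZ den x) den0 (10 ^+ 12) (10 ^+ 4) (of_Z R D).
move=> n e e0 K H d' K0 lo hi.
have -> : n / e - d' / K = (n * K - d' * e) / (e * K).
  by field; rewrite (gt_eqF e0) (gt_eqF K0).
have -> : H / K = (H * e) / (e * K) by field; rewrite (gt_eqF e0) (gt_eqF K0).
rewrite ler_norml -mulNr !ler_pM2r ?invr_gt0 ?mulr_gt0 //.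
by apply/andP; split; nra.
Qed.

End Decimals.

(** * Solutions of the Einstein equations *)

Section Solutions.
Variable R : realType.
Implicit Types (p q A B w v x y : R).

Definition einstein_eqs p q A B : Prop := exists lam : R,
  [/\ ric_q p A = lam * p, ric_q q B = lam * q,
      ric_u 9 p A = lam * (A / 2), ric_u 9 q B = lam * (B / 2)
    & ric_3 9 p q A B = lam].

Lemma einstein_eqs_swap p q A B : einstein_eqs p q A B -> einstein_eqs q p B A.
Proof.
case=> lam [e1 e2 e3 e4 e5]; exists lam; split=> //; rewrite -e5 /ric_3.
by congr (_ + _ * _ + _ * _); rewrite addrC.
Qed.

Definition bal_pair w v : Prop :=
  [/\ 559 / 500 <= w <= 49 / 40, 32 / 25 <= v <= 167 / 125, Lam w = Lam v
    & Sig w + Sig v + 5 = 18 * Lam w].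

Lemma einstein_eqs_param w v : 0 < w -> 0 < 10 * w ^+ 2 - 9 -> 0 < v ->
  0 < 10 * v ^+ 2 - 9 -> Lam w = Lam v -> Sig w + Sig v + 5 = 18 * Lam w ->
  einstein_eqs (w * Aof w) (v * Aof v) (Aof w) (Aof v).
Proof.
move=> w0 Nw v0 Nv LL SS.
have [_ e1 e2] := block_param_inv w0 Nw; have [_ e3 e4] := block_param_inv v0 Nv.
exists (Lam w / 2); split=> //; [by rewrite LL | by rewrite LL |].
by apply/ric_3_param => //; rewrite SS; field.
Qed.

Lemma quadF_Aof x : (quadF x == 0) = (Aof x == 1).
Proof.
have E0 := E_gt0 x; rewrite /Aof /quadF; apply/eqP/eqP => e.
  by apply: (canLR (mulfK _)); [rewrite gt_eqF // mulr_gt0 | rewrite mul1r; lra].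
have E1 : 2 * (20 * x ^+ 2 - 36 * x + 17) != 0 by rewrite gt_eqF // mulr_gt0.
have := divfK E1 (10 * x ^+ 2 - 9); rewrite e mul1r; clear; lra.
Qed.

(** Equal ratios make both shares [Fof w] equal, hence zero, so that [w] is a root
    of [quadF]; at such a root [A = 1]. *)
Lemma einstein_eqs_equal p q A B : 0 < p -> 0 < q -> 0 < A -> 0 < B ->
  einstein_eqs p q A B -> p / A = q / B ->
  [/\ p = q, A = 1, B = 1 & quadF p = 0].
Proof.
move=> p0 q0 A0 B0 [lam [e1 e2 e3 e4 e5]].
have /= := block_param q0 B0 e2 e4; have /= := block_param p0 A0 e1 e3.
move: (p / A) (q / B) => w v [w0 Nw AE pE lamE] [_ _ BE qE _] vw.
rewrite -{v}vw in BE qE.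
have : ric_3 9 (w * Aof w) (w * Aof w) (Aof w) (Aof w) = lam by move: e5; rewrite pE qE AE BE.
move/ric_3_param => /(_ w0 Nw w0 Nw) S.
have Fw : Fof w = 0 by move: S; rewrite /Fof lamE; clear; lra.
have mw : 0 < evalZ mpoly w by rewrite evalZ_m mulr_gt0.
have [F1 F2] := Fof_quadF w0 mw (dom_ge w0 Nw).
have qF : quadF w = 0 by apply/eqP; rewrite eq_le F1 ?F2 // Fw.
have A1 : Aof w = 1 by apply/eqP; rewrite -quadF_Aof qF.
by rewrite pE qE AE BE A1 mulr1.
Qed.

Lemma einstein_eqs_sym p : 0 < p -> quadF p = 0 -> einstein_eqs p p 1 1.
Proof.
move=> p0 qp; have /andP[p1 _] : 559 / 500 <= p <= 641 / 500 by apply: quadF_le0; rewrite qp.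
have p2 : 19 / 20 <= p by clear -p1; lra.
have A1 : Aof p = 1 by apply/eqP; rewrite -quadF_Aof qp.
have := @einstein_eqs_param p p p0 (N_gt0 p2) p0 (N_gt0 p2) erefl.
rewrite A1 mulr1; apply.
have [c c0] := Fof_factor p2; rewrite qp mulr0 /Fof.
by clear; lra.
Qed.

Lemma einstein_eqs_bal p q A B : 0 < p -> 0 < q -> 0 < A -> 0 < B ->
  einstein_eqs p q A B -> p / A != q / B ->
  exists w v, bal_pair w v /\
    ([/\ p = w * Aof w, q = v * Aof v, A = Aof w & B = Aof v] \/
     [/\ p = v * Aof v, q = w * Aof w, A = Aof v & B = Aof w]).
Proof.
move=> p0 q0 A0 B0 e ne.
wlog FF : p q A B p0 q0 A0 B0 e ne / Fof (p / A) <= Fof (q / B).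
  move=> H; have [/H|/ltW/H] := leP (Fof (p / A)) (Fof (q / B)); first exact.
  have ne' : q / B != p / A by rewrite eq_sym.
  move=> /(_ q0 p0 B0 A0 (einstein_eqs_swap e) ne') [w [v [bal [[-> -> -> ->]|[-> -> -> ->]]]]].
    by exists w, v; split=> //; right.
  by exists w, v; split=> //; left.
case: e => lam [e1 e2 e3 e4 e5].
have /= := block_param q0 B0 e2 e4; have /= := block_param p0 A0 e1 e3.
move: (p / A) (q / B) ne FF => w v ne FF [w0 Nw AE pE lamE] [v0 Nv BE qE lamE'].
have LL : Lam w = Lam v by move: lamE lamE' => ->; move: (Lam w) (Lam v); clear => l l'; lra.
have SS : Sig w + Sig v + 5 = 18 * Lam w.
  have : ric_3 9 (w * Aof w) (v * Aof v) (Aof w) (Aof v) = lam by move: e5; rewrite pE qE AE BE.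
  by move/ric_3_param => ->//; rewrite lamE; field.
have [w1 v1] := locate w0 Nw v0 Nv LL SS ne FF.
by exists w, v; split; [split | left; split].
Qed.

Lemma bal_pair_eqs w v : bal_pair w v ->
  [/\ 0 < w * Aof w, 0 < v * Aof v, 0 < Aof w & 0 < Aof v] /\
  einstein_eqs (w * Aof w) (v * Aof v) (Aof w) (Aof v).
Proof.
case=> /andP[w1 _] /andP[v1 _] LL SS.
have w2 : 19 / 20 <= w by clear -w1; lra.
have v2 : 19 / 20 <= v by clear -v1; lra.
have w0 : 0 < w by clear -w2; lra.
have v0 : 0 < v by clear -v2; lra.
have Nw := N_gt0 w2; have Nv := N_gt0 v2.
have [Aw _ _] := block_param_inv w0 Nw; have [Av _ _] := block_param_inv v0 Nv.
by split; [split=> //; apply: mulr_gt0 | apply: einstein_eqs_param].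
Qed.

Lemma near_interval (n d n' d' : Z) x :
  Z.ltb 0 d -> Z.ltb 0 d' -> of_Z R n / of_Z R d <= x <= of_Z R n' / of_Z R d' ->
  of_Z R n <= of_Z R d * x /\ of_Z R d' * x < of_Z R (Z.add n' 1).
Proof.
move=> /(of_Z_gt0 R) d0 /(of_Z_gt0 R) d'0 /andP[].
rewrite ler_pdivrMr // ler_pdivlMr // [x * _]mulrC [x * _]mulrC => -> xu; split=> //.
apply: le_lt_trans xu _; rewrite of_ZD (_ : of_Z R 1 = 1) //.
by rewrite ltrDl ltr01.
Qed.

Lemma Aof_quot x :
  Aof x = evalZ [:: -9; 0; 10]%BinZ x / evalZ (scalep 2 Epoly) x
  /\ x * Aof x = evalZ mpoly x / evalZ (scalep 2 Epoly) x.
Proof.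
have NE : evalZ [:: -9; 0; 10]%BinZ x = 10 * x ^+ 2 - 9.
  rewrite /= (_ : of_Z R 0 = 0) // (_ : of_Z R (-9) = -9) // (_ : of_Z R 10 = 10) //.
  by ring.
rewrite evalC evalZ_m evalZ_E (_ : of_Z R 2 = 2) // NE /Aof.
by split=> //; rewrite mulrA.
Qed.

Lemma exists_bal_pair : exists w v, bal_pair w v /\
  near_bal (w * Aof w) (v * Aof v) (Aof w) (Aof v).
Proof.
have [w [v [wI vI LL PQ]]] := exists_bal R.
exists w, v; split.
  have [/andP[w1 w2] /andP[v1 v2]] := (wI, vI).
  have w3 : 559 / 500 <= w.
    by apply: le_trans w1; apply: nat_frac_le; vm_compute.
  have w4 : w <= 49 / 40.
    by apply: le_trans w2 _; apply: frac_nat_le; vm_compute.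
  have v3 : 32 / 25 <= v.
    by apply: le_trans v1; apply: nat_frac_le; vm_compute.
  have v4 : v <= 167 / 125.
    by apply: le_trans v2 _; apply: frac_nat_le; vm_compute.
  have w5 : 19 / 20 <= w by clear -w3; lra.
  have v5 : 19 / 20 <= v by clear -v3; lra.
  split; [by rewrite w3 | by rewrite v3 | by [] | exact: ((PQ_sum w5 v5 LL).2 PQ)].
have ten_gt0 : Z.ltb 0 ten9 by [].
have [w1 w2] := near_interval ten_gt0 ten_gt0 wI.
have [v1 v2] := near_interval ten_gt0 ten_gt0 vI.
have E2 x : 0 < evalZ (scalep 2 Epoly) x.
  by rewrite evalC evalZ_E mulr_gt0 ?E_gt0 // (_ : of_Z R 2 = 2) // ltr0n.
have [Aw pw] := Aof_quot w; have [Av qv] := Aof_quot v.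
rewrite /near_bal !decimal5 pw qv Aw Av; split.
- by apply: (near_cert (E2 w) w1 w2); vm_compute.
- by apply: (near_cert (E2 v) v1 v2); vm_compute.
- by apply: (near_cert (E2 w) w1 w2); vm_compute.
- by apply: (near_cert (E2 v) v1 v2); vm_compute.
Qed.

Lemma decimal_range ds : all (fun d => d < 1000)%N ds -> 0 <= decimal R ds <= 1000.
Proof.
elim: ds => [|d ds IH]; first by rewrite /= lexx ler0n.
case/andP=> d1 /IH; rewrite [decimal _ (_ :: _)]/= -/(decimal R ds).
move: (decimal R ds) => r /andP[r0 r1].
have d0 : 0 <= d%:R :> R by rewrite ler0n.
have {}d1 : d%:R + 1 <= 1000 :> R by rewrite natr1 ler_nat.
by apply/andP; split; clear -r0 r1 d0 d1; lra.
Qed.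

Lemma decimal_near d0 d1 ds x : all (fun d => d < 1000)%N ds ->
  `|x - decimal R [:: d0, d1 & ds]| <= (10 ^+ 8)^-1 ->
  d0%:R + (d1%:R - 1) / 1000 <= x <= d0%:R + (d1%:R + 2) / 1000.
Proof.
have e : (10 ^+ 8)^-1 <= 1 / 1000 :> R.
  rewrite mul1r lef_pV2 ?posrE ?exprn_gt0 ?ltr0n //.
  by rewrite (_ : 1000 = 10 ^+ 3) -?natrX // ler_nat leq_exp2l.
move=> /decimal_range; rewrite ler_distl [decimal _ (_ :: _)]/=.
rewrite -/(decimal R ds).
move: (decimal R ds) (10 ^+ 8)^-1 e => r eps e /andP[r0 r1] /andP[x1 x2].
by apply/andP; split; clear -e r0 r1 x1 x2; lra.
Qed.

Lemma near_bal_bounds p q A B : near_bal p q A B ->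
  [/\ 123 / 100 < p < 124 / 100, 128 / 100 < q, 103 / 100 < A & 96 / 100 < B].
Proof.
case=> /decimal_near-/(_ isT)/andP[p1 p2] /decimal_near-/(_ isT)/andP[q1 _].
move=> /decimal_near-/(_ isT)/andP[A1 _] /decimal_near-/(_ isT)/andP[B1 _].
split; first by apply/andP; split; [clear -p1; lra | clear -p2; lra].
- by clear -q1; lra.
- by clear -A1; lra.
- by clear -B1; lra.
Qed.

End Solutions.


(** * Classification of the Einstein metrics *)

Section Classification.
Variable R : realType.
Implicit Types (p q A B w v x y : R).

Lemma quadF_roots : exists r1 r2 : R, [/\ 0 < r1, 0 < r2, r1 != r2,
  quadF r1 = 0 /\ quadF r2 = 0 & forall x, quadF x = 0 -> x = r1 \/ x = r2].
Proof.
pose s : R := Num.sqrt 6.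
have s2 : s ^+ 2 = 6 by rewrite sqr_sqrtr // ler0n.
have s0 : 0 < s by rewrite sqrtr_gt0 ltr0n.
have s3 : s < 3 by rewrite ltNge; apply/negP => H; clear -s2 H; nra.
exists ((36 - s) / 30), ((36 + s) / 30); split.
- by clear -s3; lra.
- by clear -s0; lra.
- by apply/eqP => e; clear -s0 e; lra.
- by rewrite /quadF; split; clear -s2; lra.
move=> x qx; have /eqP : (30 * x - 36 + s) * (30 * x - 36 - s) = 0.
  by move: qx; rewrite /quadF; clear -s2; lra.
by rewrite mulf_eq0 => /orP[] /eqP e; [left | right]; clear -e; lra.
Qed.

Lemma einstein9P p q A B : 0 < p -> 0 < q -> 0 < A -> 0 < B ->
  einstein4 (@metric R 9 p q A B) <-> einstein_eqs p q A B.
Proof. exact: einstein_metricP. Qed.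

Lemma fixed_metric_params (g : fourfold R 9 -> fourfold R 9 -> R) :
  fixed_metric g -> einstein4 g ->
  exists p q A B, [/\ [/\ 0 < p, 0 < q, 0 < A & 0 < B],
    homothetic (tangent R 9) g (metric p q A B) & einstein_eqs p q A B].
Proof.
move=> fg eg; have n1 : (1 < 9)%N by [].
have [p [q [A [B [[p0 q0 A0 B0] h]]]]] := fixed_metric_homothetic n1 fg.
exists p, q, A, B; split=> //; apply/einstein9P => //.
exact: einstein4_homothetic (metric_fixed n1 p0 q0 A0 B0) h eg.
Qed.

End Classification.

Theorem theorem7p25 (R : realType) :
  (exists p q A B : R,
     [/\ near_bal p q A B,
         einstein4 (@metric R 9 p q A B),
         (forall p' q' A' B' : R, near_bal p' q' A' B' ->
            einstein4 (@metric R 9 p' q' A' B') ->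
            [/\ p' = p, q' = q, A' = A & B' = B]),
         fixed_metric (@metric R 9 p q A B)
           /\ ~ symmetric_metric (@metric R 9 p q A B)
       & forall g : fourfold R 9 -> fourfold R 9 -> R,
           fixed_metric g -> einstein4 g -> ~ symmetric_metric g ->
           homothetic (tangent R 9) g (metric p q A B)
           \/ homothetic (tangent R 9) g (metric q p B A)])
  /\
  (exists g1 g2 : fourfold R 9 -> fourfold R 9 -> R,
     [/\ [/\ fixed_metric g1, einstein4 g1 & symmetric_metric g1],
         [/\ fixed_metric g2, einstein4 g2 & symmetric_metric g2],
         ~ homothetic (tangent R 9) g1 g2
       & forall g : fourfold R 9 -> fourfold R 9 -> R,
           fixed_metric g -> einstein4 g -> symmetric_metric g ->
           homothetic (tangent R 9) g g1 \/ homothetic (tangent R 9) g g2]).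
Proof.
have n1 : (1 < 9)%N by [].
split; last first.
  have [r1 [r2 [r10 r20 r12 [q1 q2] roots]]] := quadF_roots R.
  have sym r : 0 < r -> quadF r = 0 -> [/\ fixed_metric (@metric R 9 r r 1 1),
      einstein4 (@metric R 9 r r 1 1) & symmetric_metric (@metric R 9 r r 1 1)].
    move=> r0 qr; split; first exact: metric_fixed.
      by apply/einstein9P => //; apply: einstein_eqs_sym.
    by apply/symmetric_metricP.
  exists (metric r1 r1 1 1), (metric r2 r2 1 1); split; [exact: sym | exact: sym | |].
    by move/(homothetic_metric_inj n1) => [e _ _ _]; rewrite e eqxx in r12.
  move=> g fg eg [p p0 h].
  have ep : einstein_eqs p p 1 1.
    apply/einstein9P => //.
    exact: einstein4_homothetic (metric_fixed n1 p0 p0 ltr01 ltr01) h eg.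
  have [_ _ _ /roots[e|e]] := einstein_eqs_equal p0 p0 ltr01 ltr01 ep erefl.
    by left; rewrite -e.
  by right; rewrite -e.
have [w [v [bal near]]] := exists_bal_pair R.
have [[p0 q0 A0 B0] eqs] := bal_pair_eqs bal.
have [_ q1 A1 _] := near_bal_bounds near.
have cls p q A B : 0 < p -> 0 < q -> 0 < A -> 0 < B -> einstein_eqs p q A B ->
  [\/ [/\ p = q, A = 1 & B = 1],
      [/\ p = w * Aof w, q = v * Aof v, A = Aof w & B = Aof v]
    | [/\ p = v * Aof v, q = w * Aof w, A = Aof v & B = Aof w]].
  move=> {}p0 {}q0 {}A0 {}B0 e; have [eq_ratio|ne] := eqVneq (p / A) (q / B).
    by have [-> -> -> _] := einstein_eqs_equal p0 q0 A0 B0 e eq_ratio; constructor 1.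
  have [w' [v' [[w1 v1 L1 S1] H]]] := einstein_eqs_bal p0 q0 A0 B0 e ne.
  have [w2 v2 L2 S2] := bal.
  have [ew ev] := located_unique w1 v1 w2 v2 L1 S1 L2 S2.
  by rewrite ew ev in H; case: H; [constructor 2 | constructor 3].
exists (w * Aof w), (v * Aof v), (Aof w), (Aof v); split.
- exact: near.
- exact/einstein9P.
- move=> p' q' A' B' near'; have [/andP[p1 p2] q1' A1' B1'] := near_bal_bounds near'.
  have p'0 : 0 < p' by clear -p1; lra.
  have q'0 : 0 < q' by clear -q1'; lra.
  have A'0 : 0 < A' by clear -A1'; lra.
  have B'0 : 0 < B' by clear -B1'; lra.
  move/einstein9P => /(_ p'0 q'0 A'0 B'0) /cls-/(_ p'0 q'0 A'0 B'0).
  case=> [[_ e _]|//|[e _ _ _]]; exfalso.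
    by rewrite e in A1'; clear -A1'; lra.
  by rewrite -e in q1; clear -q1 p2; lra.
- split; first exact: metric_fixed.
  move/symmetric_metricP => /(_ n1 p0)[_ e _].
  by rewrite e in A1; clear -A1; lra.
- move=> g fg eg nsg.
  have [p [q [A [B [[p'0 q'0 A'0 B'0] h e]]]]] := fixed_metric_params fg eg.
  case: (cls p q A B p'0 q'0 A'0 B'0 e) => [[eq_pq eA eB]|[<- <- <- <-]|[<- <- <- <-]].
  + case: nsg; exists p => //.
    by move: h; rewrite eA eB -eq_pq.
  + by left.
  + by right.
Qed.
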